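(* For $c_1,c_2,c_3$ and $n\in\mathbb{N}$ let $M(1,c_1,c_2,c_3;n)$ be the number of $(x_1,\dots,x_8)\in\mathbb{Z}^8$ with $n=(x_1^2+x_1x_2+x_2^2)+c_1(x_3^2+x_3x_4+x_4^2)+c_2(x_5^2+x_5x_6+x_6^2)+c_3(x_7^2+x_7x_8+x_8^2)$. Let $(c_1,c_2,c_3)$ be one of the 19 triples $(1,1,2),(1,1,4),(1,1,8),(1,2,2),(1,2,4),(1,2,8),(1,4,4),(1,4,8),(1,8,8),(2,2,2),(2,2,4),(2,2,8),(2,4,4),(2,4,8),(2,8,8),(4,4,4),(4,4,8),(4,8,8),(8,8,8)$. Then for every $n\in\mathbb{N}$, $$M(1,c_1,c_2,c_3;n)=\sum_{i=1}^{16}\nu_iA_i(n),$$ where $A_i(n)$ are the Fourier coefficients of the functions $f_i$ in the context and $(\nu_1,\dots,\nu_{16})$ is the vector assigned to $(1,c_1,c_2,c_3)$ in the table in the context.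
   Context: $q=e^{2\pi iz}$, $\eta(z)=q^{1/24}\prod_{n\ge1}(1-q^n)$, $E_4(z)=1+240\sum_{n\ge1}\sigma_3(n)q^n$. Put $f_{4,6}(z)=\eta^2(z)\eta^2(2z)\eta^2(3z)\eta^2(6z)$, $f_{4,8}(z)=\eta^4(2z)\eta^4(4z)$, $f_{4,12}(z)=\eta^{-1}(z)\eta^{2}(2z)\eta^{3}(3z)\eta^{3}(4z)\eta^{2}(6z)\eta^{-1}(12z)-\eta^{3}(z)\eta^{2}(2z)\eta^{-1}(3z)\eta^{-1}(4z)\eta^{2}(6z)\eta^{3}(12z)$, $f_{4,24}(z)=\eta^{-4}(z)\eta^{11}(2z)\eta^{-4}(3z)\eta^{-3}(4z)\eta^{11}(6z)\eta^{-3}(12z)=\sum a_{4,24}(n)q^n$. Set $f_1,\dots,f_8=E_4(tz)$ for $t=1,2,3,4,6,8,12,24$ respectively, $f_9=f_{4,6}(z)$, $f_{10}=f_{4,6}(2z)$, $f_{11}=f_{4,6}(4z)$, $f_{12}=f_{4,8}(z)$, $f_{13}=f_{4,8}(3z)$, $f_{14}=f_{4,12}(z)$, $f_{15}=f_{4,12}(2z)$, $f_{16}=\sum_{n\ \mathrm{odd}}a_{4,24}(n)q^n$; $f_i(z)=\sum_{n\ge0}A_i(n)q^n$. Table of $(\nu_1,\dots,\nu_{16})$: (1,1,1,2): 3/40, -1/5, -27/40, 0, 9/5, 0, 0, 0, 0, 0, 0, 0, 0, 0, 0, 0. (1,1,1,4): 3/100, -9/100, 27/100, 4/25, -81/100,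 0, 36/25, 0, 54/5, 432/5, 0, 0, 0, 0, 0, 0. (1,1,1,8): 3/160, -9/160, -27/160, 9/80, 81/160, -1/5, -81/80, 9/5, 0, 0, 0, -27/4, 243/4, 0, 81, 81/4. (1,1,2,2): 1/50, 2/25, 9/50, 0, 18/25, 0, 0, 0, 36/5, 0, 0, 0, 0, 0, 0, 0. (1,1,2,4): 1/80, 1/16, -9/80, -1/5, -9/16, 0, 9/5, 0, 0, 0, 0, 0, 0, 9, 0, 0. (1,1,2,8): 1/200, 1/40, 9/200, -9/100, 9/40, 4/25, -81/100, 36/25, 9/5, 144/5, 1152/5, 9, 81, 0, 0, 0. (1,1,4,4): 1/200, 3/200, 9/200, 2/25, 27/200, 0, 18/25, 0, 54/5, 216/5, 0, 0, 0, 0, 0, 0. (1,1,4,8): 1/320, 3/320, -9/320, 1/16, -27/320, -1/5, -9/16, 9/5, 0, 0, 0, 9/4, -81/4, 9/4, 27, 27/4. (1,1,8,8): 1/800, 3/800, 9/800, 3/200, 27/800, 2/25, 27/200, 18/25, 36/5, 234/5, 576/5, 9/2, 81/2, 0, 0, 0. (1,2,2,2): 1/40, -3/20, -9/40, 0, 27/20, 0, 0, 0, 0, 0, 0, 0, 0, 0, 0, 0. (1,2,2,4): 1/100, -7/100, 9/100, 4/25, -63/100, 0, 36/25, 0, 18/5, 72/5, 0, 0, 0, 0, 0, 0. (1,2,2,8): 1/160, -7/160, -9/160, 9/80, 63/160, -1/5, -81/80, 9/5, 0, 0, 0, -9/4, 81/4, 0, 9, 27/4. (1,2,4,4): 1/160,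 -1/32, -9/160, -1/10, 9/32, 0, 9/10, 0, 0, 0, 0, 0, 0, 9/2, 0, 0. (1,2,4,8): 1/400, -1/80, 9/400, -1/20, -9/80, 4/25, -9/20, 36/25, 9/10, 27/5, 72/5, 9/2, 81/2, 0, 0, 0. (1,2,8,8): 1/640, -1/128, -9/640, -3/160, 9/128, -1/10, 27/160, 9/10, 0, 0, 0, -9/8, 81/8, 27/8, 9/2, 27/8. (1,4,4,4): 1/400, -9/400, 9/400, 3/25, -81/400, 0, 27/25, 0, 27/5, 54/5, 0, 0, 0, 0, 0, 0. (1,4,4,8): 1/640, -9/640, -9/640, 7/80, 81/640, -1/5, -63/80, 9/5, 0, 0, 0, 9/8, -81/8, 9/8, 0, 27/8. (1,4,8,8): 1/1600, -9/1600, 9/1600, 1/40, -81/1600, 2/25, 9/40, 18/25, 18/5, 36/5, 36/5, 9/4, 81/4, 0, 0, 0. (1,8,8,8): 1/2560, -9/2560, -9/2560, 9/320, 81/2560, -3/20, -81/320, 27/20, 0, 0, 0, 27/32, -243/32, 81/32, 0, 81/32. *)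

(* Defs.v *)
From mathcomp Require Import all_boot all_algebra.
Set Implicit Arguments. Unset Strict Implicit. Unset Printing Implicit Defensive.
Import GRing.Theory Num.Theory.
Local Open Scope ring_scope.

Definition series := nat -> int.

Definition smul (s t : series) : series :=
  fun n => \sum_(0 <= i < n.+1) s i * t (n - i)%N.
Definition sone : series := fun n => (n == 0%N)%:R.

(* (1 - q^j)  (used with j >= 1) *)
Definition fac1 (j : nat) : series :=
  fun n => if n == 0%N then 1 else if n == j then -1 else 0.
(* (1 - q^j)^{-1} = sum_t q^{j t}  (used with j >= 1) *)
Definition ifac1 (j : nat) : series := fun n => if (j %| n)%N then 1 else 0.

Definition spow (s : series) (k : nat) : series := iter k (smul s) sone.

Definition facpow (j : nat) (e : int) : series :=
  match e with
  | Posz k => spow (fac1 j) k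
  | Negz k => spow (ifac1 j) k.+1
  end.

(* prod_{m=1}^{N} prod_{(k,e) in l} (1 - q^{k m})^e ; for coefficients of index <= N
   this agrees with the infinite product prod_{m>=1} prod_{(k,e)} (1-q^{km})^e,
   since the factors with k m > N are 1 + O(q^{N+1}). *)
Definition prodq (l : seq (nat * int)) (N : nat) : series :=
  \big[smul/sone]_(m <- iota 1 N) \big[smul/sone]_(p <- l) facpow (p.1 * m)%N p.2.

(* eta quotient prod_{(k,e) in l} eta(k z)^e, with eta(z) = q^{1/24} prod (1-q^n).
   Its leading power is q^{(sum k e)/24}; in all uses below sum k e is divisible by 24. *)
Definition eta_weight (l : seq (nat * int)) : int := \sum_(p <- l) (p.1)%:Z * p.2.
Definition etaq (l : seq (nat * int)) : series :=
  fun n => match (n%:Z - (eta_weight l %/ 24)%Z) with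
           | Posz k => prodq l k k
           | Negz _ => 0
           end.

Definition sigma3 (m : nat) : nat := \sum_(d <- divisors m) d ^ 3.

Definition E4t (t : nat) : series :=
  fun n => if n == 0%N then 1
           else if (t %| n)%N then 240 * (sigma3 (n %/ t))%:Z else 0.

Definition rescale (d : nat) (s : series) : series :=
  fun n => if (d %| n)%N then s (n %/ d)%N else 0.

Definition ep (k : nat) (e : int) : nat * int := (k, e).

Definition f4_6 : series := etaq [:: ep 1 (2); ep 2 (2); ep 3 (2); ep 6 (2)].
Definition f4_8 : series := etaq [:: ep 2 (4); ep 4 (4)].
Definition f4_12 : series :=
  fun n => etaq [:: ep 1 (-1); ep 2 (2); ep 3 (3); ep 4 (3); ep 6 (2); ep 12 (-1)] n
         - etaq [:: ep 1 (3); ep 2 (2); ep 3 (-1); ep 4 (-1); ep 6 (2); ep 12 (3)] n.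
Definition f4_24 : series :=
  etaq [:: ep 1 (-4); ep 2 (11); ep 3 (-4); ep 4 (-3); ep 6 (11); ep 12 (-3)].

Definition A (i : nat) : series :=
  match i with
  | 1 => E4t 1 | 2 => E4t 2 | 3 => E4t 3 | 4 => E4t 4
  | 5 => E4t 6 | 6 => E4t 8 | 7 => E4t 12 | 8 => E4t 24
  | 9 => f4_6 | 10 => rescale 2 f4_6 | 11 => rescale 4 f4_6
  | 12 => f4_8 | 13 => rescale 3 f4_8
  | 14 => f4_12 | 15 => rescale 2 f4_12
  | 16 => fun n => if odd n then f4_24 n else 0
  | _ => fun _ => 0
  end%N.

Definition quad (a b : int) : int := a ^+ 2 + a * b + b ^+ 2.
Definition Qform (c1 c2 c3 : nat) (x : {ffun 'I_8 -> int}) : int :=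
  quad (x (inord 0)) (x (inord 1))
  + c1%:Z * quad (x (inord 2)) (x (inord 3))
  + c2%:Z * quad (x (inord 4)) (x (inord 5))
  + c3%:Z * quad (x (inord 6)) (x (inord 7)).

Definition fr (a b : int) : rat := a%:~R / b%:~R.

Definition nu_table : seq ((nat * nat * nat) * seq rat) := [::
 ((1,1,2)%N, [:: fr 3 40; fr (-1) 5; fr (-27) 40; 0; fr 9 5; 0; 0; 0; 0; 0; 0; 0; 0; 0; 0; 0]);
 ((1,1,4)%N, [:: fr 3 100; fr (-9) 100; fr 27 100; fr 4 25; fr (-81) 100; 0; fr 36 25; 0; fr 54 5; fr 432 5; 0; 0; 0; 0; 0; 0]);
 ((1,1,8)%N, [:: fr 3 160; fr (-9) 160; fr (-27) 160; fr 9 80; fr 81 160; fr (-1) 5; fr (-81) 80; fr 9 5; 0; 0; 0; fr (-27) 4; fr 243 4; 0; fr 81 1; fr 81 4]);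
 ((1,2,2)%N, [:: fr 1 50; fr 2 25; fr 9 50; 0; fr 18 25; 0; 0; 0; fr 36 5; 0; 0; 0; 0; 0; 0; 0]);
 ((1,2,4)%N, [:: fr 1 80; fr 1 16; fr (-9) 80; fr (-1) 5; fr (-9) 16; 0; fr 9 5; 0; 0; 0; 0; 0; 0; fr 9 1; 0; 0]);
 ((1,2,8)%N, [:: fr 1 200; fr 1 40; fr 9 200; fr (-9) 100; fr 9 40; fr 4 25; fr (-81) 100; fr 36 25; fr 9 5; fr 144 5; fr 1152 5; fr 9 1; fr 81 1; 0; 0; 0]);
 ((1,4,4)%N, [:: fr 1 200; fr 3 200; fr 9 200; fr 2 25; fr 27 200; 0; fr 18 25; 0; fr 54 5; fr 216 5; 0; 0; 0; 0; 0; 0]);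
 ((1,4,8)%N, [:: fr 1 320; fr 3 320; fr (-9) 320; fr 1 16; fr (-27) 320; fr (-1) 5; fr (-9) 16; fr 9 5; 0; 0; 0; fr 9 4; fr (-81) 4; fr 9 4; fr 27 1; fr 27 4]);
 ((1,8,8)%N, [:: fr 1 800; fr 3 800; fr 9 800; fr 3 200; fr 27 800; fr 2 25; fr 27 200; fr 18 25; fr 36 5; fr 234 5; fr 576 5; fr 9 2; fr 81 2; 0; 0; 0]);
 ((2,2,2)%N, [:: fr 1 40; fr (-3) 20; fr (-9) 40; 0; fr 27 20; 0; 0; 0; 0; 0; 0; 0; 0; 0; 0; 0]);
 ((2,2,4)%N, [:: fr 1 100; fr (-7) 100; fr 9 100; fr 4 25; fr (-63) 100; 0; fr 36 25; 0; fr 18 5; fr 72 5; 0; 0; 0; 0; 0; 0]);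
 ((2,2,8)%N, [:: fr 1 160; fr (-7) 160; fr (-9) 160; fr 9 80; fr 63 160; fr (-1) 5; fr (-81) 80; fr 9 5; 0; 0; 0; fr (-9) 4; fr 81 4; 0; fr 9 1; fr 27 4]);
 ((2,4,4)%N, [:: fr 1 160; fr (-1) 32; fr (-9) 160; fr (-1) 10; fr 9 32; 0; fr 9 10; 0; 0; 0; 0; 0; 0; fr 9 2; 0; 0]);
 ((2,4,8)%N, [:: fr 1 400; fr (-1) 80; fr 9 400; fr (-1) 20; fr (-9) 80; fr 4 25; fr (-9) 20; fr 36 25; fr 9 10; fr 27 5; fr 72 5; fr 9 2; fr 81 2; 0; 0; 0]);
 ((2,8,8)%N, [:: fr 1 640; fr (-1) 128; fr (-9) 640; fr (-3) 160; fr 9 128; fr (-1) 10; fr 27 160; fr 9 10; 0; 0; 0; fr (-9) 8; fr 81 8; fr 27 8; fr 9 2; fr 27 8]);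
 ((4,4,4)%N, [:: fr 1 400; fr (-9) 400; fr 9 400; fr 3 25; fr (-81) 400; 0; fr 27 25; 0; fr 27 5; fr 54 5; 0; 0; 0; 0; 0; 0]);
 ((4,4,8)%N, [:: fr 1 640; fr (-9) 640; fr (-9) 640; fr 7 80; fr 81 640; fr (-1) 5; fr (-63) 80; fr 9 5; 0; 0; 0; fr 9 8; fr (-81) 8; fr 9 8; 0; fr 27 8]);
 ((4,8,8)%N, [:: fr 1 1600; fr (-9) 1600; fr 9 1600; fr 1 40; fr (-81) 1600; fr 2 25; fr 9 40; fr 18 25; fr 18 5; fr 36 5; fr 36 5; fr 9 4; fr 81 4; 0; 0; 0]);
 ((8,8,8)%N, [:: fr 1 2560; fr (-9) 2560; fr (-9) 2560; fr 9 320; fr 81 2560; fr (-3) 20; fr (-81) 320; fr 27 20; 0; 0; 0; fr 27 32; fr (-243) 32; fr 81 32; 0; fr 81 32])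
].

(* Main.v *)
(** Let a(q) be the theta series of x^2 + xy + y^2.  A product a(q) a(q^c1) a(q^c2) a(q^c3)
    is a quartic form in a_k = a(q^k), k = 1, 2, 4, 8, and these four series are bound by
    the two relations a_1^2 - 2 a_1 a_4 + 4 a_4^2 = 3 a_2^2 and its image under q -> q^2.
    Each f_i is a quartic form in the a_k as well, so the theorem becomes linear algebra
    in the 16-dimensional space of quartic forms modulo these relations.

    For the Lambert series 1 + 6 sum chi(d) q^(dm), Liouville's elementary identity, which
    rests on the partial fraction decomposition of q^a/(1-q^a) * q^b/(1-q^b), yields the
    squares and products of a_1, a_2 and E_2, the derivatives of a_1, a_2, E_2 with respect
    to q d/dq, and hence the relation above and E_4(q^k), k = 1, 2, 3, 6, as quartic forms.
    The Lambert series is the theta series because both satisfy the same recursion: their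
    even part is the series at q^4, and the even part of the square is known from the
    divisor function on one side and from three sublattices of Z[w]^2 on the other.  Finally
    an eta quotient is determined by its logarithmic derivative, a combination of the
    E_2(q^k), and by its leading coefficient, and the quartic forms have the same ones. *)

From HB Require Import structures.
Require Import Defs.
From mathcomp Require Import all_boot all_algebra.
From mathcomp Require Import all_order boolp.
From mathcomp Require Import ring lra zify.
Import GRing.Theory Num.Theory.
Import Order.TTheory.
Local Open Scope ring_scope.

(** * Formal power series *)

(** For formal series, agreement of finitely many coefficients proves nothing by itself, so each
    relation is either derived from Liouville's identity or read off a recursion that determines the
    series. Coefficients stay integral: denominators are cleared by explicit multiples, which
    torsion-freeness removes, and rationals appear only together with the weights of the table.
    Polynomial consequences are stated as certificates, with explicit multipliers of known
    relations, so that one [ring] identity remains in each case. The relations are monic in a_1 and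
    in a_2, so normal forms are spanned by 1, a_1, a_2, a_1 a_2 times forms in a_4, a_8; in degree
    four this gives 5 + 4 + 4 + 3 = 16 monomials. The formulas come in pairs: the sign change of a_2
    and a_8 preserves both relations, takes the form of E_4(q^k) to that of 9 E_4(q^(3k)) for k = 1,
    2, 4, 8, and the form of f_{4,8} to that of 9 f_{4,8}(q^3). *)

Definition fps : Type := series.

HB.instance Definition _ := gen_eqMixin fps.
HB.instance Definition _ := gen_choiceMixin fps.

Definition fps_add (f g : fps) : fps := fun n => f n + g n.
Definition fps_opp (f : fps) : fps := fun n => - f n.
Definition fps_zero : fps := fun=> 0.

Lemma fps_addA : associative fps_add.
Proof. by move=> f g h; apply/funext => n; rewrite /fps_add addrA. Qed.
Lemma fps_addC : commutative fps_add.
Proof. by move=> f g; apply/funext => n; rewrite /fps_add addrC. Qed.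
Lemma fps_add0 : left_id fps_zero fps_add.
Proof. by move=> f; apply/funext => n; rewrite /fps_add add0r. Qed.
Lemma fps_addN : left_inverse fps_zero fps_opp fps_add.
Proof. by move=> f; apply/funext => n; rewrite /fps_add /fps_opp addNr. Qed.

HB.instance Definition _ :=
  GRing.isZmodule.Build fps fps_addA fps_addC fps_add0 fps_addN.

(** Coefficients up to N of a product only see truncations, so associativity of [smul] and
    multiplicativity of q -> q^d are inherited from polynomials. *)
Definition fps_trunc (N : nat) (f : series) : {poly int} :=
  \poly_(i < N.+1) f i.

Lemma coef_fps_trunc N f i : (i <= N)%N -> (fps_trunc N f)`_i = f i.
Proof. by move=> iN; rewrite coef_poly ltnS iN. Qed.

Lemma smul_trunc N f g n : (n <= N)%N ->
  smul f g n = (fps_trunc N f * fps_trunc N g)`_n.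
Proof.
move=> nN; rewrite coefM /smul big_mkord; apply: eq_bigr => i _.
rewrite !coef_fps_trunc // ?(leq_trans (leq_subr _ _)) //.
by rewrite (leq_trans _ nN) // -ltnS.
Qed.

Lemma fps_mulC : commutative smul.
Proof. by move=> f g; apply/funext => n; rewrite !(smul_trunc _ _ _ _ (leqnn n))
    mulrC. Qed.

Lemma fps_mulA : associative smul.
Proof.
move=> f g h; apply/funext => n.
transitivity ((fps_trunc n f * (fps_trunc n g * fps_trunc n h))`_n).
  rewrite (smul_trunc _ _ _ _ (leqnn n)) [in RHS]coefM coefM.
  apply: eq_bigr => i _; congr (_ * _).
  by rewrite coef_fps_trunc ?leq_subr // (smul_trunc n) // leq_subr.
rewrite mulrA (smul_trunc _ _ _ _ (leqnn n)) [in RHS]coefM coefM.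
apply: eq_bigr => -[i Hi] _; congr (_ * _); have iN : (i <= n)%N by [].
by rewrite coef_fps_trunc // (smul_trunc n).
Qed.

Lemma fps_mul1 : left_id sone smul.
Proof.
move=> f; apply/funext => n; rewrite /smul big_nat_recl // /sone /= mul1r subn0.
by rewrite big1 ?addr0 // => i _; rewrite mul0r.
Qed.

Lemma fps_mulDl : left_distributive smul fps_add.
Proof.
move=> f g h; apply/funext => n.
rewrite /fps_add /smul -big_split /=.
by apply: eq_bigr => i _; rewrite mulrDl.
Qed.

Lemma fps_oner_neq0 : (sone : fps) != 0.
Proof. by apply/eqP => /(congr1 (fun f : fps => f 0%N)). Qed.

HB.instance Definition _ := GRing.Zmodule_isComNzRing.Build fps
  fps_mulA fps_mulC fps_mul1 fps_mulDl fps_oner_neq0.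

Lemma fpsD (f g : fps) n : (f + g) n = f n + g n. Proof. by []. Qed.
Lemma fpsN (f : fps) n : (- f) n = - f n. Proof. by []. Qed.
Lemma fps1 n : (1 : fps) n = (n == 0%N)%:R. Proof. by []. Qed.
Lemma fpsM (f g : fps) n :
  (f * g) n = \sum_(i < n.+1) f i * g (n - i)%N.
Proof. by rewrite -(big_mkord xpredT (fun i => f i * g (n - i)%N)). Qed.

Lemma fpsMn (f : fps) k n : (f *+ k) n = f n *+ k.
Proof. by elim: k => // k IH; rewrite !mulrSr fpsD IH. Qed.

Lemma fps_sum (I : Type) (r : seq I) (P : pred I) (F : I -> fps) n :
  (\sum_(i <- r | P i) F i) n = \sum_(i <- r | P i) F i n.
Proof. by elim/big_rec2: _ => // i x f _ <-. Qed.

(** Removes the integer factor left by clearing denominators. The argument is the predecessor of the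
    factor: [fps_mulrnI 1] divides by 2. *)
Lemma fps_mulrnI k (f g : fps) : f *+ k.+1 = g *+ k.+1 -> f = g.
Proof.
move=> /(congr1 (fun h : fps => h _)) E; apply/funext => n.
by have := E n; rewrite !fpsMn; apply: pmulrnI.
Qed.

Lemma spow_exp (f : fps) k : spow f k = f ^+ k.
Proof. by elim: k => // k IH; rewrite exprS -IH. Qed.

(** * The derivation q d/dq and the substitution q -> q^d *)

Definition qD (f : fps) : fps := fun n => n%:R * f n.

Lemma qDD f g : qD (f + g) = qD f + qD g.
Proof. by apply/funext => n; rewrite /qD !fpsD mulrDr. Qed.
Lemma qDN f : qD (- f) = - qD f.
Proof. by apply/funext => n; rewrite /qD !fpsN mulrN. Qed.
Lemma qDMn f k : qD (f *+ k) = qD f *+ k.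
Proof. by apply/funext => n; rewrite /qD !fpsMn mulrnAr. Qed.
Lemma qD1 : qD 1 = 0.
Proof. by apply/funext => -[|n]; rewrite /qD fps1 ?mul0r ?mulr0. Qed.
Lemma qDM f g : qD (f * g) = qD f * g + f * qD g.
Proof.
apply/funext => n; rewrite /qD fpsD !fpsM mulr_sumr -big_split /=.
apply: eq_bigr => -[i Hi] _ /=.
by rewrite -{1}(subnKC (ltnSE Hi)) natrD; ring.
Qed.
Lemma qDX f k : qD (f ^+ k.+1) = f ^+ k * qD f *+ k.+1.
Proof.
elim: k => [|k IH]; first by rewrite expr0 mul1r.
by rewrite exprS qDM IH exprS; ring.
Qed.

Definition V (d : nat) (f : fps) : fps := rescale d f.

Lemma VD d f g : V d (f + g) = V d f + V d g.
Proof.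
apply/funext => n; rewrite fpsD /V /rescale fpsD.
by case: ifP => // _; rewrite addr0.
Qed.
Lemma VN d f : V d (- f) = - V d f.
Proof.
apply/funext => n; rewrite fpsN /V /rescale fpsN.
by case: ifP => // _; rewrite oppr0.
Qed.
Lemma VMn d f k : V d (f *+ k) = V d f *+ k.
Proof.
apply/funext => n; rewrite fpsMn /V /rescale fpsMn.
by case: ifP => // _; rewrite mul0rn.
Qed.
Lemma V1 d : (0 < d)%N -> V d 1 = 1.
Proof.
move=> d0; apply/funext => n; rewrite /V /rescale !fps1; case: ifP => [dn|].
  by congr (_%:R); rewrite -[in RHS](divnK dn) muln_eq0 (gtn_eqF d0) orbF.
by case: n => //; rewrite dvdn0.
Qed.
Lemma VM d f g : (0 < d)%N -> V d (f * g) = V d f * V d g.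
Proof.
move=> d0; apply/funext => n.
have tr N h i : (i <= N)%N -> V d h i = (fps_trunc N h \Po 'X^d)`_i.
  move=> iN; rewrite coef_comp_poly_Xn // /V /rescale; case: ifP => // _.
  by rewrite coef_fps_trunc // (leq_trans (leq_div _ _)).
rewrite [RHS]fpsM.
transitivity (\sum_(i < n.+1) (fps_trunc n f \Po 'X^d)`_i *
                              (fps_trunc n g \Po 'X^d)`_(n - i)); last first.
  apply: eq_bigr => -[i Hi] _ /=; have iN : (i <= n)%N by [].
  by rewrite (tr n f i) // (tr n g) // leq_subr.
rewrite -coefM -comp_polyM coef_comp_poly_Xn // /V /rescale.
by case: ifP => // _; rewrite [LHS](smul_trunc n) // leq_div.
Qed.
Lemma VX d f k : (0 < d)%N -> V d (f ^+ k) = V d f ^+ k.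
Proof.
move=> d0; elim: k => [|k IH]; first exact: V1.
by rewrite !exprS VM // IH.
Qed.
Lemma V_qD d f : V d (qD f) *+ d = qD (V d f).
Proof.
apply/funext => n; rewrite fpsMn /V /rescale /qD; case: ifP => [dn|_].
  by rewrite -{3}(divnK dn) natrM -mulr_natr; ring.
by rewrite mul0rn mulr0.
Qed.
Lemma VV d e f : (0 < d)%N -> V d (V e f) = V (d * e) f.
Proof.
move=> d0; apply/funext => n; rewrite /V /rescale.
case: (boolP (d %| n)%N) => [dn|/negP dn].
  by rewrite -[in RHS](divnK dn) [(_ %/ _ * _)%N]mulnC dvdn_pmul2l // divnMl.
by case: ifP => // /(dvdn_trans (dvdn_mulr _ (dvdnn d))).
Qed.

(** * Liouville's identity *)

Definition qpow (a : nat) : fps := fun n => (n == a)%:R.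

Lemma qpowM a (f : fps) n :
  (qpow a * f) n = if (a <= n)%N then f (n - a)%N else 0.
Proof.
rewrite fpsM; case: (leqP a n) => [an|na]; last first.
  rewrite big1 // => -[i Hi] _ /=; rewrite /qpow; case: eqP => [ia|]; last by rewrite
      mul0r.
  by move: Hi na; rewrite ia ltnS => /leq_ltn_trans H /H; rewrite ltnn.
have an' : (a < n.+1)%N by [].
rewrite (bigD1 (Ordinal an')) //= {1}/qpow eqxx mul1r big1 ?addr0 // => i.
by rewrite -val_eqE /= /qpow => /negbTE ->; rewrite mul0r.
Qed.

Lemma qpowD a b : qpow (a + b) = qpow a * qpow b.
Proof.
apply/funext => n; rewrite qpowM /qpow; case: (leqP a n) => [an|na].
  by rewrite -[in LHS](subnKC an) eqn_add2l.
by rewrite ltn_eqF // ltn_addr.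
Qed.

(** The expansion of q^a/(1-q^a) for a > 0, so that [1 + geo a] inverts [1 - qpow a]. *)
Definition geo (a : nat) : fps := fun n => ((0 < n) && (a %| n))%N%:R.

Lemma geo_rec a : (0 < a)%N -> geo a = qpow a * (1 + geo a).
Proof.
move=> a0; apply/funext => n; rewrite qpowM fpsD fps1 /geo.
case: (leqP a n) => [an|na].
  rewrite (leq_trans a0 an) -{1}(subnK an) dvdn_addl //.
  case: (posnP (n - a)) => [->|] /=; first by rewrite dvdn0 addr0.
  by rewrite add0r.
case: posnP => //= n0; case: (boolP (a %| n)%N) => // /(dvdn_leq n0).
by rewrite leqNgt na.
Qed.

Lemma geo_unit a : (0 < a)%N -> (1 - qpow a) * (1 + geo a) = 1.
Proof. by move=> a0; rewrite mulrBl mul1r -geo_rec // addrK. Qed.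

(* [1/(1-A)], [1/(1-B)] and [1/(1-AB)] enter through the inverses [u], [v], [w]. *)
Lemma partial_fraction (R : comNzRingType) (A B u v w : R) :
  (1 - A) * u = 1 -> (1 - B) * v = 1 -> (1 - A * B) * w = 1 ->
  (u - 1) * (v - 1) = (w - 1) * (u + v - 1).
Proof.
move=> hu hv hw; suff e : w * (u + v - 1) = u * v by rewrite [RHS]mulrBl e; ring.
transitivity (u * v * ((1 - A * B) * w)); last by rewrite hw mulr1.
transitivity (w * (((1 - A) * u) * v + u * ((1 - B) * v) - ((1 - A) * u) * ((1 - B) *
    v))).
  by rewrite hu hv; ring.
by ring.
Qed.

Lemma geoM a b : (0 < a)%N -> (0 < b)%N ->
  geo a * geo b = geo (a + b) + geo (a + b) * geo a + geo (a + b) * geo b.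
Proof.
move=> a0 b0; have hu := geo_unit _ a0; have hv := geo_unit _ b0.
have := geo_unit (a + b); rewrite qpowD => /(_ (ltn_addr b a0)) hw.
have := partial_fraction _ _ _ _ _ _ hu hv hw.
by rewrite ![1 + _]addrC !addrK => ->; ring.
Qed.

Lemma geo_gt a n : (n < a)%N -> geo a n = 0.
Proof.
move=> na; rewrite /geo; case: posnP => //= n0.
by case: (boolP (a %| n)%N) => // /(dvdn_leq n0); rewrite leqNgt na.
Qed.

Lemma geoM_gt a b n : (n < a)%N -> (geo a * geo b) n = 0.
Proof.
move=> na; rewrite fpsM big1 // => -[i Hi] _ /=.
by rewrite geo_gt ?mul0r // (leq_ltn_trans _ na).
Qed.

(** This is x^2/(1-x)^2 = sum of (m-1) x^m at x = q^a, proved by descent from n to n - a through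
    [geo_rec]. *)
Lemma geo_sqr a n : (0 < a)%N ->
  (geo a * geo a) n = if (0 < n)%N && (a %| n)%N then (n %/ a)%:Z - 1 else 0.
Proof.
move=> a0; elim/ltn_ind: n => n IH.
have -> : geo a * geo a = qpow a * (geo a + geo a * geo a).
  by rewrite {1}(geo_rec a) //; ring.
rewrite qpowM fpsD; case: (leqP a n) => [an|na]; last first.
  case: posnP => //= n0; case: (boolP (a %| n)%N) => // /(dvdn_leq n0).
  by rewrite leqNgt na.
have n0 := leq_trans a0 an.
have dn : (a %| n)%N = (a %| n - a)%N by rewrite -{1}(subnK an) dvdn_addl.
have qn : (n %/ a)%N = ((n - a) %/ a).+1.
  by rewrite -{1}(subnK an) divnDr // divnn a0 addn1.
rewrite IH ?ltn_subrL ?a0 // n0 dn qn /geo /=.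
case: (posnP (n - a)) => [->|n1] /=; first by rewrite dvdn0 div0n.
by case: ifP => // _; rewrite -addn1 PoszD addrK addrCA subrr addr0.
Qed.

Section Transform.
Variables (n : nat) (g : nat -> nat -> int) (c : nat -> int).
Hypotheses (gC : forall a b, g a b = g b a)
  (gD : forall a b, (0 < a)%N -> (0 < b)%N ->
     g a b = c (a + b)%N + g (a + b)%N a + g (a + b)%N b)
  (c_gt : forall a, (n < a)%N -> c a = 0)
  (g_gt : forall a b, (n < a)%N -> g a b = 0).

(** Here [g a b] stands for the coefficient at n of [geo a * geo b], and [c a] for that of [geo a].
    The hypotheses are symmetry, the partial fraction relation, and the vanishing beyond n that
    makes the double sum finite. *)
Let E (h : nat -> nat -> int) :=
  \sum_(1 <= a < n.+1) \sum_(1 <= b < n.+1) h a b * g a b.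

Lemma sum_triangle (F : nat -> nat -> int) :
  (forall a b, (n < b)%N -> F a b = 0) ->
  \sum_(1 <= a < n.+1) \sum_(1 <= b < n.+1) F a (a + b)%N =
  \sum_(1 <= a < n.+1) \sum_(1 <= b < n.+1 | (b < a)%N) F b a.
Proof.
move=> F0; rewrite [RHS](exchange_big_dep xpredT) //=.
rewrite [LHS]big_seq_cond [RHS]big_seq_cond; apply: eq_bigr => a.
rewrite andbT mem_index_iota => /andP[a0 an].
transitivity (\sum_(a.+1 <= b < (a + n).+1) F a b).
  rewrite -(add1n a) big_addn -addnS addKn.
  by apply: eq_bigr => b _; rewrite addnC.
rewrite (big_cat_nat _ (n := n.+1)) //=; last by rewrite ltnS leq_addl.
rewrite [X in _ + X]big_nat [X in _ + X]big1 ?addr0; last first.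
  by move=> b /andP[nb _]; exact: F0.
rewrite [RHS](big_cat_nat _ (n := a.+1)) //= [X in _ = X + _]big_nat_cond.
rewrite [X in _ = X + _]big1 ?add0r; last first.
  by move=> b /andP[/andP[_ ba] ab]; move: (leq_trans ba ab); rewrite ltnn.
rewrite [LHS]big_nat_cond [RHS]big_nat_cond; apply: eq_bigl => b.
by case: (ltnP a b); rewrite ?andbF.
Qed.

Lemma E_split (h : nat -> nat -> int) : E h =
  \sum_(1 <= a < n.+1) \sum_(1 <= b < n.+1 | (b < a)%N) (h a b + h b a) * g a b
  + \sum_(1 <= a < n.+1) h a a * g a a.
Proof.
have tri : E h = \sum_(1 <= a < n.+1) \sum_(1 <= b < n.+1 | (b < a)%N) h a b * g a b
  + \sum_(1 <= a < n.+1) \sum_(1 <= b < n.+1 | (a < b)%N) h a b * g a b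
  + \sum_(1 <= a < n.+1) h a a * g a a.
  rewrite /E -!big_split /=; apply: eq_big_nat => a /andP[a0 an].
  rewrite (bigID (fun b => b < a)%N) /= -addrA; congr (_ + _).
  rewrite (bigID (fun b => a < b)%N) /=; congr (_ + _).
    by apply: eq_bigl => b; case: ltngtP.
  rewrite (eq_bigl (fun b => b == a)); last by move=> b /=; case: ltngtP.
  rewrite big_mkcond (bigD1_seq a) ?iota_uniq ?mem_index_iota ?a0 //= eqxx.
  by rewrite big1 ?addr0 // => b /negbTE ->.
rewrite {}tri [X in _ + X + _](exchange_big_dep xpredT) //=; congr (_ + _).
rewrite -big_split; apply: eq_bigr => a _ /=.
rewrite -big_split; apply: eq_bigr => b _ /=.
by rewrite mulrDl (gC b a).
Qed.

(** The relation [gD] replaces the term at (a, b) by terms whose first index is a + b. Re-indexing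
    by that sum moves the quadrant to the triangle b < a, where b and a - b are the two old
    indices. *)
Lemma E_shear (h : nat -> nat -> int) : E h =
  \sum_(1 <= a < n.+1) \sum_(1 <= b < n.+1 | (b < a)%N)
    (h b (a - b)%N * c a + (h b (a - b)%N + h (a - b)%N b) * g a b).
Proof.
pose F a b := h a (b - a)%N * c b + h a (b - a)%N * g b a.
pose G a b := h (b - a)%N a * g b a.
transitivity (\sum_(1 <= a < n.+1) \sum_(1 <= b < n.+1) F a (a + b)%N
   + \sum_(1 <= a < n.+1) \sum_(1 <= b < n.+1) G a (a + b)%N).
  rewrite [X in _ + X]exchange_big /= -big_split.
  apply: eq_big_nat => a /andP[a0 _] /=; rewrite -big_split.
  apply: eq_big_nat => b /andP[b0 _] /=.
  by rewrite /F /G gD // addKn addnC addKn (addnC b); ring.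
rewrite !sum_triangle; first last.
- by move=> a b nb; rewrite /F c_gt // g_gt // !mulr0 addr0.
- by move=> a b nb; rewrite /G g_gt // mulr0.
rewrite -big_split; apply: eq_bigr => a _ /=; rewrite -big_split /=.
by apply: eq_bigr => b _; rewrite /F /G; ring.
Qed.

Lemma E_liouville (f : int -> int -> int) :
  (forall a b, f (- a) b = - f a b) -> (forall a b, f a (- b) = - f a b) ->
  2 * E (fun a b => f a b) =
  E (fun a b => f a%:Z (a%:Z + b%:Z) + f (a%:Z + b%:Z) a%:Z
                - f (a%:Z - b%:Z) a%:Z - f a%:Z (a%:Z - b%:Z))
  + \sum_(1 <= a < n.+1) f a a * g a a
  + \sum_(1 <= a < n.+1) \sum_(1 <= b < n.+1 | (b < a)%N)
       (f b%:Z (a%:Z - b%:Z) - f b a - f a b) * c a.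
Proof.
move=> fNl fNr.
pose h1 (a b : nat) := f a%:Z (a%:Z + b%:Z) + f (a%:Z + b%:Z) a%:Z.
pose k (a b : nat) := f (a%:Z - b%:Z) a%:Z + f a%:Z (a%:Z - b%:Z).
have f0 x : f 0 x = 0 by have := fNl 0 x; rewrite oppr0 => /eqP; rewrite eq_sym eqNr
    => /eqP.
have f0r x : f x 0 = 0 by have := fNr x 0; rewrite oppr0 => /eqP; rewrite eq_sym eqNr
    => /eqP.
have -> : E (fun a b => f a%:Z (a%:Z + b%:Z) + f (a%:Z + b%:Z) a%:Z
                - f (a%:Z - b%:Z) a%:Z - f a%:Z (a%:Z - b%:Z)) = E h1 - E k.
  rewrite /E -sumrB; apply: eq_bigr => a _; rewrite -sumrB.
  by apply: eq_bigr => b _; rewrite /h1 /k; ring.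
(* One copy of the sum for [f] and the sum for [h1] are sheared, the other copy and the sum for [k]
   are split. All four then run over b < a, and oddness of [f] makes the coefficients of [g a b]
   agree; the diagonal and the terms in [c] remain. *)
rewrite mulr_natl mulr2n {1}E_shear E_split (E_shear h1) (E_split k).
have -> : \sum_(1 <= a < n.+1) k a a * g a a = 0.
  by rewrite big1 // => a _; rewrite /k subrr f0 f0r addr0 mul0r.
rewrite addr0 addrA -[RHS]addrA [X in _ = _ + X]addrC addrA; congr (_ + _).
rewrite -sumrB -!big_split; apply: eq_bigr => a _ /=.
rewrite -sumrB -!big_split /=; apply: eq_bigr => b ba.
have ab : (a - b)%N%:Z = a%:Z - b%:Z by rewrite -subzn // ltnW.
rewrite /h1 /k !ab [_ + (a%:Z - _)]addrC subrK -(opprB a%:Z) fNl fNr; ring.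
Qed.

End Transform.

(** The Lambert series of [s], with constant term 0 because the range is empty at n = 0. The weight
    is a function on all integers so that it can be odd. *)
Definition lam (s : int -> int) : fps :=
  fun n => \sum_(1 <= d < n.+1 | (d %| n)%N) s d.

(** The double Lambert sum over all a, b >= 1; terms with an index above n do not reach coefficient
    n, so the cut at n is harmless. *)
Definition S2 (h : int -> int -> int) : fps :=
  fun n => \sum_(1 <= a < n.+1) \sum_(1 <= b < n.+1) h a b * (geo a * geo b) n.

Lemma lam_geo s N n : (n <= N)%N -> lam s n = \sum_(1 <= a < N.+1) s a * geo a n.
Proof.
move=> nN; rewrite (big_cat_nat _ (n := n.+1)) //= [X in _ + X]big_nat.
rewrite [X in _ + X]big1 ?addr0; last first.
  by move=> a /andP[na _]; rewrite geo_gt ?mulr0.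
rewrite /lam big_mkcond; apply: eq_big_nat => a /andP[a0 an].
by rewrite /geo (leq_trans a0 an) /=; case: ifP; rewrite ?mulr1 ?mulr0.
Qed.

Lemma S2_lam s t : S2 (fun a b => s a * t b) = lam s * lam t.
Proof.
apply/funext => n; rewrite fpsM.
transitivity (\sum_(i < n.+1) \sum_(1 <= a < n.+1) \sum_(1 <= b < n.+1)
   s a * t b * (geo a i * geo b (n - i)%N)); last first.
  apply: eq_bigr => -[i Hi] _ /=; rewrite (lam_geo s n) // (lam_geo t n) ?leq_subr //.
  rewrite big_distrl /=; apply: eq_bigr => a _.
  by rewrite big_distrr /=; apply: eq_bigr => b _; ring.
rewrite exchange_big; apply: eq_bigr => a _ /=.
rewrite exchange_big; apply: eq_bigr => b _ /=.
by rewrite fpsM mulr_sumr.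
Qed.

(** In [E_liouville] the diagonal is evaluated by [geo_sqr], and the terms in [c] form a Lambert
    series whose weights are finite sums; the absolute value only turns d into a summation bound. *)
Lemma liouville (f : int -> int -> int) n :
  (forall a b, f (- a) b = - f a b) -> (forall a b, f a (- b) = - f a b) ->
  2 * S2 f n =
  S2 (fun a b => f a (a + b) + f (a + b) a - f (a - b) a - f a (a - b)) n
  + \sum_(1 <= d < n.+1 | (d %| n)%N) ((n %/ d)%:Z - 1) * f d d
  + lam (fun d => \sum_(1 <= b < `|d|%N) (f b%:Z (d - b%:Z) - f b%:Z d - f d b%:Z)) n.
Proof.
move=> fNl fNr.
have := @E_liouville n (fun a b => (geo a * geo b) n) (fun a => geo a n).
move=> /(_ _ _ _ _ f fNl fNr) -> //; first last.
- by move=> a b; exact: geoM_gt.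
- by move=> a; exact: geo_gt.
- by move=> a b a0 b0; rewrite geoM // !fpsD.
- by move=> a b; rewrite mulrC.
congr (_ + _ + _).
  rewrite [RHS]big_mkcond; apply: eq_big_nat => a /andP[a0 an].
  rewrite geo_sqr // (leq_trans a0 an) /=.
  by case: ifP; rewrite ?mulr0 // mulrC.
rewrite /lam [RHS]big_mkcond; apply: eq_big_nat => a /andP[a0 an].
rewrite /geo (leq_trans a0 an) /=; case: ifP => da; last first.
  by rewrite big1 // => b _; rewrite mulr0.
rewrite [RHS](big_nat_widen _ _ n.+1) ?absz_nat ?(ltnW an) //.
rewrite big_mkcond [RHS]big_mkcond; apply: eq_bigr => b _ /=.
by rewrite mulr1.
Qed.

(** * Characters modulo 6 and divisor sums *)

Lemma sum_divisors (F : nat -> int) n : (0 < n)%N ->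
  \sum_(1 <= d < n.+1 | (d %| n)%N) F d = \sum_(d <- divisors n) F d.
Proof.
move=> n0; rewrite -big_filter; apply/perm_big/uniq_perm.
- exact/filter_uniq/iota_uniq.
- exact: divisors_uniq.
move=> d; rewrite mem_filter mem_index_iota -dvdn_divisors //.
case: (boolP (d %| n)%N) => //= dn.
by rewrite ltnS (dvdn_leq n0 dn) (dvdn_gt0 n0 dn).
Qed.

Lemma sum_codivisors (F : nat -> int) n :
  \sum_(1 <= d < n.+1 | (d %| n)%N) F (n %/ d)%N =
  \sum_(1 <= d < n.+1 | (d %| n)%N) F d.
Proof.
case: n => [|n]; first by rewrite !big_nil.
have n0 := ltn0Sn n; rewrite !sum_divisors // -(big_map (divn n.+1) xpredT F).
have K : {in divisors n.+1, cancel (divn n.+1) (divn n.+1)}.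
  move=> d; rewrite -dvdn_divisors // => dn.
  by rewrite -{1}(divnK dn) mulKn // divn_gt0 ?(dvdn_gt0 n0 dn) // dvdn_leq.
apply/perm_big/uniq_perm.
- by rewrite (map_inj_in_uniq (can_in_inj K)) divisors_uniq.
- exact: divisors_uniq.
move=> d; apply/mapP/idP => [[e]|dn].
  by rewrite -!dvdn_divisors // => en ->; exact: dvdn_div.
exists (n.+1 %/ d)%N; last by rewrite K.
by move: dn; rewrite -!dvdn_divisors //; exact: dvdn_div.
Qed.

Lemma sum_multiples (F : nat -> int) k m : (0 < k)%N ->
  \sum_(1 <= d < (k * m).+1 | (k %| d)%N) F d = \sum_(1 <= e < m.+1) F (k * e)%N.
Proof.
move=> k0; elim: m => [|m IH]; first by rewrite muln0 !big_nil.
rewrite (big_cat_nat _ (n := (k * m).+1)) //=; last by rewrite ltnS leq_mul.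
rewrite IH [RHS]big_nat_recr //=; congr (_ + _).
have lt : (k * m < k * m + k)%N by rewrite -[ltnLHS]addn0 ltn_add2l.
rewrite mulnS addnC big_mkcond big_nat_recr //=.
rewrite dvdn_addr ?dvdn_mulr // dvdnn big_nat big1 ?add0r // => d /andP[d1 d2].
rewrite -(subnKC (ltnW d1)) dvdn_addr ?dvdn_mulr //.
case: (boolP (k %| _)%N) => // /dvdn_leq; rewrite subn_gt0 => /(_ d1).
by move=> kd; exfalso; lia.
Qed.

Lemma lamD s t : lam (fun d => s d + t d) = lam s + lam t.
Proof. by apply/funext => n; rewrite fpsD /lam -big_split. Qed.
Lemma lamZ k s n : lam (fun d => k * s d) n = k * lam s n.
Proof. by rewrite /lam mulr_sumr. Qed.

Lemma lam_dil k s : (0 < k)%N ->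
  lam (fun d => if (k %| `|d|)%N then s d else 0) = V k (lam (fun d => s (k%:Z * d))).
Proof.
move=> k0; apply/funext => n.
transitivity (\sum_(1 <= d < n.+1 | (k %| d)%N) if (d %| n)%N then s d else 0).
  rewrite /lam [LHS]big_mkcond [RHS]big_mkcond.
  by apply: eq_bigr => d _ /=; case: ifP; case: ifP.
rewrite /V /rescale; case: ifP => kn; last first.
  rewrite big1 // => d kd; case: ifP => // dn.
  by rewrite (dvdn_trans kd dn) in kn.
have -> : n.+1 = (k * (n %/ k)).+1 by rewrite mulnC divnK.
rewrite sum_multiples // /lam [RHS]big_mkcond; apply: eq_bigr => e _.
by rewrite dvdn_divRL // [(e * k)%N]mulnC PoszM.
Qed.

Definition chi (a : int) : int :=
  if (a %% 3)%Z == 1 then 1 else if (a %% 3)%Z == 2 then -1 else 0.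
Definition eps (a : int) : int := if (a %% 2)%Z == 0 then 1 else -1.

(** The nine residue pairs of (a, b) modulo 3 with the joint values of [chi] at a, b, a + b, b - a
    and a + 1; a case analysis leaves identities for [ring]. *)
Variant chi_spec : int -> int -> int -> int -> int -> Prop :=
| Chi00 : chi_spec 0 0 0 0 1 | Chi01 : chi_spec 0 1 1 1 1
| Chi02 : chi_spec 0 (-1) (-1) (-1) 1
| Chi10 : chi_spec 1 0 1 (-1) (-1) | Chi11 : chi_spec 1 1 (-1) 0 (-1)
| Chi12 : chi_spec 1 (-1) 0 1 (-1)
| Chi20 : chi_spec (-1) 0 (-1) 1 0 | Chi21 : chi_spec (-1) 1 0 (-1) 0
| Chi22 : chi_spec (-1) (-1) 1 0 0.

Lemma chiP a b : chi_spec (chi a) (chi b) (chi (a + b)) (chi (b - a)) (chi (a + 1)).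
Proof.
have Ha : (a %% 3)%Z = 0 \/ (a %% 3)%Z = 1 \/ (a %% 3)%Z = 2 by lia.
have Hb : (b %% 3)%Z = 0 \/ (b %% 3)%Z = 1 \/ (b %% 3)%Z = 2 by lia.
rewrite /chi -[((a + b) %% 3)%Z]modzDm -[((b - a) %% 3)%Z]modzDm.
rewrite -[((a + 1) %% 3)%Z]modzDm -[((- a) %% 3)%Z]modzNm.
by case: Ha => [->|[->|->]]; case: Hb => [->|[->|->]]; constructor.
Qed.

Lemma chiN a : chi (- a) = - chi a.
Proof.
have Ha : (a %% 3)%Z = 0 \/ (a %% 3)%Z = 1 \/ (a %% 3)%Z = 2 by lia.
by rewrite /chi -modzNm; case: Ha => [->|[->|->]].
Qed.

Lemma chi_double a : chi (2 * a) = - chi a.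
Proof.
rewrite -chiN /chi; have -> // : ((2 * a) %% 3)%Z = ((- a) %% 3)%Z by lia.
Qed.

Variant chi_val_spec : int -> Prop :=
| ChiZero : chi_val_spec 0 | ChiOne : chi_val_spec 1 | ChiOpp : chi_val_spec (-1).

Lemma chi_val a : chi_val_spec (chi a).
Proof. by rewrite /chi; case: ifP => _; [|case: ifP => _]; constructor. Qed.

Lemma epsD a b : eps (a + b) = eps a * eps b.
Proof.
have Ha : (a %% 2)%Z = 0 \/ (a %% 2)%Z = 1 by lia.
have Hb : (b %% 2)%Z = 0 \/ (b %% 2)%Z = 1 by lia.
by rewrite /eps -modzDm; case: Ha => [->|->]; case: Hb => [->|->].
Qed.

Lemma epsN a : eps (- a) = eps a.
Proof.
have Ha : (a %% 2)%Z = 0 \/ (a %% 2)%Z = 1 by lia.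
by rewrite /eps -modzNm; case: Ha => [->|->].
Qed.

Variant sign_spec : int -> Prop := SignP : sign_spec 1 | SignN : sign_spec (-1).

Lemma eps_sign a : sign_spec (eps a).
Proof. by rewrite /eps; case: ifP => _; constructor. Qed.

(* [chi a] and [phi a] are multiples of [sin (2 pi a / 3)] and [sin (pi a / 3)], and
   [2 - 3 * chi a ^+ 2] is [2 cos (2 pi a / 3)]: this is the sine addition formula. *)
Lemma chi_sub a b : chi (a + b) - chi (a - b) = (2 - 3 * chi a ^+ 2) * chi b.
Proof.
have -> : chi (a - b) = - chi (b - a) by rewrite -chiN opprB.
by case: (chiP a b).
Qed.

Definition phi (a : int) := chi a * eps a.

Lemma phi_sub a b : phi (a + b) - phi (a - b) = (2 - 3 * chi a ^+ 2) * eps a * phi b.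
Proof. by rewrite /phi !epsD epsN -[_ - _]mulrBl chi_sub; ring. Qed.

(** Telescoping. In the sums below the upper bound m is kept apart from the parameter d of the
    summands, which makes induction on m possible; m = d is set only when the sums are used. *)
Lemma sum_nat_closed (F W : nat -> int) :
  W 1%N = 0 -> (forall m, W m.+1 = W m + F m) -> forall m, (0 < m)%N ->
  \sum_(1 <= b < m) F b = W m.
Proof.
move=> W1 WS [//|m] _; elim: m => [|m IH]; first by rewrite big_nil W1.
by rewrite big_nat_recr //= IH -WS.
Qed.

Lemma chi_1 : chi 1 = 1. Proof. by []. Qed.
Lemma eps_1 : eps 1 = -1. Proof. by []. Qed.

(* The right-hand sides are quasi-polynomials of period 6 in [m] and [d], found by
   interpolation. *)
Lemma sum_chi_chi (d : int) (m : nat) : (0 < m)%N ->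
  \sum_(1 <= b < m) 12 *
    (chi b%:Z * chi (d - b%:Z) - chi b%:Z * chi d - chi d * chi b%:Z) =
  2 * chi m + 15 * chi m * chi d - 3 * chi m * chi d ^+ 2 + 6 * chi m ^+ 2 -
  15 * chi m ^+ 2 * chi d - 9 * chi m ^+ 2 * chi d ^+ 2 - 8 * m%:Z + 12 *
  m%:Z * chi d ^+ 2.
Proof.
move: m; apply: sum_nat_closed => [|m] /=.
  rewrite chi_1 ; ring.
rewrite -[m.+1]addn1 PoszD.
by case: (chiP m d); ring.
Qed.

Lemma sum_phi_phi (d : int) (m : nat) : (0 < m)%N ->
  \sum_(1 <= b < m) 12 *
    (phi b%:Z * phi (d - b%:Z) - phi b%:Z * phi d - phi d * phi b%:Z) =
  24 * chi d * eps d - 24 * eps m * chi d * eps d + 2 * chi m * eps d + 3 *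
  chi m * chi d * eps d - 3 * chi m * chi d ^+ 2 * eps d + 12 * chi m * eps
  m * chi d * eps d + 6 * chi m ^+ 2 * eps d - 3 * chi m ^+ 2 * chi d * eps
  d - 9 * chi m ^+ 2 * chi d ^+ 2 * eps d + 36 * chi m ^+ 2 * eps m * chi d
  * eps d - 8 * m%:Z * eps d + 12 * m%:Z * chi d ^+ 2 * eps d.
Proof.
move: m; apply: sum_nat_closed => [|m] /=.
  rewrite chi_1 eps_1; ring.
rewrite -[m.+1]addn1 PoszD /phi !epsD ?epsN eps_1.
by case: (eps_sign m); case: (eps_sign d); case: (chiP m d); ring.
Qed.

Lemma sum_phi_deps (d : int) (m : nat) : (0 < m)%N ->
  \sum_(1 <= b < m) 12 *
    (phi b%:Z * ((d - b%:Z) * eps (d - b%:Z)) - phi b%:Z * (d * eps d)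
     - phi d * (b%:Z * eps b%:Z)) =
  3 * chi d * eps d - 3 * eps m * chi d * eps d - 4 * chi m * eps d + 12 * d
  * eps d - 12 * d * eps m * eps d - 6 * d * chi m * eps d + 6 * d * chi m *
  eps m * eps d + 6 * d * chi m ^+ 2 * eps d + 18 * d * chi m ^+ 2 * eps m *
  eps d + 4 * m%:Z * eps d + 6 * m%:Z * eps m * chi d * eps d + 6 * m%:Z *
  chi m * eps d - 6 * m%:Z * chi m ^+ 2 * eps d.
Proof.
move: m; apply: sum_nat_closed => [|m] /=.
  rewrite chi_1 eps_1; ring.
rewrite -[m.+1]addn1 PoszD /phi !epsD ?epsN eps_1.
by case: (eps_sign m); case: (eps_sign d); case: (chiP m d); ring.
Qed.

Lemma sum_chi_deps (d : int) (m : nat) : (0 < m)%N ->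
  \sum_(1 <= b < m) 4 *
    (chi b%:Z * ((d - b%:Z) * eps (d - b%:Z)) - chi b%:Z * (d * eps d)
     - chi d * (b%:Z * eps b%:Z)) =
  chi d - eps m * chi d - 4 * chi m * eps m * eps d - 4 * d * eps d + 4 * d
  * eps m * eps d + 2 * d * chi m * eps d - 2 * d * chi m * eps m * eps d -
  2 * d * chi m ^+ 2 * eps d - 6 * d * chi m ^+ 2 * eps m * eps d - 4 * m%:Z
  * eps m * eps d + 2 * m%:Z * eps m * chi d + 2 * m%:Z * chi m * eps m *
  eps d + 6 * m%:Z * chi m ^+ 2 * eps m * eps d.
Proof.
move: m; apply: sum_nat_closed => [|m] /=.
  rewrite chi_1 eps_1; ring.
rewrite -[m.+1]addn1 PoszD !epsD ?epsN eps_1.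
by case: (eps_sign m); case: (eps_sign d); case: (chiP m d); ring.
Qed.

Lemma sum_d_d (d : int) (m : nat) : (0 < m)%N ->
  \sum_(1 <= b < m) 6 *
    (b%:Z * (d - b%:Z) - b%:Z * d - d * b%:Z) =
  - m%:Z + 3 * m%:Z * d + 3 * m%:Z ^+ 2 - 3 * m%:Z ^+ 2 * d - 2 * m%:Z ^+ 3.
Proof.
move: m; apply: sum_nat_closed => [|m] /=.
  by ring.
by rewrite -[m.+1]addn1 PoszD; ring.
Qed.

Lemma sum_d_deps (d : int) (m : nat) : (0 < m)%N ->
  \sum_(1 <= b < m) 4 *
    (b%:Z * ((d - b%:Z) * eps (d - b%:Z)) - b%:Z * (d * eps d)
     - d * (b%:Z * eps b%:Z)) =
  d - d * eps d - d * eps m + d * eps m * eps d - 2 * m%:Z * eps m * eps d +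
  2 * m%:Z * d * eps d + 2 * m%:Z * d * eps m - 2 * m%:Z * d * eps m * eps d
  + 2 * m%:Z ^+ 2 * eps m * eps d - 2 * m%:Z ^+ 2 * d * eps d.
Proof.
move: m; apply: sum_nat_closed => [|m] /=.
  rewrite eps_1; ring.
rewrite -[m.+1]addn1 PoszD !epsD ?epsN eps_1.
by case: (eps_sign m); case: (eps_sign d); ring.
Qed.

(** * Convolutions of Lambert series *)

(** Lets the conclusion of [liouville_prod] be simplified while its last premise, the closed form of
    the finite sums, is still open. *)
Lemma cut_premise (P Q R : Prop) : (P -> Q) -> P -> (Q -> R) -> R.
Proof. by move=> PQ p; apply; exact: PQ. Qed.

Lemma eq_lam (s t : int -> int) :
  (forall d : nat, (0 < d)%N -> s d = t d) -> lam s = lam t.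
Proof.
move=> st; apply/funext => n; rewrite /lam big_nat_cond [RHS]big_nat_cond.
by apply: eq_bigr => d /andP[/andP[d0 _] _]; exact: st.
Qed.

Lemma lam_sum (r : seq (int * (int -> int))) n :
  lam (fun d => \sum_(p <- r) p.1 * p.2 d) n = \sum_(p <- r) p.1 * lam p.2 n.
Proof.
rewrite /lam exchange_big; apply: eq_bigr => p _.
by rewrite mulr_sumr.
Qed.

(** The sign is twice the indicator of even d minus 1, and restriction to even d is the substitution
    q -> q^2. *)
Lemma lam_eps s c n : (forall d, s (2 * d) = c * s d) ->
  lam (fun d => s d * eps d) n = 2 * c * V 2 (lam s) n - lam s n.
Proof.
move=> sc; pose s2 (d : int) := if (2 %| `|d|)%N then s d else 0.
rewrite (@eq_lam _ (fun d => \sum_(p <- [:: (2, s2); (-1, s)]) p.1 * p.2 d)).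
  rewrite lam_sum !big_cons big_nil /= lam_dil // mulN1r addr0 -mulrA.
  congr (2 * _ - _); rewrite /V /rescale; case: ifP; rewrite ?mulr0 // => _.
  by rewrite -lamZ; congr lam; apply/funext => d; rewrite sc.
move=> d _; rewrite !big_cons big_nil /s2 /= /eps.
have -> : ((d%:Z %% 2)%Z == 0) = (2 %| d)%N by lia.
by case: ifP => _; ring.
Qed.

Lemma lam_chi2 s c n : (forall d, s (3 * d) = c * s d) ->
  lam (fun d => s d * chi d ^+ 2) n = lam s n - c * V 3 (lam s) n.
Proof.
move=> sc; pose s3 (d : int) := if (3 %| `|d|)%N then s d else 0.
rewrite (@eq_lam _ (fun d => \sum_(p <- [:: (1, s); (-1, s3)]) p.1 * p.2 d)).
  rewrite lam_sum !big_cons big_nil /= lam_dil // mulN1r addr0 mul1r.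
  congr (_ - _); rewrite /V /rescale; case: ifP; rewrite ?mulr0 // => _.
  by rewrite -lamZ; congr lam; apply/funext => d; rewrite sc.
move=> d _; rewrite !big_cons big_nil /s3 /= /chi.
rewrite modz_nat /dvdn; have := ltn_pmod d (ltn0Sn 2).
by case: (d %% 3)%N => [|[|[|]]] //= _; ring.
Qed.

Lemma S2_lincomb (r : seq (int * ((int -> int) * (int -> int)))) n :
  S2 (fun a b => \sum_(p <- r) p.1 * (p.2.1 a * p.2.2 b)) n =
  \sum_(p <- r) p.1 * (lam p.2.1 * lam p.2.2) n.
Proof.
under [RHS]eq_bigr => p _ do rewrite -S2_lam /S2 mulr_sumr.
rewrite [RHS]exchange_big; apply: eq_bigr => a _ /=.
under [RHS]eq_bigr => p _ do rewrite mulr_sumr.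
rewrite [RHS]exchange_big; apply: eq_bigr => b _ /=.
by rewrite mulr_suml; apply: eq_bigr => p _; ring.
Qed.

(** Liouville's identity for f(a,b) = s(a) t(b). An addition theorem, recorded in [r], separates the
    variables, so the transformed double sum is a combination of products of Lambert series; [l]
    records the closed form of the finite sums, and [k] clears its denominators. The extra term
    [k * (s d * t d)] absorbs the -1 in the diagonal factor n/d - 1. *)
Lemma liouville_prod s t k (r : seq (int * ((int -> int) * (int -> int))))
    (l : seq (int * (int -> int))) n :
  (forall a, s (- a) = - s a) -> (forall a, t (- a) = - t a) ->
  (forall a b, s a * t (a + b) + s (a + b) * t a - s (a - b) * t a - s a * t (a - b)
     = \sum_(p <- r) p.1 * (p.2.1 a * p.2.2 b)) ->
  (forall d : nat, (0 < d)%N ->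
     \sum_(1 <= b < d) k * (s b%:Z * t (d%:Z - b%:Z) - s b%:Z * t d - s d * t b%:Z)
     = \sum_(p <- l) p.1 * p.2 d + k * (s d * t d)) ->
  k * (2 * (lam s * lam t) n) =
  k * (\sum_(p <- r) p.1 * (lam p.2.1 * lam p.2.2) n)
  + k * (\sum_(1 <= d < n.+1 | (d %| n)%N) (n %/ d)%:Z * (s d * t d))
  + \sum_(p <- l) p.1 * lam p.2 n.
Proof.
move=> sN tN Tst cst.
rewrite -S2_lam liouville; last 2 first.
- by move=> a b; rewrite sN mulNr.
- by move=> a b; rewrite tN mulrN.
rewrite (_ : S2 _ n = \sum_(p <- r) p.1 * (lam p.2.1 * lam p.2.2) n); last first.
  rewrite -S2_lincomb; congr (S2 _ n).
  by apply/funext => a; apply/funext => b; exact: Tst.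
rewrite !mulrDr -!addrA; congr (_ + _).
under eq_bigr => d _ do rewrite mulrBl mul1r.
rewrite sumrB mulrBr -addrA; congr (_ + _).
rewrite -lam_sum -(lamZ k) -mulN1r /lam !mulr_sumr -big_split.
rewrite big_nat_cond [RHS]big_nat_cond; apply: eq_bigr => d /andP[/andP[d0 _] _] /=.
by rewrite mulr_sumr cst //; ring.
Qed.

Lemma sum_codiv_qD (s : int -> int) n :
  \sum_(1 <= d < n.+1 | (d %| n)%N) (n %/ d)%:Z * (d%:Z * s d) = qD (lam s) n.
Proof.
rewrite /qD /lam mulr_sumr; apply: eq_bigr => d dn.
by rewrite mulrA -PoszM divnK // natz.
Qed.

(** The constants are left out: [1 + 6 X] will be the theta series, [1 - 24 U] and [1 + 240 W3] are
    E_2 and E_4. [Z] and [UE] are the twists of [X] and [U] by (-1)^d. *)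
Definition X : fps := lam chi.
Definition Z : fps := lam phi.
Definition U : fps := lam id.
Definition UE : fps := lam (fun d => d * eps d).
Definition W3 : fps := lam (fun d => d ^+ 3).

(** Passing to the codivisor e = n/d, the square of the character removes those e for which 3
    divides n/e, which are the divisors of n/3. *)
Lemma sum_codiv_chi2 n :
  \sum_(1 <= d < n.+1 | (d %| n)%N) (n %/ d)%:Z * chi d ^+ 2 = U n - V 3 U n.
Proof.
pose G e := e%:Z - (if (3 %| n %/ e)%N then e%:Z else 0).
rewrite (eq_bigr (fun d => G (n %/ d)%N)) ?sum_codivisors; last first.
  move=> d dn; have chi2 : chi d%:Z ^+ 2 = 1 - (3 %| d)%N%:R.
    rewrite /chi modz_nat /dvdn; have := ltn_pmod d (ltn0Sn 2).
    by case: (d %% 3)%N => [|[|[|]]].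
  rewrite chi2 /G; case: (posnP n) => [->|n0]; first by rewrite !div0n dvdn0 mul0r subrr.
  have -> : (n %/ (n %/ d))%N = d.
    by rewrite -{1}(divnK dn) mulKn // divn_gt0 ?(dvdn_gt0 n0 dn) // dvdn_leq.
  by case: (3 %| d)%N => /=; ring.
rewrite sumrB; congr (_ - _); rewrite -big_mkcondr /V /rescale.
case: ifP => n3; last first.
  rewrite big1 // => d /andP[dn d3]; move: n3; rewrite -(divnK dn).
  by rewrite dvdn_mulr.
case: (posnP n) => [->|n0]; first by rewrite div0n /U /lam !big_nil.
rewrite /U /lam [RHS](big_nat_widen _ _ n.+1) ?ltnS ?leq_div //.
rewrite big_nat_cond [RHS]big_nat_cond; apply: eq_bigl => d.
case: (boolP (1 <= d < n.+1)%N) => //= /andP[d0 _].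
have -> : (d %| n)%N && (3 %| n %/ d)%N = (d %| n %/ 3)%N.
  apply/andP/idP => [[dn]|]; first by rewrite !dvdn_divRL // mulnC.
  move=> d3; have dn := dvdn_trans d3 (dvdn_div n3).
  by split=> //; move: d3; rewrite !dvdn_divRL // mulnC.
case: (boolP (d %| n %/ 3)%N) => //= /dvdn_leq.
by rewrite divn_gt0 // dvdn_leq // ltnS => ->.
Qed.

Lemma ZE : Z = - X - V 2 X *+ 2.
Proof.
apply/funext => n; rewrite fpsD !fpsN fpsMn /Z /phi (lam_eps _ (-1)).
  by rewrite /X; ring.
by move=> d; rewrite chi_double mulN1r.
Qed.

Lemma UE_E : UE = V 2 U *+ 4 - U.
Proof.
apply/funext => n; rewrite fpsD fpsN fpsMn /UE (lam_eps _ 2) //.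
by rewrite /U; ring.
Qed.

Definition deps (d : int) := d * eps d.

Lemma depsN d : deps (- d) = - deps d.
Proof. by rewrite /deps epsN mulNr. Qed.

Lemma phiN d : phi (- d) = - phi d.
Proof. by rewrite /phi chiN epsN mulNr. Qed.

Lemma eps_sqr d : eps d * eps d = 1.
Proof. by case: eps_sign. Qed.

Lemma chi_cos d : chi d * (2 - 3 * chi d ^+ 2) = - chi d.
Proof. by case: chi_val. Qed.

Lemma deps_sub a b : deps (a + b) - deps (a - b) = 2 * eps a * deps b.
Proof. by rewrite /deps !epsD epsN; ring. Qed.

Lemma lam_dchi2 : lam (fun d => d * chi d ^+ 2) = U - V 3 U *+ 3.
Proof.
by apply/funext => n; rewrite (lam_chi2 id 3) // fpsD fpsN fpsMn mulr_natl.
Qed.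

Lemma lam_depschi2 : lam (fun d => deps d * chi d ^+ 2) = UE - V 3 UE *+ 3.
Proof.
apply/funext => n; rewrite (lam_chi2 deps 3) ?fpsD ?fpsN ?fpsMn ?mulr_natl //.
move=> d; rewrite /deps (_ : 3 * d = d + d + d); last by ring.
by rewrite !epsD eps_sqr mul1r; ring.
Qed.

(** For s = t = chi the cosine factor of the addition formula is absorbed by [chi_cos], so the
    double sum is again a multiple of X^2. *)
Lemma X_sqr : X ^+ 2 *+ 3 + X = U - V 3 U *+ 3.
Proof.
apply/funext => n; rewrite expr2 !(fpsD, fpsN, fpsMn).
have T a b : chi a * chi (a + b) + chi (a + b) * chi a - chi (a - b) * chi a
    - chi a * chi (a - b) = \sum_(p <- [:: (-2, (chi, chi))]) p.1 * (p.2.1 a * p.2.2 b).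
  rewrite big_seq1 /=.
  transitivity (2 * chi a * (chi (a + b) - chi (a - b))); first by ring.
  by rewrite chi_sub mulrA -[2 * chi a * _]mulrA chi_cos; ring.
have := liouville_prod _ _ 12 _
  [:: (-16, chi); (-8, id); (12, fun d => d * chi d ^+ 2)] n chiN chiN T.
rewrite !big_cons !big_nil /= lam_dchi2 sum_codiv_chi2 -/X -/U => E.
apply: (cut_premise _ _ _ E) => [d d0|{}E]; last first.
  by move: E; rewrite fpsD fpsN fpsMn; lia.
(* The closed form at m = d; the higher powers of the character collapse by its values 0, 1, -1. *)
rewrite sum_chi_chi // !big_cons big_nil /=.
by case: (chi_val d); ring.
Qed.

(** With s = t = phi the two signs at a cancel in the addition formula, and the transformed sum is
    the mixed product of [X] and [Z]. *)
Lemma ZZ_XZ : (Z ^+ 2 + X * Z) *+ 6 =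
  (U - V 3 U) *+ 3 + X *+ 3 + Z *+ 5 + UE - V 3 UE *+ 9.
Proof.
apply/funext => n; rewrite expr2 !(fpsD, fpsN, fpsMn).
have T a b : phi a * phi (a + b) + phi (a + b) * phi a - phi (a - b) * phi a
    - phi a * phi (a - b) = \sum_(p <- [:: (-2, (chi, phi))]) p.1 * (p.2.1 a * p.2.2 b).
  rewrite big_seq1 /=.
  transitivity (2 * phi a * (phi (a + b) - phi (a - b))); first by ring.
  rewrite phi_sub {1}/phi.
  transitivity (2 * (chi a * (2 - 3 * chi a ^+ 2)) * (eps a * eps a) * phi b); first
      by ring.
  by rewrite chi_cos eps_sqr; ring.
have := liouville_prod _ _ 12 _
  [:: (12, chi); (20, phi); (-8, deps); (12, fun d => deps d * chi d ^+ 2)] n phiN phiN T.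
rewrite !big_cons !big_nil /= lam_depschi2 -/X -/Z -/UE => E.
have codiv : \sum_(1 <= d < n.+1 | (d %| n)%N) (n %/ d)%:Z * (phi d * phi d) = U n -
    V 3 U n.
  rewrite -sum_codiv_chi2; apply: eq_bigr => d _; congr (_ * _).
  by rewrite /phi mulrACA eps_sqr mulr1.
rewrite codiv in E.
apply: (cut_premise _ _ _ E) => [d d0|{}E]; last first.
  by move: E; rewrite fpsD fpsN fpsMn; lia.
rewrite sum_phi_phi // !big_cons big_nil /= /phi /deps.
by case: (eps_sign d); case: (chi_val d); ring.
Qed.

(** For the pair [phi], [deps] the signs cancel on the diagonal and leave d chi(d), so the codivisor
    sum is the derivative of [X]. *)
Lemma qDX_eq : (Z * UE) *+ 24 = (X * UE) *+ 24 - (U * Z) *+ 12 + (V 3 U * Z) *+ 108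
  + qD X *+ 12 - X *+ 3 - Z + U *+ 6 - V 3 U *+ 54 + UE *+ 16.
Proof.
have T a b : phi a * deps (a + b) + phi (a + b) * deps a - phi (a - b) * deps a
    - phi a * deps (a - b) = \sum_(p <- [:: (2, (chi, deps)); (2, (id, phi));
       (-3, (fun d => d * chi d ^+ 2, phi))]) p.1 * (p.2.1 a * p.2.2 b).
  rewrite !big_cons big_nil /=.
  transitivity (phi a * (deps (a + b) - deps (a - b)) + deps a * (phi (a + b) - phi
      (a - b))); first by ring.
  rewrite deps_sub phi_sub {1}/phi {2}/deps.
  transitivity ((eps a * eps a) * (2 * chi a * deps b + a * (2 - 3 * chi a ^+ 2) *
      phi b)); first by ring.
  by rewrite eps_sqr; ring.
apply/funext => n.
have := liouville_prod _ _ 12 _ [:: (-3, chi); (-1, phi); (-12, id);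
  (18, fun d => d * chi d ^+ 2); (16, deps)] n phiN depsN T.
rewrite !big_cons !big_nil /= lam_dchi2 -/X -/Z -/UE -/U => E.
have codiv : \sum_(1 <= d < n.+1 | (d %| n)%N) (n %/ d)%:Z * (phi d * deps d) = qD X n.
  rewrite -sum_codiv_qD; apply: eq_bigr => d _; congr (_ * _).
  by rewrite /phi /deps; case: eps_sign; ring.
have expand : (U - V 3 U *+ 3) * Z = U * Z - (V 3 U * Z) *+ 3 by ring.
rewrite codiv expand in E.
rewrite !(fpsD, fpsN, fpsMn).
apply: (cut_premise _ _ _ E) => [d d0|{}E]; last first.
  by move: E; rewrite !(fpsD, fpsN, fpsMn); lia.
rewrite sum_phi_deps // !big_cons big_nil /= /phi /deps.
by case: (eps_sign d); case: (chi_val d); ring.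
Qed.

(** For the pair [chi], [deps] the diagonal keeps its sign, and the codivisor sum is the derivative
    of [Z]. *)
Lemma qDZ_eq : (Z * UE) *+ 8 + (V 3 UE * X) *+ 36 + qD Z *+ 4 + V 3 UE *+ 6 =
  (UE * X) *+ 12 + X *+ 3 + Z + UE *+ 6.
Proof.
have T a b : chi a * deps (a + b) + chi (a + b) * deps a - chi (a - b) * deps a
    - chi a * deps (a - b) = \sum_(p <- [:: (2, (phi, deps)); (2, (deps, chi));
       (-3, (fun d => deps d * chi d ^+ 2, chi))]) p.1 * (p.2.1 a * p.2.2 b).
  rewrite !big_cons big_nil /=.
  transitivity (chi a * (deps (a + b) - deps (a - b)) + deps a * (chi (a + b) - chi
      (a - b))); first by ring.
  by rewrite deps_sub chi_sub /phi; ring.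
apply/funext => n.
have := liouville_prod _ _ 4 _ [:: (-3, chi); (-1, phi); (-4, deps);
  (-2, fun d => deps d * chi d ^+ 2)] n chiN depsN T.
rewrite !big_cons !big_nil /= lam_depschi2 -/X -/Z -/UE => E.
have codiv : \sum_(1 <= d < n.+1 | (d %| n)%N) (n %/ d)%:Z * (chi d * deps d) = qD Z n.
  rewrite -sum_codiv_qD; apply: eq_bigr => d _; congr (_ * _).
  by rewrite /phi /deps; ring.
have expand : (UE - V 3 UE *+ 3) * X = UE * X - (V 3 UE * X) *+ 3 by ring.
have swap : X * UE = UE * X by ring.
rewrite codiv expand swap in E.
rewrite !(fpsD, fpsN, fpsMn).
apply: (cut_premise _ _ _ E) => [d d0|{}E]; last first.
  by move: E; rewrite !(fpsD, fpsN, fpsMn); lia.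
rewrite sum_chi_deps // !big_cons big_nil /= /phi /deps.
by case: (eps_sign d); case: (chi_val d); ring.
Qed.

(** Ramanujan's equation 12 q dE_2/dq = E_2^2 - E_4, before normalisation. *)
Lemma U_sqr : U ^+ 2 *+ 12 + qD U *+ 6 = U + W3 *+ 5.
Proof.
have idN (a : int) : id (- a) = - id a by [].
have T (a b : int) : id a * id (a + b) + id (a + b) * id a - id (a - b) * id a
    - id a * id (a - b) = \sum_(p <- [:: (4, (id, id))]) p.1 * (p.2.1 a * p.2.2 b).
  by rewrite big_seq1 /=; ring.
apply/funext => n.
have := liouville_prod _ _ 6 _ [:: (-1, id); (-5, fun d => d ^+ 3)] n idN idN T.
rewrite !big_cons !big_nil /= -/U -/W3 => E.
have codiv : \sum_(1 <= d < n.+1 | (d %| n)%N) (n %/ d)%:Z * (d%:Z * d%:Z) = qD U n.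
  by rewrite -sum_codiv_qD.
rewrite codiv in E; rewrite expr2 !(fpsD, fpsN, fpsMn).
apply: (cut_premise _ _ _ E) => [d d0|{}E]; last by move: E; lia.
by rewrite sum_d_d // !big_cons big_nil /=; ring.
Qed.

Definition W3E : fps := lam (fun d => d ^+ 3 * eps d).

Lemma W3E_E : W3E = V 2 W3 *+ 16 - W3.
Proof.
apply/funext => n; rewrite fpsD fpsN fpsMn /W3E (lam_eps _ 8).
  by rewrite /W3; ring.
by move=> d; rewrite exprMn.
Qed.

(** From the pair [id], [deps]: the product of [U] and [UE] occurs equally on both sides and drops
    out, leaving a second equation of Ramanujan's type. *)
Lemma UE_sqr : UE ^+ 2 *+ 4 + qD UE *+ 2 = UE + W3E.
Proof.
have idN (a : int) : id (- a) = - id a by [].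
have T (a b : int) : id a * deps (a + b) + id (a + b) * deps a - id (a - b) * deps a
    - id a * deps (a - b) =
    \sum_(p <- [:: (2, (deps, deps)); (2, (deps, id))]) p.1 * (p.2.1 a * p.2.2 b).
  rewrite !big_cons big_nil /=.
  transitivity (a * (deps (a + b) - deps (a - b)) + 2 * b * deps a); first by ring.
  by rewrite deps_sub /deps; ring.
apply/funext => n.
have := liouville_prod _ _ 4 _ [:: (-2, deps); (-2, fun d => d ^+ 3 * eps d)] n idN
    depsN T.
rewrite !big_cons !big_nil /= -/U -/UE -/W3E => E.
have codiv : \sum_(1 <= d < n.+1 | (d %| n)%N) (n %/ d)%:Z * (d%:Z * deps d) = qD UE n.
  by rewrite -sum_codiv_qD.
have swap : U * UE = UE * U by ring.
rewrite codiv swap in E; rewrite expr2 !(fpsD, fpsN, fpsMn).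
apply: (cut_premise _ _ _ E) => [d d0|{}E]; last by move: E; lia.
rewrite sum_d_deps // !big_cons big_nil /= /deps.
by case: (eps_sign d); ring.
Qed.

(** * Level 6 relations *)

(** The certificate format: the notations below assemble l = r from known equations with chosen
    multipliers, and [ring] checks that A - B is the resulting difference. *)
Lemma lincomb {R : comNzRingType} {A B l r : R} : l = r -> A - B = l - r -> A = B.
Proof. by move=> ->; rewrite subrr => /eqP; rewrite subr_eq0 => /eqP. Qed.

Lemma eqD {R : comNzRingType} {l r l' r' : R} : l = r -> l' = r' -> l + l' = r + r'.
Proof. by move=> -> ->. Qed.

Lemma eqM {R : comNzRingType} (c : R) {l r : R} : l = r -> c * l = c * r.
Proof. by move=> ->. Qed.

Notation "e + e'" := (eqD e e') : lincomb_scope.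
Notation "c * e" := (eqM c%R e) : lincomb_scope.
Delimit Scope lincomb_scope with LC.

(* The Borwein theta function a and the Eisenstein series [E_2], [E_4], at [q^k]. *)
Definition a (k : nat) : fps := V k (1 + X *+ 6).
Definition P (k : nat) : fps := V k (1 - U *+ 24).
Definition E (k : nat) : fps := V k (1 + W3 *+ 240).

Lemma V_id f : V 1 f = f.
Proof. by apply/funext => n; rewrite /V /rescale dvd1n divn1. Qed.

Lemma aE k : (0 < k)%N -> a k = 1 + V k X *+ 6.
Proof. by move=> k0; rewrite /a VD V1 // VMn. Qed.
Lemma PE k : (0 < k)%N -> P k = 1 - V k U *+ 24.
Proof. by move=> k0; rewrite /P VD V1 // VN VMn. Qed.
Lemma EE k : (0 < k)%N -> E k = 1 + V k W3 *+ 240.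
Proof. by move=> k0; rewrite /E VD V1 // VMn. Qed.

Lemma Va d k : (0 < d)%N -> V d (a k) = a (d * k). Proof. exact: VV. Qed.
Lemma VP d k : (0 < d)%N -> V d (P k) = P (d * k). Proof. exact: VV. Qed.
Lemma VE d k : (0 < d)%N -> V d (E k) = E (d * k). Proof. exact: VV. Qed.

(** [X_sqr] and its image under q -> q^2 eliminate the dilates of [U] by 3 and 6 from [ZZ_XZ]. *)
Lemma V2U : V 2 U *+ 4 = U *+ 2 - X ^+ 2 *+ 3 + V 2 X ^+ 2 *+ 6 - X * V 2 X *+ 6
  + V 2 X - X *+ 2.
Proof.
have := congr1 (V 2) X_sqr; rewrite !(VD, VMn, VX, VN) // VV // => h2.
have := ZZ_XZ; rewrite ZE UE_E !(VD, VMn, VN) // !VV // => h3.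
apply: (fps_mulrnI 1).
by apply: (lincomb (1 * h3 + 2 * X_sqr + (-12) * h2)%LC); ring.
Qed.

Lemma P2_eq : P 2 *+ 2 = P 1 + a 1 ^+ 2 + a 1 * a 2 *+ 2 - a 2 ^+ 2 *+ 2.
Proof.
rewrite !PE // !aE // !V_id.
by apply: (lincomb ((-12) * V2U)%LC); ring.
Qed.

Lemma P3_eq : P 3 *+ 3 = P 1 + a 1 ^+ 2 *+ 2.
Proof.
rewrite !PE // !aE // !V_id.
by apply: (lincomb ((-24) * X_sqr)%LC); ring.
Qed.

Lemma qDa k : (0 < k)%N -> qD (a k) = qD (V k X) *+ 6.
Proof. by move=> k0; rewrite aE // qDD qD1 add0r qDMn. Qed.

Lemma qDa1 : qD (a 1) *+ 12 =
  a 1 * P 1 + a 1 ^+ 3 + a 1 ^+ 2 * a 2 *+ 6 - a 2 ^+ 3 *+ 8.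
Proof.
have := qDX_eq; rewrite ZE UE_E => h4.
rewrite qDa // !PE // !aE // !V_id.
pose z := - X - V 2 X *+ 2.
by apply: (lincomb ((-6) * h4 + (108 - 216 * z) * X_sqr + (144 * z - 144 * X - 96) *
    V2U)%LC); rewrite /z; ring.
Qed.

Lemma qDa2 : qD (a 2) *+ 12 =
  a 2 * P 1 + a 1 ^+ 3 *+ 2 + a 1 ^+ 2 * a 2 - a 1 * a 2 ^+ 2 *+ 4.
Proof.
have := congr1 (V 2) X_sqr; rewrite !(VD, VMn, VX, VN) // VV // => h2.
have := qDZ_eq; rewrite ZE UE_E !(VD, VMn, VN) // !VV // qDD !qDN qDMn => h5.
have := qDa1; rewrite !qDa // !PE // !aE // !V_id => h1.
apply: (fps_mulrnI 1).
pose z := - X - V 2 X *+ 2.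
by apply: (lincomb ((-18) * h5 + (- 1) * h1 + (- (216 * X + 36)) * X_sqr + (4 * (216
    * X + 36)) * h2 + (144 * z - 72) * V2U)%LC); rewrite /z; ring.
Qed.

Lemma qDP1 : qD (P 1) *+ 12 = P 1 ^+ 2 - E 1.
Proof.
rewrite !PE // !EE // !V_id qDD qDN qDMn qD1.
by apply: (lincomb ((-48) * U_sqr)%LC); ring.
Qed.

Lemma qDP k : (0 < k)%N -> qD (P k) *+ 12 = (P k ^+ 2 - E k) *+ k.
Proof.
move=> k0; have := congr1 (V k) qDP1.
rewrite !VMn !VD VN VX // VP // VE // muln1 => <-.
by rewrite -mulrnA mulnC mulrnA V_qD VP // muln1.
Qed.

(** At (a_1, a_2) this is 2 E_2(q^2) - E_2(q), by [P2_eq]. *)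
Definition G (x y : fps) : fps := x ^+ 2 + x * y *+ 2 - y ^+ 2 *+ 2.

(** [UE_sqr], rewritten as [h3], loses its derivatives to Ramanujan's equation at q and q^2. *)
Lemma E12_sum : E 2 *+ 4 + E 1 = G (a 1) (a 2) ^+ 2 *+ 5.
Proof.
have hP : P 2 *+ 2 - P 1 = G (a 1) (a 2) by rewrite P2_eq /G; ring.
rewrite -hP; have h1 := qDP1; have h2 := qDP 2 isT.
have h3 : (P 2 *+ 4 - P 1) ^+ 2 *+ 5 =
    (qD (P 2) *+ 4 - qD (P 1)) *+ 60 + (E 2 *+ 16 - E 1) *+ 3.
  have := UE_sqr; rewrite UE_E W3E_E qDD qDMn qDN => h.
  rewrite !PE // !EE // !V_id !qDD !qDN !qDMn qD1.
  by apply: (lincomb (720 * h)%LC); ring.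
apply: (fps_mulrnI 1).
by apply: (lincomb ((- 1) * h3 + (-20) * h2 + 5 * h1)%LC); ring.
Qed.

(** Differentiating [P2_eq] gives a second equation for the same pair: Ramanujan's equation brings
    in the E_4, and the terms in [P 1] cancel. *)
Lemma E12_diff : E 1 - E 2 *+ 4 =
  a 1 ^+ 4 *+ 5 + a 1 ^+ 3 * a 2 *+ 4 + a 1 * a 2 ^+ 3 *+ 8 - a 2 ^+ 4 *+ 20.
Proof.
have hP : P 2 *+ 2 = P 1 + G (a 1) (a 2) by rewrite P2_eq /G; ring.
have h1 := qDP1; have h2 := qDP 2 isT.
have := congr1 qD hP; rewrite qDMn qDD /G !(qDD, qDN, qDMn, qDM, qDX) !expr1 => hD.
have hS := congr1 (fun f => f ^+ 2) hP.
apply: (lincomb (1 * h1 + (-2) * h2 + 12 * hD + (a 1 *+ 2 + a 2 *+ 2) * qDa1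
  + (a 1 *+ 2 - a 2 *+ 4) * qDa2 + (-1) * hS)%LC).
by rewrite /G; ring.
Qed.

Lemma E1_eq : E 1 = a 1 ^+ 4 *+ 5 + a 1 ^+ 3 * a 2 *+ 12 - a 1 * a 2 ^+ 3 *+ 16.
Proof.
by apply: (fps_mulrnI 1); apply: (lincomb (1 * E12_sum + 1 * E12_diff)%LC); rewrite
    /G; ring.
Qed.

Lemma E2_eq : E 2 = a 2 ^+ 4 *+ 5 - a 1 * a 2 ^+ 3 *+ 6 + a 1 ^+ 3 * a 2 *+ 2.
Proof.
by apply: (fps_mulrnI 7); apply: (lincomb (1 * E12_sum + (-1) * E12_diff)%LC);
    rewrite /G; ring.
Qed.

(** The same device applied to [P3_eq]. *)
Lemma E3_eq : E 3 *+ 9 = a 1 ^+ 4 *+ 5 - a 1 ^+ 3 * a 2 *+ 12 + a 1 * a 2 ^+ 3 *+ 16.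
Proof.
have hD := congr1 qD P3_eq; have hS := congr1 (fun f => f ^+ 2) P3_eq.
move: hD; rewrite qDMn qDD qDMn qDX expr1 => hD; have h3 := qDP 3 isT.
by apply: (lincomb (3 * h3 + (-1) * qDP1 + (-12) * hD + 1 * hS + (- a 1 *+ 4) * qDa1
  + 1 * E1_eq)%LC); ring.
Qed.

Lemma E6_eq : E 6 *+ 9 = a 2 ^+ 4 *+ 5 + a 1 * a 2 ^+ 3 *+ 6 - a 1 ^+ 3 * a 2 *+ 2.
Proof.
have := congr1 (V 2) P3_eq; rewrite !(VMn, VD, VX) // !VP // !Va // !muln1 => P6_eq.
have hD := congr1 qD P6_eq; have hS := congr1 (fun f => f ^+ 2) P6_eq.
move: hD; rewrite qDMn qDD qDMn qDX expr1 => hD.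
have h6 := qDP (2 * 3) isT; have h2 := qDP 2 isT.
apply: (fps_mulrnI 1).
by apply: (lincomb (3 * h6 + (-1) * h2 + (-12) * hD + 2 * hS + (- a 2 *+ 4) * qDa2
  + 2 * E2_eq + (a 2 ^+ 2 *+ 4) * P2_eq)%LC); ring.
Qed.

(** * Parity and the level 12 conic *)

(* The substitution [q -> -q]. *)
Definition tw (f : fps) : fps := fun n => (-1) ^+ n * f n.

Lemma twD f g : tw (f + g) = tw f + tw g.
Proof. by apply/funext => n; rewrite /tw !fpsD mulrDr. Qed.
Lemma twN f : tw (- f) = - tw f.
Proof. by apply/funext => n; rewrite /tw !fpsN mulrN. Qed.
Lemma twMn f k : tw (f *+ k) = tw f *+ k.
Proof. by apply/funext => n; rewrite /tw !fpsMn mulrnAr. Qed.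
Lemma tw1 : tw 1 = 1.
Proof. by apply/funext => -[|n]; rewrite /tw fps1 ?mulr0 ?mulr1. Qed.
Lemma twM f g : tw (f * g) = tw f * tw g.
Proof.
apply/funext => n; rewrite /tw !fpsM mulr_sumr; apply: eq_bigr => -[i Hi] _ /=.
by rewrite -{1}(subnKC (ltnSE Hi)) exprD; ring.
Qed.
Lemma twX f k : tw (f ^+ k) = tw f ^+ k.
Proof. by elim: k => [|k IH]; rewrite ?expr0 ?tw1 // !exprS twM IH. Qed.

Lemma tw_V_odd k f : odd k -> tw (V k f) = V k (tw f).
Proof.
move=> ok; apply/funext => n; rewrite /tw /V /rescale; case: ifP => [kn|_]; last
    exact: mulr0.
by rewrite -{1}(divnK kn) -signr_odd oddM ok andbT signr_odd.
Qed.

Lemma tw_V_even k f : ~~ odd k -> tw (V k f) = V k f.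
Proof.
move=> /negbTE ok; apply/funext => n; rewrite /tw /V /rescale.
case: ifP => [kn|_]; last exact: mulr0.
by rewrite -{1}(divnK kn) -signr_odd oddM ok andbF mul1r.
Qed.

Definition evens (f : fps) : fps := fun n => f (2 * n)%N.

Lemma tw_evens f : f + tw f = V 2 (evens f) *+ 2.
Proof.
apply/funext => n; rewrite fpsD fpsMn /tw /V /rescale /evens -signr_odd dvdn2.
case: (boolP (odd n)) => on /=; first by rewrite mul0rn expr1 mulN1r subrr.
by rewrite mul1r mulnC divnK ?dvdn2 // mulr2n.
Qed.

(** The Hecke relation at 2: odd divisors of 2n and of n coincide, while the even divisors
    contribute c times a dilate. *)
Lemma evens_lam s c : (forall d, s (2 * d) = c * s d) ->
  forall n, evens (lam s) n = (1 + c) * lam s n - c * V 2 (lam s) n.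
Proof.
move=> sc; pose s2 (d : int) := if (2 %| `|d|)%N then s d else 0.
pose so (d : int) := if (2 %| `|d|)%N then 0 else s d.
have V2s n : lam s2 n = c * V 2 (lam s) n.
  rewrite lam_dil // /V /rescale; case: ifP; rewrite ?mulr0 // => _.
  by rewrite -lamZ; congr lam; apply/funext => d; rewrite sc.
have split n : lam s n = lam s2 n + lam so n.
  rewrite -fpsD -lamD; congr (lam _ n); apply/funext => d; rewrite /s2 /so.
  by case: ifP; rewrite ?addr0 ?add0r.
have odd_part n : lam so (2 * n)%N = lam so n.
  have [->|n0] := posnP n; first by rewrite muln0.
  rewrite /lam [RHS](big_nat_widen _ _ (2 * n).+1) ?ltnS ?leq_pmull //.
  rewrite big_mkcond [RHS]big_mkcond; apply: eq_bigr => d _; rewrite /so absz_nat.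
  case: (boolP (2 %| d)%N) => [_|]; first by case: ifP; case: ifP.
  rewrite dvdn2 negbK => od; rewrite Gauss_dvdr ?coprimen2 //.
  by case: (boolP (d %| n)%N) => //= /(dvdn_leq n0); rewrite ltnS => ->.
move=> n; rewrite /evens split odd_part V2s.
have -> : V 2 (lam s) (2 * n)%N = lam s n by rewrite /V /rescale dvdn_mulr // mulKn.
have := split n; rewrite V2s; lia.
Qed.

Lemma evensX : evens X = V 2 X.
Proof.
apply/funext => n; rewrite /X (evens_lam _ (-1)) ?subrr ?mul0r ?mulN1r ?opprK ?add0r //.
by move=> d; rewrite chi_double mulN1r.
Qed.

Lemma evensU : evens U = U *+ 3 - V 2 U *+ 2.
Proof. by apply/funext => n; rewrite fpsD fpsN !fpsMn /U (evens_lam _ 2) //; ring. Qed.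

Lemma tw_a1 : tw (a 1) = a 4 *+ 2 - a 1.
Proof.
have := tw_evens X; rewrite evensX VV // => h.
rewrite !aE // V_id twD twMn tw1.
by apply: (lincomb (6 * h)%LC); ring.
Qed.

Lemma tw_a2k k : tw (a (2 * k)) = a (2 * k).
Proof. by rewrite tw_V_even // oddM. Qed.

Lemma tw_P1 : tw (P 1) = P 2 *+ 6 - P 4 *+ 4 - P 1.
Proof.
have := tw_evens U; rewrite evensU VD VN !VMn VV // => h.
rewrite !PE // V_id twD twN twMn tw1.
by apply: (lincomb ((-24) * h)%LC); ring.
Qed.

(** As 3 is odd, q -> -q commutes with q -> q^3. Applying it to [P3_eq] and comparing with dilates
    of [P3_eq] eliminates every [P] and leaves a relation between squares, one of them that of
    [tw (a 1)]. *)
Lemma conic : a 1 ^+ 2 + a 4 ^+ 2 *+ 4 = a 1 * a 4 *+ 2 + a 2 ^+ 2 *+ 3.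
Proof.
have h3 := congr1 tw P3_eq.
have : tw (P 3) = P 6 *+ 6 - P 12 *+ 4 - P 3.
  rewrite -(VP 3 1) // tw_V_odd // tw_P1 !(VD, VN, VMn) !VP //.
move: h3; rewrite !(twD, twMn, twX) tw_a1 tw_P1 => h1 h2; rewrite h2 in h1.
have := congr1 (V 2) P3_eq; rewrite !(VMn, VD, VX) // !VP // !Va // !muln1 => h4.
have := congr1 (V 4) P3_eq; rewrite !(VMn, VD, VX) // !VP // !Va // !muln1 => h5.
apply: (fps_mulrnI 3).
by apply: (lincomb ((-1) * h1 + (-1) * P3_eq + 6 * h4 + (-4) * h5)%LC); ring.
Qed.

Lemma evens_V2 f : evens (V 2 f) = f.
Proof. by apply/funext => n; rewrite /evens /V /rescale dvdn_mulr // mulKn. Qed.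

(** The even part is half of a_1^2 + (2 a_4 - a_1)^2, and [conic] trades its mixed term for
    squares. *)
Lemma evens_a1_sqr : evens (a 1 ^+ 2) = a 1 ^+ 2 *+ 3 - V 2 (a 1 ^+ 2) *+ 2.
Proof.
apply: (fps_mulrnI 1); rewrite -[LHS]evens_V2 VMn -tw_evens.
rewrite -[RHS]evens_V2 !(VMn, VD, VN, VX) // VV // !Va // !muln1; congr evens.
rewrite twX tw_a1.
by apply: (lincomb (2 * conic)%LC); ring.
Qed.

Lemma evens_a1 : evens (a 1) = V 2 (a 1).
Proof.
rewrite Va // aE // V_id aE //; apply/funext => n.
rewrite /evens !fpsD !fpsMn [X (2 * n)%N](congr1 (fun h : fps => h n) evensX).
by rewrite !fps1 muln_eq0.
Qed.

(* At an odd index [n >= 3] the coefficient [f n] enters [f ^+ 2] at index [n + 1]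
   only through [2 * f 1 * f n], so the two parity conditions give a recursion. *)
Lemma parity_unique (f g : fps) :
  f 0%N = 1 -> f 1%N = 6 -> evens f = V 2 f ->
  evens (f ^+ 2) = f ^+ 2 *+ 3 - V 2 (f ^+ 2) *+ 2 ->
  g 0%N = 1 -> g 1%N = 6 -> evens g = V 2 g ->
  evens (g ^+ 2) = g ^+ 2 *+ 3 - V 2 (g ^+ 2) *+ 2 ->
  f = g.
Proof.
move=> f0 f1 fe fs g0 g1 ge gs; apply/funext; elim/ltn_ind => n IH.
have dbl m : (m %/ 2 < n)%N -> f (2 * m)%N = g (2 * m)%N.
  move=> mn; have := congr1 (fun h : fps => h m) fe; rewrite /evens => ->.
  have := congr1 (fun h : fps => h m) ge; rewrite /evens => ->.
  by rewrite /V /rescale; case: ifP => // _; exact: IH.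
have sq m : (m < n)%N -> (f ^+ 2) m = (g ^+ 2) m.
  move=> mn; rewrite !expr2 !fpsM; apply: eq_bigr => -[i Hi] _ /=.
  have im := leq_trans Hi mn; rewrite !IH // (leq_ltn_trans (leq_subr _ _)) //.
case: (boolP (odd n)) => on; last first.
  have n2 : n = (2 * n./2)%N by rewrite mul2n even_halfK.
  case: n n2 on IH dbl sq => [|n] n2 on IH dbl sq; first by rewrite f0 g0.
  by rewrite n2; apply: dbl; lia.
case: n on IH dbl sq => [//|[|k]] on IH dbl sq; first by rewrite f1 g1.
pose m := (k.+3)./2.
have m2 : k.+3 = (2 * m)%N by rewrite mul2n /m even_halfK // oddS on.
have top : f k.+3 = g k.+3 by rewrite m2; apply: dbl; lia.
(* With n = k + 2 and n + 1 = 2m, the second parity condition expresses this coefficient by those of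
   the square at m and m/2, both below n. *)
have S : (f ^+ 2) k.+3 = (g ^+ 2) k.+3.
  have := congr1 (fun h : fps => h m) fs; rewrite /evens -m2 => ->.
  have := congr1 (fun h : fps => h m) gs; rewrite /evens -m2 => ->.
  rewrite !(fpsD, fpsN, fpsMn) sq; last by lia.
  by congr (_ - _ *+ 2); rewrite /V /rescale; case: ifP => // _; apply: sq; lia.
have expand (h : fps) : (h ^+ 2) k.+3 = 2 * (h 0%N * h k.+3) + 2 * (h 1%N * h k.+2)
    + \sum_(i < k) h i.+2 * h (k.+1 - i)%N.
  rewrite expr2 fpsM big_ord_recl big_ord_recl big_ord_recr big_ord_recr /=.
  have e1 : (k.+3 - (1 + (1 + k)) = 1)%N by lia.
  have e0 : (k.+3 - (1 + (1 + k.+1)) = 0)%N by lia.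
  rewrite /bump /= e0 e1 subn0.
  have -> : \sum_(i < k) h (1 + (1 + i))%N * h (k.+3 - (1 + (1 + i)))%N =
            \sum_(i < k) h i.+2 * h (k.+1 - i)%N by [].
  by rewrite (_ : k.+3 - (1 + 0) = k.+2)%N ?subn1 // !add1n; ring.
move: S; rewrite !expand top f0 f1 g0 g1.
rewrite (eq_bigr (fun i : 'I_k => g i.+2 * g (k.+1 - i)%N)); last first.
  by move=> [i Hi] _ /=; rewrite !IH //; lia.
by move=> /addIr /addrI; lia.
Qed.

(** * Counting representations *)

Definition counts (T : eqType) (N : T -> int) (r : fps) :=
  forall n, exists s : seq T,
    [/\ uniq s, forall x, (x \in s) = (N x == n%:Z) & (size s)%:Z = r n].

Lemma counts_bij (T T' : eqType) (N : T -> int) (N' : T' -> int) r f g :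
  cancel f g -> cancel g f -> (forall x, N' (f x) = N x) -> counts T N r -> counts T'
      N' r.
Proof.
move=> fg gf NN c n; have [s [us ms ss]] := c n.
exists (map f s); split; last by rewrite size_map.
  by rewrite map_inj_uniq //; exact: can_inj fg.
move=> y; rewrite -{1}(gf y) mem_map ?ms; last exact: can_inj fg.
by rewrite -NN gf.
Qed.

Lemma counts_scale (T : eqType) (N : T -> int) r k : (0 < k)%N ->
  counts T N r -> counts T (fun x => k%:Z * N x) (V k r).
Proof.
move=> k0 c n; rewrite /V /rescale; case: ifP => kn.
  have [s [us ms ss]] := c (n %/ k)%N; exists s; split=> // x.
  rewrite ms -{2}(divnK kn) mulnC PoszM; apply/eqP/eqP => [->//|].
  by apply: mulfI; rewrite eqz_nat -lt0n.
exists [::]; split=> // x; rewrite in_nil; apply/esym/negbTE/eqP => E.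
move: kn; rewrite -[n](absz_nat n) -E abszM absz_nat.
by rewrite dvdn_mulr.
Qed.

Lemma counts_add (T T' : eqType) (N : T -> int) (N' : T' -> int) r r' :
  (forall x, 0 <= N x) -> (forall x, 0 <= N' x) -> counts T N r -> counts T' N' r' ->
  counts (T * T')%type (fun p => N p.1 + N' p.2) ((r : fps) * (r' : fps)).
Proof.
move=> N0 N0' c c' n.
(* Restricting to pairs whose first value is below k makes each induction step add one term of the
   convolution. *)
suff H k : (k <= n.+1)%N -> exists s : seq (T * T'),
    [/\ uniq s, forall p, (p \in s) = (N p.1 + N' p.2 == n%:Z) && (N p.1 < k%:Z)
     & (size s)%:Z = \sum_(i < k) r i * r' (n - i)%N].
  have [s [us ms ss]] := H _ (leqnn _); exists s; split=> // [p|]; last by rewrite fpsM.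
  rewrite ms; apply: andb_idr => /eqP E.
  by have := N0' p.2; lia.
elim: k => [_|k IH kn].
  exists [::]; split=> // [p|]; last by rewrite big_ord0.
  by rewrite in_nil ltNge N0 andbF.
have [s [us ms ss]] := IH (ltnW kn).
have [t [ut mt st]] := c k; have [t' [ut' mt' st']] := c' (n - k)%N.
exists (s ++ [seq (x, y) | x <- t, y <- t']); split.
- rewrite cat_uniq us allpairs_uniq ?andbT //=; last by move=> [? ?] [? ?].
  apply/hasPn => -[x y] /allpairsP[[x' y'] /= [xt yt [-> ->]]].
  rewrite ms /=; move: xt; rewrite mt => /eqP ->.
  by rewrite ltxx andbF.
- move=> [x y]; rewrite mem_cat ms /=.
  have -> : ((x, y) \in [seq (x0, y0) | x0 <- t, y0 <- t']) = (x \in t) && (y \in t').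
    apply/allpairsP/andP => [[[x' y'] /= [xt yt [-> ->]]] // | [xt yt]].
    by exists (x, y).
  rewrite mt mt'.
  by apply/idP/idP; lia.
- by rewrite size_cat size_allpairs PoszD PoszM ss st st' big_ord_recr.
Qed.

Definition quad2 (p : int * int) : int := quad p.1 p.2.

Lemma quad2_ge0 p : 0 <= quad2 p.
Proof. by rewrite /quad2 /quad; nia. Qed.

(** A finite search in the box from -2n to 2n. It is exhaustive because 4 (x^2 + xy + y^2) = 3 x^2 +
    (x + 2y)^2 bounds x, and y by symmetry. *)
Definition theta : fps := fun n =>
  let r := [seq i%:Z - (2 * n)%:Z | i <- iota 0 (4 * n).+1] in
  (size [seq p <- [seq (x, y) | x <- r, y <- r] | quad2 p == n%:Z])%:Z.

Lemma counts_theta : counts (int * int)%type quad2 theta.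
Proof.
move=> n; set r := [seq i%:Z - (2 * n)%:Z | i <- iota 0 (4 * n).+1].
exists [seq p <- [seq (x, y) | x <- r, y <- r] | quad2 p == n%:Z]; split=> //.
  apply/filter_uniq/allpairs_uniq; last by move=> [? ?] [? ?].
    by rewrite map_inj_uniq ?iota_uniq // => i j; lia.
  by rewrite map_inj_uniq ?iota_uniq // => i j; lia.
have mr (x : int) : (`|x| <= (2 * n)%:Z) -> x \in r.
  move=> xn; apply/mapP; exists (absz (x + (2 * n)%:Z)); last by lia.
  by rewrite mem_iota; lia.
have bound (x y : int) : quad x y = n%:Z -> `|x| <= (2 * n)%:Z.
  move=> E; have h : 0 <= (x + 2 * y) ^+ 2 by exact: sqr_ge0.
  have e : (x + 2 * y) ^+ 2 = 4 * n%:Z - 3 * (x * x) by rewrite -E /quad; ring.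
  have : `|x| <= x * x by nia.
  by move: h; rewrite e; lia.
move=> [x y]; rewrite mem_filter; apply: andb_idr => /eqP E.
apply/allpairsP; exists (x, y); split=> //; apply: mr; first exact: bound E.
by apply: (bound y x); rewrite -E /quad2 /quad /=; ring.
Qed.

Definition quad4 (p : (int * int) * (int * int)) : int := quad2 p.1 + quad2 p.2.

Definition ev (x : int) : bool := (x %% 2)%Z == 0.

Lemma evD x y : ev (x + y) = (ev x == ev y). Proof. by rewrite /ev; lia. Qed.
Lemma evN x : ev (- x) = ev x. Proof. by rewrite /ev; lia. Qed.
Lemma evM x y : ev (x * y) = ev x || ev y.
Proof.
rewrite /ev -modzMm; have : (x %% 2)%Z = 0 \/ (x %% 2)%Z = 1 by lia.
by case=> ->; have : (y %% 2)%Z = 0 \/ (y %% 2)%Z = 1; by [lia | case=> ->].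
Qed.
Lemma ev_half x : ev x -> 2 * (x %/ 2)%Z = x. Proof. by rewrite /ev; lia. Qed.

Lemma count_image (T T' : eqType) (s : seq T) (t : seq T') (f : T' -> T) (g : T -> T')
    (p : pred T) : uniq s -> uniq t -> cancel f g ->
  (forall y, y \in t -> (f y \in s) && p (f y)) ->
  (forall x, x \in s -> p x -> (g x \in t) && (f (g x) == x)) ->
  count p s = size t.
Proof.
move=> us ut fg ft gs; rewrite -size_filter -(size_map f t).
apply/perm_size/uniq_perm; first exact: filter_uniq.
  by rewrite map_inj_uniq //; exact: can_inj fg.
move=> x; rewrite mem_filter andbC; apply/andP/mapP => [[xs px]|[y yt ->]].
  by have /andP[gt /eqP e] := gs x xs px; exists (g x).
by apply/andP; exact: ft.
Qed.

(** By the parallelogram law, (p, q) -> (p + q, rot (p - q)) doubles the norm; its image consists of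
    the pairs (x, y) with x congruent to rot' y modulo 2. *)
Lemma count_cong (rot rot' : int * int -> int * int) (m : nat)
    (s t : seq ((int * int) * (int * int))) :
  cancel rot rot' -> cancel rot' rot -> (forall p, quad2 (rot p) = quad2 p) ->
  uniq s -> (forall x, (x \in s) = (quad4 x == (2 * m)%:Z)) ->
  uniq t -> (forall x, (x \in t) = (quad4 x == m%:Z)) ->
  count (fun x => ev (x.1.1 - (rot' x.2).1) && ev (x.1.2 - (rot' x.2).2)) s = size t.
Proof.
move=> K K' qrot us ms ut mt.
pose f (x : (int * int) * (int * int)) :=
  ((x.1.1 + x.2.1, x.1.2 + x.2.2), rot (x.1.1 - x.2.1, x.1.2 - x.2.2)).
pose g (x : (int * int) * (int * int)) :=
  ((((x.1.1 + (rot' x.2).1) %/ 2)%Z, ((x.1.2 + (rot' x.2).2) %/ 2)%Z),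
   (((x.1.1 - (rot' x.2).1) %/ 2)%Z, ((x.1.2 - (rot' x.2).2) %/ 2)%Z)).
have qf x : quad4 (f x) = 2 * quad4 x.
  by rewrite /quad4 /f /= qrot /quad2 /quad /=; ring.
have fg : cancel f g.
  by move=> [[a b] [c d]]; rewrite /f /g /= K /=; congr (_, _, (_, _)); lia.
apply: (@count_image _ _ s t f g) => // [y|x].
  rewrite mt ms qf PoszM => /eqP ->; rewrite eqxx /= K /=.
  by rewrite /ev; apply/andP; split; lia.
rewrite ms => /eqP qx /andP[e1 e2].
have fgx : f (g x) = x.
  move: e1 e2; rewrite /f /g /=; case: x {qx} => [[a b] q] /=.
  have := K' q; case: (rot' q) => [c d] /= <-; rewrite /ev => e1 e2.
  by congr (_, _, rot (_, _)); lia.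
rewrite fgx eqxx andbT mt; move: qx; rewrite -fgx qf PoszM fgx.
by move/mulfI => ->.
Qed.

Lemma ev_quad x y : ev (quad x y) = ev x && ev y.
Proof. by rewrite /quad !expr2 !evD !evM; case: (ev x); case: (ev y). Qed.

(** The form is even only if both variables are, and halving them divides it by 4. *)
Lemma evens_theta : evens theta = V 2 theta.
Proof.
apply/funext => m; rewrite /evens.
have [s [us ms <-]] := counts_theta (2 * m)%N.
have [t [ut mt <-]] := counts_scale _ _ _ 2 isT counts_theta m.
rewrite -(count_predT s); congr (Posz _).
pose f (x : int * int) := (2 * x.1, 2 * x.2).
pose g (x : int * int) := ((x.1 %/ 2)%Z, (x.2 %/ 2)%Z).
have qf x : quad2 (f x) = 4 * quad2 x by rewrite /quad2 /quad /f /=; ring.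
apply: (@count_image _ _ s t f g) => //.
- by move=> [x y]; rewrite /f /g /=; congr (_, _); lia.
- by move=> y; rewrite mt ms qf => /eqP e; rewrite andbT; lia.
move=> x; rewrite ms => /eqP e _.
have : ev (quad2 x) by rewrite e /ev; lia.
rewrite /quad2 ev_quad => /andP[e1 e2].
have fgx : f (g x) = x.
  move: e1 e2; rewrite /f /g /=; case: x {e} => x y /= e1 e2.
  by rewrite !ev_half.
rewrite fgx eqxx andbT mt; move: e; rewrite -fgx qf fgx => e.
by apply/eqP; lia.
Qed.

Lemma counts_theta2 : counts _ quad4 (theta * theta).
Proof. by apply: counts_add; try exact: quad2_ge0; exact: counts_theta. Qed.

Lemma count_sum (T : eqType) (s : seq T) (p p1 p2 p3 : pred T) :
  (forall x, x \in s -> (1 + 2 * p x = p1 x + p2 x + p3 x)%N) ->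
  (size s + 2 * count p s = count p1 s + count p2 s + count p3 s)%N.
Proof.
elim: s => //= x s IH H; have := H x (mem_head _ _).
have := IH (fun y ys => H y (mem_behead (s := x :: s) ys)); lia.
Qed.

(* In [Z[w]^2], with w a cube root of unity, the vectors (x, y) of even norm are those
   with y = u x mod 2 for some u in {1, w, w^2}; each of the three congruences cuts out
   a copy of [Z[w]^2] scaled by 2, and any two of them meet in [2 Z[w]^2]. *)
Lemma evens_theta_sqr :
  evens (theta ^+ 2) = theta ^+ 2 *+ 3 - V 2 (theta ^+ 2) *+ 2.
Proof.
apply/funext => m; rewrite fpsD fpsN !fpsMn /evens expr2.
have [s [us ms <-]] := counts_theta2 (2 * m)%N.
have [t [ut mt <-]] := counts_theta2 m.
have [w [uw mw <-]] := counts_scale _ _ _ 2 isT counts_theta2 m.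
(* With z = -w^2, a primitive sixth root of unity, x + y z has norm x^2 + xy + y^2. [r1] and [r2]
   multiply by z and by z^2 = w, the primed maps are their inverses, and z agrees with w^2 modulo
   2. *)
pose r1 (p : int * int) := (- p.2, p.1 + p.2).
pose r1' (p : int * int) := (p.1 + p.2, - p.1).
pose r2 (p : int * int) := (- p.1 - p.2, p.1).
pose r2' (p : int * int) := (p.2, - p.1 - p.2).
have c0 := count_cong id id m s t (fun=> erefl) (fun=> erefl) (fun=> erefl) us ms ut mt.
have c1 : count (fun x => ev (x.1.1 - (r1' x.2).1) && ev (x.1.2 - (r1' x.2).2)) s =
    size t.
  apply: (count_cong r1) => //.
  - by move=> [x y]; rewrite /r1 /r1' /=; congr (_, _); ring.
  - by move=> [x y]; rewrite /r1 /r1' /=; congr (_, _); ring.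
  - by move=> [x y]; rewrite /quad2 /quad /r1 /=; ring.
have c2 : count (fun x => ev (x.1.1 - (r2' x.2).1) && ev (x.1.2 - (r2' x.2).2)) s =
    size t.
  apply: (count_cong r2) => //.
  - by move=> [x y]; rewrite /r2 /r2' /=; congr (_, _); ring.
  - by move=> [x y]; rewrite /r2 /r2' /=; congr (_, _); ring.
  - by move=> [x y]; rewrite /quad2 /quad /r2 /=; ring.
pose e (x : (int * int) * (int * int)) := [&& ev x.1.1, ev x.1.2, ev x.2.1 & ev x.2.2].
have ce : count e s = size w.
  pose f (x : (int * int) * (int * int)) := ((2 * x.1.1, 2 * x.1.2), (2 * x.2.1, 2 *
      x.2.2)).
  pose g (x : (int * int) * (int * int)) :=
    (((x.1.1 %/ 2)%Z, (x.1.2 %/ 2)%Z), ((x.2.1 %/ 2)%Z, (x.2.2 %/ 2)%Z)).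
  have qf x : quad4 (f x) = 4 * quad4 x by rewrite /quad4 /quad2 /quad /f /=; ring.
  apply: (@count_image _ _ s w f g) => //.
  - by move=> [[x y] [z u]]; rewrite /f /g /=; congr (_, _, (_, _)); lia.
  - move=> y; rewrite mw ms qf => /eqP h; rewrite /e /f /= !evM /= andbT.
    by apply/eqP; lia.
  move=> x; rewrite ms => /eqP h ex.
  have fgx : f (g x) = x.
    move: ex; rewrite /e /f /g /=; case: x {h} => [[x y] [z u]] /= /and4P[? ? ? ?].
    by rewrite !ev_half.
  rewrite fgx eqxx andbT mw; move: h; rewrite -fgx qf fgx => h.
  by apply/eqP; lia.
(* A vector of even norm satisfies exactly one of the three congruences, or all three when it is
   divisible by 2. *)
suff : (size s + 2 * size w = size t + size t + size t)%N by lia.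
rewrite -{1}c0 -{1}c1 -c2 -ce; apply: count_sum => -[[x y] [z u]].
rewrite ms => /eqP h; have : ev (quad4 (x, y, (z, u))) by rewrite h /ev; lia.
rewrite /quad4 /quad2 /= evD !ev_quad /e /r1' /r2' /= !(evD, evN).
by case: (ev x); case: (ev y); case: (ev z); case: (ev u).
Qed.

Lemma theta_lambert : theta = a 1.
Proof.
apply: parity_unique.
- by vm_compute.
- by vm_compute.
- exact: evens_theta.
- exact: evens_theta_sqr.
- by rewrite aE // V_id fpsD fpsMn /X /lam big_nil.
- by rewrite aE // V_id fpsD fpsMn /X /lam big_mkcond big_nat1.
- exact: evens_a1.
- exact: evens_a1_sqr.
Qed.

(** * Eta quotients *)

Lemma qD_qpow j : qD (qpow j) = qpow j *+ j.
Proof.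
apply/funext => n; rewrite fpsMn /qD /qpow; case: eqP => [->|_].
  by rewrite mulr1.
by rewrite mulr0 mul0rn.
Qed.

Lemma fpsMz (f : fps) (k : int) n : (f *~ k) n = f n * k.
Proof.
case: k => k; rewrite ?NegzE ?mulrNz -?pmulrn ?fpsN fpsMn -mulr_natr ?natz //.
by rewrite mulrN.
Qed.

Lemma fac1E j : (0 < j)%N -> fac1 j = 1 - qpow j :> fps.
Proof.
move=> j0; apply/funext => -[|n]; rewrite fpsD fpsN fps1 /fac1 /qpow /=.
  by rewrite eq_sym (gtn_eqF j0) subr0.
by case: eqP => _; rewrite ?sub0r // subr0.
Qed.

Lemma ifac1E j : (0 < j)%N -> ifac1 j = 1 + geo j :> fps.
Proof.
move=> j0; apply/funext => -[|n]; rewrite fpsD fps1 /ifac1 /geo /=.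
  by rewrite dvdn0.
by rewrite add0r; case: ifP.
Qed.

Lemma qD_fac1 j : (0 < j)%N -> qD (fac1 j) = (fac1 j : fps) * (geo j *~ (- j%:Z)).
Proof.
move=> j0; rewrite fac1E // qDD qDN qD1 qD_qpow.
have := geo_rec j j0 => h.
by rewrite mulrNz -pmulrn; apply: (lincomb ((j%:R) * h)%LC); ring.
Qed.

Lemma qD_ifac1 j : (0 < j)%N -> qD (ifac1 j) = (ifac1 j : fps) * (geo j *~ j%:Z).
Proof.
move=> j0; rewrite ifac1E // qDD qD1.
have h := geo_rec j j0; have hD := congr1 qD h; have hu := geo_unit j j0.
move: hD; rewrite qDM qD_qpow qDD qD1 => hD.
rewrite add0r in hD *; rewrite -pmulrn -[LHS]mulr1 -[X in _ * X = _]hu.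
by apply: (lincomb ((1 + geo j) * hD + (- ((1 + geo j) *+ j)) * h)%LC); ring.
Qed.

Lemma qD_expr (f L : fps) k : qD f = f * L -> qD (f ^+ k) = f ^+ k * (L *+ k).
Proof.
case: k => [|k] h; first by rewrite expr0 qD1 mulr0n mulr0.
by rewrite qDX h exprSr; ring.
Qed.

Lemma qD_facpow j e : (0 < j)%N ->
  qD (facpow j e) = (facpow j e : fps) * (geo j *~ (- (j%:Z * e))).
Proof.
move=> j0; case: e => k; rewrite /facpow.
  have -> : spow (fac1 j) k = (fac1 j : fps) ^+ k by rewrite spow_exp.
  rewrite (qD_expr _ _ _ (qD_fac1 j j0)) pmulrn -mulrzA; congr (_ * (_ *~ _)).
  by ring.
have -> : spow (ifac1 j) k.+1 = (ifac1 j : fps) ^+ k.+1 by rewrite spow_exp.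
rewrite (qD_expr _ _ _ (qD_ifac1 j j0)) pmulrn -mulrzA; congr (_ * (_ *~ _)).
by rewrite NegzE; ring.
Qed.

Lemma qD_prod (I : eqType) (r : seq I) (F L : I -> fps) :
  (forall i, i \in r -> qD (F i) = F i * L i) ->
  qD (\prod_(i <- r) F i) = \prod_(i <- r) F i * \sum_(i <- r) L i.
Proof.
elim: r => [|i r IH] H; first by rewrite !big_nil qD1 mulr0.
rewrite !big_cons qDM H ?mem_head // IH; last by move=> j jr; apply: H; rewrite inE
    jr orbT.
by ring.
Qed.

(** The infinite product read diagonally: coefficient n comes from the product cut at n. *)
Definition eta_euler (l : seq (nat * int)) : fps := fun n => prodq l n n.

Definition eta_lambert (l : seq (nat * int)) : fps :=
  \sum_(p <- l) V p.1 U *~ (- (p.1%:Z * p.2)).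

Lemma geo_sum_U k N n : (0 < k)%N -> (n <= N)%N ->
  \sum_(m <- iota 1 N) (geo (k * m) n * m%:Z) = V k U n.
Proof.
move=> k0 nN; rewrite /V /rescale /U.
case: ifP => kn; last first.
  rewrite big1 // => m _; rewrite /geo; case: (boolP (k * m %| n)%N) => [kmn|].
    by rewrite (dvdn_trans (dvdn_mulr _ (dvdnn k)) kmn) in kn.
  by rewrite andbF mul0r.
rewrite (lam_geo _ N); last by rewrite (leq_trans (leq_div _ _)).
rewrite /index_iota subn1; apply: eq_big_seq => m; rewrite mem_iota => /andP[m0 _].
rewrite mulrC /geo; congr (_ * _); congr ((_ : bool)%:R).
case: (posnP n) => [->|n0]; first by rewrite div0n.
rewrite divn_gt0 // dvdn_leq // dvdn_divRL // mulnC.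
by [].
Qed.

Lemma qD_prodq l N : all (fun p => 0 < p.1)%N l ->
  qD (prodq l N) = (prodq l N : fps) *
    \sum_(m <- iota 1 N) \sum_(p <- l) geo (p.1 * m) *~ (- ((p.1 * m)%:Z * p.2)).
Proof.
move=> l0; apply: (qD_prod _ _ (fun m => \prod_(p <- l) (facpow (p.1 * m) p.2 : fps))).
move=> m; rewrite mem_iota => /andP[m0 _].
apply: (qD_prod _ _ (fun p => facpow (p.1 * m) p.2 : fps)) => p pl.
by rewrite qD_facpow // muln_gt0 m0 (allP l0 p pl).
Qed.

Lemma eta_lambert_trunc l N n : all (fun p => 0 < p.1)%N l -> (n <= N)%N ->
  (\sum_(m <- iota 1 N) \sum_(p <- l) geo (p.1 * m) *~ (- ((p.1 * m)%:Z * p.2)) : fps) n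
  = eta_lambert l n.
Proof.
move=> l0 nN; rewrite exchange_big /eta_lambert !fps_sum.
apply: eq_big_seq => p pl; rewrite fpsMz fps_sum -(geo_sum_U _ N) ?(allP l0 p pl) //.
rewrite mulr_suml; apply: eq_bigr => m _; rewrite fpsMz PoszM; ring.
Qed.

Lemma eta_lambert0 l : eta_lambert l 0%N = 0.
Proof.
rewrite /eta_lambert fps_sum big1 // => p _; rewrite fpsMz /V /rescale dvdn0.
by rewrite div0n /U /lam big_nil mul0r.
Qed.

Lemma fps_expr0 (f : fps) k : f 0%N = 1 -> (f ^+ k) 0%N = 1.
Proof.
by move=> f0; elim: k => [|k IH]; rewrite ?expr0 // exprS fpsM big_ord1 f0 IH.
Qed.

Lemma fps_prod0 (I : Type) (r : seq I) (F : I -> fps) :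
  (forall i, F i 0%N = 1) -> (\prod_(i <- r) F i) 0%N = 1.
Proof.
move=> F0; elim: r => [|i r IH]; first by rewrite big_nil.
by rewrite big_cons fpsM big_ord1 F0 IH.
Qed.

Lemma prodq0 l N : prodq l N 0%N = 1.
Proof.
apply: (@fps_prod0 _ _ (fun m => \prod_(p <- l) (facpow (p.1 * m) p.2 : fps))) => m.
apply: (@fps_prod0 _ _ (fun p => facpow (p.1 * m) p.2 : fps)) => -[k [e|e]].
  have -> : facpow (k * m) e = (fac1 (k * m) : fps) ^+ e by rewrite /facpow spow_exp.
  exact: fps_expr0.
have -> : facpow (k * m) (Negz e) = (ifac1 (k * m) : fps) ^+ e.+1.
  by rewrite /facpow spow_exp.
by apply: fps_expr0; rewrite /ifac1 dvdn0.
Qed.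

(** Since L vanishes at 0, coefficient n of f L involves only f below n, so the equation is a
    recursion. It is truncated because the finite products have the right logarithmic derivative
    only up to N. *)
Lemma ode_unique_trunc (f g L M : fps) N :
  f 0%N = g 0%N -> L 0%N = 0 -> (forall n, (n <= N)%N -> L n = M n) ->
  (forall n, (n <= N)%N -> qD f n = (f * L) n) ->
  (forall n, (n <= N)%N -> qD g n = (g * M) n) ->
  forall n, (n <= N)%N -> f n = g n.
Proof.
move=> fg0 L0 LM fN gN; elim/ltn_ind => -[//|n] IH nN.
have fE := fN _ nN; have gE := gN _ nN.
rewrite /qD fpsM big_ord_recr /= subnn L0 mulr0 addr0 in fE.
rewrite /qD fpsM big_ord_recr /= subnn -(LM 0%N) // L0 mulr0 addr0 in gE.
apply: (@mulfI _ n.+1%:R); first by rewrite pnatr_eq0.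
rewrite fE gE; apply: eq_bigr => -[i Hi] _ /=.
by rewrite IH ?(leq_trans (ltnW Hi)) // LM // (leq_trans (leq_subr _ _)).
Qed.

(** The two products have the same logarithmic derivative up to n, hence the same coefficients; no
    expansion of the extra factors is required. *)
Lemma prodq_trunc l N n : all (fun p => 0 < p.1)%N l -> (n <= N)%N ->
  prodq l N n = prodq l n n.
Proof.
move=> l0 nN; pose Lam k : fps :=
  \sum_(m <- iota 1 k) \sum_(p <- l) geo (p.1 * m) *~ (- ((p.1 * m)%:Z * p.2)).
apply: (ode_unique_trunc _ _ (Lam N) (Lam n) n) => //.
- by rewrite !prodq0.
- by rewrite /Lam eta_lambert_trunc // eta_lambert0.
- by move=> i ni; rewrite /Lam !eta_lambert_trunc // (leq_trans ni).
- by move=> i _; rewrite -(qD_prodq l N).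
- by move=> i _; rewrite -(qD_prodq l n).
Qed.

Lemma qD_eta_euler l : all (fun p => 0 < p.1)%N l ->
  qD (eta_euler l) = eta_euler l * eta_lambert l.
Proof.
move=> l0; apply/funext => n; have := congr1 (fun h : fps => h n) (qD_prodq l n l0).
rewrite /qD => ->; rewrite !fpsM; apply: eq_bigr => -[i Hi] _ /=.
by rewrite eta_lambert_trunc ?leq_subr // prodq_trunc.
Qed.

Lemma etaqE l v : eta_weight l = (24 * v)%:Z -> etaq l = qpow v * eta_euler l :> fps.
Proof.
move=> lv; apply/funext => n; rewrite qpowM /etaq lv PoszM mulKz //.
case: (leqP v n) => [vn|nv]; first by rewrite subzn.
by case E : (n%:Z - v%:Z) => [k|k] //; lia.
Qed.

(* Twenty-four times the logarithmic derivative of the eta quotient. *)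
Definition eta_log (l : seq (nat * int)) : fps :=
  \sum_(p <- l) P p.1 *~ (p.1%:Z * p.2).

Lemma eta_logE l v : all (fun p => 0 < p.1)%N l -> eta_weight l = (24 * v)%:Z ->
  eta_log l = (v%:R + eta_lambert l) *+ 24.
Proof.
move=> l0 lv.
have -> : (v%:R + eta_lambert l) *+ 24 =
    1 *~ eta_weight l + \sum_(p <- l) V p.1 U *~ (- (p.1%:Z * p.2)) *+ 24.
  by rewrite mulrnDl sumrMnl lv -pmulrn mulnC mulrnA.
rewrite /eta_weight mulrz_sumr -big_split; apply: eq_big_seq => p pl /=.
rewrite PE ?(allP l0 p pl) // mulrzBl mulrNz mulNrn; congr (_ - _).
rewrite ![_ *+ 24]pmulrn -!mulrzA [in RHS]mulrC.
by [].
Qed.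

(** The equation reads 24 (n - v) h(n) = terms below n, so every coefficient is forced except the
    one at v. *)
Lemma ode_unique (f g L : fps) (v : nat) :
  L 0%N = (24 * v)%:Z -> f v = g v ->
  qD f *+ 24 = f * L -> qD g *+ 24 = g * L -> f = g.
Proof.
move=> L0 fgv fE gE; apply/funext; elim/ltn_ind => n IH.
have [->//|nv] := eqVneq n v.
have ode (h : fps) : qD h *+ 24 = h * L ->
    24 * (n%:Z - v%:Z) * h n = \sum_(i < n) h i * L (n - i)%N.
  move=> /(congr1 (fun k : fps => k n)); rewrite fpsMn fpsM big_ord_recr /= subnn L0.
  rewrite /qD natz PoszM => E; rewrite -[RHS](addrK (h n * (24 * v%:Z))) -E.
  by rewrite -mulr_natr; ring.
apply: (@mulfI _ (24 * (n%:Z - v%:Z))); first by rewrite mulf_neq0 // subr_eq0 eqz_nat.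
by rewrite !ode //; apply: eq_bigr => -[i Hi] _ /=; rewrite IH.
Qed.

(** The quotient begins with q^v, so the factor k has to be the coefficient of [h] at v. *)
Lemma etaq_unique l v (h : fps) (k : nat) :
  all (fun p => 0 < p.1)%N l -> eta_weight l = (24 * v)%:Z ->
  qD h *+ 24 = h * eta_log l -> h v = k%:Z -> (etaq l : fps) *+ k = h.
Proof.
move=> l0 lv hE hv; apply: (ode_unique _ _ (eta_log l) v) => //.
- rewrite (eta_logE _ v) // fpsMn fpsD eta_lambert0 addr0.
  have -> : (v%:R : fps) 0%N = v%:Z by rewrite fpsMn fps1; exact: natz.
  by rewrite -mulr_natr natz -PoszM mulnC.
- rewrite fpsMn hv (etaqE _ v) // qpowM leqnn subnn /eta_euler prodq0.
  exact: natz.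
rewrite qDMn (etaqE _ v) // qDM qD_qpow qD_eta_euler // (eta_logE _ v) //.
by ring.
Qed.

(** * Eta quotients as quartic forms *)

(** Each k E_2(q^k) is E_2(q) plus a quadratic form. In the eta quotients below the exponents add up
    to 8, so [P 1] enters [eta_log] with factor 8, exactly as in 24 q d/dq of a quartic form, and
    cancels. *)
Lemma P4_eq : P 4 *+ 4 = P 1 + G (a 1) (a 2) + G (a 2) (a 4) *+ 2.
Proof.
have := congr1 (V 2) P2_eq; rewrite !(VMn, VD, VN, VX, VM) // !VP // !Va // !muln1 => h.
by apply: (lincomb (2 * h + 1 * P2_eq)%LC); rewrite /G; ring.
Qed.

Lemma P6_eq : P 6 *+ 6 = P 1 + G (a 1) (a 2) + a 2 ^+ 2 *+ 4.
Proof.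
have := congr1 (V 2) P3_eq; rewrite !(VMn, VD, VN, VX, VM) // !VP // !Va // !muln1 => h.
by apply: (lincomb (2 * h + 1 * P2_eq)%LC); rewrite /G; ring.
Qed.

Lemma P12_eq : P 12 *+ 12 = P 1 + G (a 1) (a 2) + G (a 2) (a 4) *+ 2 + a 4 ^+ 2 *+ 8.
Proof.
have := congr1 (V 4) P3_eq; rewrite !(VMn, VD, VN, VX, VM) // !VP // !Va // !muln1 => h.
by apply: (lincomb (4 * h + 1 * P4_eq)%LC); rewrite /G; ring.
Qed.

Lemma conic2 : a 2 ^+ 2 + a 8 ^+ 2 *+ 4 = a 2 * a 8 *+ 2 + a 4 ^+ 2 *+ 3.
Proof.
by have := congr1 (V 2) conic; rewrite !(VMn, VD, VN, VX, VM) // !Va.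
Qed.

Definition qD12 (f : fps) : fps := qD f *+ 12.

Lemma qD12D f g : qD12 (f + g) = qD12 f + qD12 g.
Proof. by rewrite /qD12 qDD mulrnDl. Qed.
Lemma qD12N f : qD12 (- f) = - qD12 f.
Proof. by rewrite /qD12 qDN mulNrn. Qed.
Lemma qD12Mn f k : qD12 (f *+ k) = qD12 f *+ k.
Proof. by rewrite /qD12 qDMn mulrnAC. Qed.
Lemma qD12M f g : qD12 (f * g) = qD12 f * g + f * qD12 g.
Proof. by rewrite /qD12 qDM; ring. Qed.
Lemma qD12X f k : qD12 (f ^+ k.+1) = f ^+ k * qD12 f *+ k.+1.
Proof. by rewrite /qD12 qDX mulrnAC mulrnAr. Qed.

Lemma qD12_a2k k : (0 < k)%N -> qD12 (a (k * 2)) =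
  (a (k * 2) * P k + a k ^+ 3 *+ 2 + a k ^+ 2 * a (k * 2) - a k * a (k * 2) ^+ 2 *+
      4) *+ k.
Proof.
move=> k0; have := congr1 (V k) qDa2.
rewrite !(VMn, VD, VN, VX, VM) // !VP // !Va // !muln1 => <-.
by rewrite /qD12 -Va // -V_qD mulrnAC.
Qed.

Lemma qD12_a1 : qD12 (a 1) = a 1 * P 1 + a 1 ^+ 3 + a 1 ^+ 2 * a 2 *+ 6 - a 2 ^+ 3 *+ 8.
Proof. exact: qDa1. Qed.
Lemma qD12_a2 : qD12 (a 2) = a 2 * P 1 + a 1 ^+ 3 *+ 2 + a 1 ^+ 2 * a 2 - a 1 * a 2
    ^+ 2 *+ 4.
Proof. exact: qDa2. Qed.
Lemma qD12_a4 : qD12 (a 4) = a 4 * (P 1 + G (a 1) (a 2))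
  + (a 2 ^+ 3 *+ 2 + a 2 ^+ 2 * a 4 - a 2 * a 4 ^+ 2 *+ 4) *+ 2.
Proof. by apply: (lincomb (1 * qD12_a2k 2 isT + a 4 * P2_eq)%LC); rewrite /G; ring. Qed.
Lemma qD12_a8 : qD12 (a 8) = a 8 * (P 1 + G (a 1) (a 2) + G (a 2) (a 4) *+ 2)
  + (a 4 ^+ 3 *+ 2 + a 4 ^+ 2 * a 8 - a 4 * a 8 ^+ 2 *+ 4) *+ 4.
Proof. by apply: (lincomb (1 * qD12_a2k 4 isT + a 8 * P4_eq)%LC); rewrite /G; ring. Qed.

Definition qD12E := (qD12D, qD12N, qD12Mn, qD12M, qD12X, qD12_a1, qD12_a2, qD12_a4,
    qD12_a8).

(** * Leading coefficients of quartic forms *)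

Definition eqm (n : nat) (f g : fps) := forall i, (i <= n)%N -> f i = g i.

Lemma eqm_refl n f : eqm n f f. Proof. by []. Qed.
Lemma eqmD n f g f' g' : eqm n f f' -> eqm n g g' -> eqm n (f + g) (f' + g').
Proof. by move=> ef eg i ni; rewrite !fpsD ef ?eg. Qed.
Lemma eqmN n f f' : eqm n f f' -> eqm n (- f) (- f').
Proof. by move=> ef i ni; rewrite !fpsN ef. Qed.
Lemma eqmMn n f f' k : eqm n f f' -> eqm n (f *+ k) (f' *+ k).
Proof. by move=> ef i ni; rewrite !fpsMn ef. Qed.
Lemma eqmM n f g f' g' : eqm n f f' -> eqm n g g' -> eqm n (f * g) (f' * g').
Proof.
move=> ef eg i ni; rewrite !fpsM; apply: eq_bigr => -[j Hj] _ /=.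
by rewrite ef ?eg ?(leq_trans (leq_subr _ _)) // (leq_trans (ltnSE Hj) ni).
Qed.
Lemma eqmX n f f' k : eqm n f f' -> eqm n (f ^+ k) (f' ^+ k).
Proof.
by move=> ef; elim: k => [|k IH]; [exact: eqm_refl | rewrite !exprS; exact: eqmM].
Qed.

Definition q1 : fps := qpow 1.

Lemma q1X k : q1 ^+ k = qpow k.
Proof. by elim: k => [|k IH]; [apply/funext | rewrite exprS IH -qpowD]. Qed.

(** Supplying the remainder [S] explicitly turns the extraction of a leading coefficient into a
    [ring] identity in q. *)
Lemma coef_eqm (f g S : fps) v k :
  eqm v f g -> g = q1 ^+ v *+ k + q1 ^+ v.+1 * S -> f v = k%:Z.
Proof.
move=> e E; rewrite e // E fpsD fpsMn !q1X qpowM ltnn addr0 /qpow eqxx.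
exact: natz.
Qed.

(** Precision 3 is the largest order of vanishing that occurs, in [etaq_f48_3]. *)
Lemma eqm_a1 v : (v <= 3)%N -> eqm v (a 1) (1 + q1 *+ 6 + q1 ^+ 3 *+ 6).
Proof.
move=> v3 i iv; rewrite aE // V_id !(fpsD, fpsMn) q1X /q1 /qpow fps1.
have := leq_trans iv v3; rewrite /X /lam.
by case: i {iv} => [|[|[|[|]]]] // _; rewrite unlock.
Qed.

Lemma eqm_a2 v : (v <= 3)%N -> eqm v (a 2) (1 + q1 ^+ 2 *+ 6).
Proof.
move=> v3 i iv; rewrite aE // !(fpsD, fpsMn) q1X /q1 /qpow fps1.
have := leq_trans iv v3; rewrite /V /rescale /X /lam.
by case: i {iv} => [|[|[|[|]]]] // _; rewrite unlock.
Qed.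

Lemma eqm_a4 v : (v <= 3)%N -> eqm v (a 4) 1.
Proof.
move=> v3 i iv; rewrite aE // !(fpsD, fpsMn) fps1.
have := leq_trans iv v3; rewrite /V /rescale /X /lam.
by case: i {iv} => [|[|[|[|]]]] // _; rewrite unlock.
Qed.

Lemma eqm_a8 v : (v <= 3)%N -> eqm v (a 8) 1.
Proof.
move=> v3 i iv; rewrite aE // !(fpsD, fpsMn) fps1.
have := leq_trans iv v3; rewrite /V /rescale /X /lam.
by case: i {iv} => [|[|[|[|]]]] // _; rewrite unlock.
Qed.

Lemma eta_log_cons k e l z :
  k%:Z * e = z -> eta_log (ep k e :: l) = P k *~ z + eta_log l.
Proof. by move=> <-; rewrite /eta_log big_cons. Qed.

Lemma eta_log_nil : eta_log [::] = 0.
Proof. exact: big_nil. Qed.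

Ltac eqm_eval := repeat lazymatch goal with
  | |- eqm _ (a 1) _ => apply eqm_a1; exact isT
  | |- eqm _ (a 2) _ => apply eqm_a2; exact isT
  | |- eqm _ (a 4) _ => apply eqm_a4; exact isT
  | |- eqm _ (a 8) _ => apply eqm_a8; exact isT
  | |- eqm _ (_ + _) _ => apply eqmD
  | |- eqm _ (- _) _ => apply eqmN
  | |- eqm _ (_ *+ _) _ => apply eqmMn
  | |- eqm _ (_ ^+ _) _ => apply eqmX
  | |- eqm _ (_ * _) _ => apply eqmM
  end.

(* Both sides satisfy the same first-order equation in q d/dq; [K1] and [K2] are the
   quotients of the division by the relations [conic] and [conic2]. *)
Lemma etaq_f46 :
  (etaq [:: ep 1 (2); ep 2 (2); ep 3 (2); ep 6 (2)] : fps) *+ 36 =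
  - a 1 ^+ 4 + a 1 ^+ 2 * a 2 ^+ 2 *+ 5 - a 2 ^+ 4 *+ 4.
Proof.
set H := (X in _ = X); apply: (etaq_unique _ 1) => //; last first.
- apply: (coef_eqm _ _ (
    - 1 *+ 72 - q1 ^+ 1 *+ 108 + q1 ^+ 2 *+ 108 + q1 ^+ 3 *+ 288 + q1 ^+ 4 *+
    2124 - q1 ^+ 5 *+ 432 + q1 ^+ 6 *+ 2160 - q1 ^+ 7 *+ 864 + q1 ^+ 8 *+ 1296
    - q1 ^+ 10 *+ 1296)); first by rewrite /H; eqm_eval.
  by ring.
- rewrite (eta_log_cons 1 (2) _ (2) erefl)
    (eta_log_cons 2 (2) _ (4) erefl)
    (eta_log_cons 3 (2) _ (6) erefl)
    (eta_log_cons 6 (2) _ (12) erefl) eta_log_nil.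
  have -> : qD H *+ 24 = qD12 H *+ 2 by rewrite /qD12 -mulrnA.
  rewrite {1}/H !qD12E.
  by apply: (lincomb ((H *~ (-2)) * P2_eq + (H *~ (-2)) * P3_eq + (H *~ (-2)) *
      P6_eq)%LC); rewrite /H /G; ring.
by rewrite /eta_weight !big_cons big_nil.
Qed.

Lemma etaq_f48 :
  (etaq [:: ep 2 (4); ep 4 (4)] : fps) *+ 36 =
  a 1 * a 2 * a 4 ^+ 2 + a 1 * a 2 * a 4 * a 8 *+ 2 - a 1 * a 2 * a 8 ^+ 2 *+
  8 - a 1 * a 4 ^+ 3 *+ 3 + a 1 * a 4 ^+ 2 * a 8 *+ 2 + a 1 * a 4 * a 8 ^+ 2
  *+ 4 + a 1 * a 8 ^+ 3 *+ 8 - a 2 * a 4 ^+ 3 - a 2 * a 4 ^+ 2 * a 8 *+ 2 + a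
  2 * a 4 * a 8 ^+ 2 *+ 8 + a 4 ^+ 4 *+ 3 - a 4 ^+ 3 * a 8 *+ 2 - a 4 ^+ 2 * a
  8 ^+ 2 *+ 4 - a 4 * a 8 ^+ 3 *+ 8.
Proof.
set H := (X in _ = X); apply: (etaq_unique _ 1) => //; last first.
- apply: (coef_eqm _ _ (
    - q1 ^+ 1 *+ 144 - q1 ^+ 3 *+ 180)); first by rewrite /H; eqm_eval.
  by ring.
- rewrite (eta_log_cons 2 (4) _ (8) erefl)
    (eta_log_cons 4 (4) _ (16) erefl) eta_log_nil.
  have -> : qD H *+ 24 = qD12 H *+ 2 by rewrite /qD12 -mulrnA.
  rewrite {1}/H !qD12E.
  pose K1 : fps :=
    a 1 ^+ 2 * a 4 ^+ 2 *+ 4 + a 1 ^+ 2 * a 4 * a 8 *+ 8 - a 1 ^+ 2 * a 8 ^+ 2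
    *+ 32 + a 1 * a 4 ^+ 3 *+ 4 + a 1 * a 4 ^+ 2 * a 8 *+ 8 - a 1 * a 4 * a 8 ^+
    2 *+ 32 + a 2 ^+ 2 * a 4 ^+ 2 *+ 8 + a 2 ^+ 2 * a 4 * a 8 *+ 16 - a 2 ^+ 2 *
    a 8 ^+ 2 *+ 64 - a 2 * a 4 ^+ 3 *+ 24 + a 2 * a 4 ^+ 2 * a 8 *+ 16 + a 2 * a
    4 * a 8 ^+ 2 *+ 32 + a 2 * a 8 ^+ 3 *+ 64 - a 4 ^+ 4 *+ 8 - a 4 ^+ 3 * a 8
    *+ 16 + a 4 ^+ 2 * a 8 ^+ 2 *+ 64.
  pose K2 : fps :=
    a 1 * a 2 ^+ 2 * a 4 *+ 16 + a 1 * a 2 ^+ 2 * a 8 *+ 16 - a 1 * a 2 * a 4 ^+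
    2 *+ 64 + a 1 * a 2 * a 4 * a 8 *+ 80 + a 1 * a 4 ^+ 3 *+ 16 - a 1 * a 4 ^+
    2 * a 8 *+ 32 - a 1 * a 4 * a 8 ^+ 2 *+ 192 - a 2 ^+ 2 * a 4 ^+ 2 *+ 16 - a
    2 ^+ 2 * a 4 * a 8 *+ 16 + a 2 * a 4 ^+ 3 *+ 64 - a 2 * a 4 ^+ 2 * a 8 *+ 80
    - a 4 ^+ 4 *+ 16 + a 4 ^+ 3 * a 8 *+ 32 + a 4 ^+ 2 * a 8 ^+ 2 *+ 192.
  by apply: (lincomb ((H *~ (-4)) * P2_eq + (H *~ (-4)) * P4_eq + K1 * conic + K2 *
      conic2)%LC); rewrite /H /G /K1 /K2; ring.
by rewrite /eta_weight !big_cons big_nil.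
Qed.

(** The substitution q -> q^3 in [etaq_f48] would lead to a_3, a_6, a_12 and a_24, outside the four
    series, so the differential equation is solved afresh. *)
Lemma etaq_f48_3 :
  (etaq [:: ep 6 (4); ep 12 (4)] : fps) *+ 324 =
  - (a 1 * a 2 * a 4 ^+ 2) + a 1 * a 2 * a 4 * a 8 *+ 2 + a 1 * a 2 * a 8 ^+ 2
  *+ 8 - a 1 * a 4 ^+ 3 *+ 3 - a 1 * a 4 ^+ 2 * a 8 *+ 2 + a 1 * a 4 * a 8 ^+
  2 *+ 4 - a 1 * a 8 ^+ 3 *+ 8 + a 2 * a 4 ^+ 3 - a 2 * a 4 ^+ 2 * a 8 *+ 2 -
  a 2 * a 4 * a 8 ^+ 2 *+ 8 + a 4 ^+ 4 *+ 3 + a 4 ^+ 3 * a 8 *+ 2 - a 4 ^+ 2 *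
  a 8 ^+ 2 *+ 4 + a 4 * a 8 ^+ 3 *+ 8.
Proof.
set H := (X in _ = X); apply: (etaq_unique _ 3) => //; last first.
- apply: (coef_eqm _ _ (
    q1 ^+ 1 *+ 324)); first by rewrite /H; eqm_eval.
  by ring.
- rewrite (eta_log_cons 6 (4) _ (24) erefl)
    (eta_log_cons 12 (4) _ (48) erefl) eta_log_nil.
  have -> : qD H *+ 24 = qD12 H *+ 2 by rewrite /qD12 -mulrnA.
  rewrite {1}/H !qD12E.
  pose K1 : fps :=
    - (a 1 ^+ 2 * a 4 ^+ 2) *+ 4 + a 1 ^+ 2 * a 4 * a 8 *+ 8 + a 1 ^+ 2 * a 8 ^+
    2 *+ 32 - a 1 * a 4 ^+ 3 *+ 4 + a 1 * a 4 ^+ 2 * a 8 *+ 8 + a 1 * a 4 * a 8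
    ^+ 2 *+ 32 - a 2 ^+ 2 * a 4 ^+ 2 *+ 8 + a 2 ^+ 2 * a 4 * a 8 *+ 16 + a 2 ^+
    2 * a 8 ^+ 2 *+ 64 - a 2 * a 4 ^+ 3 *+ 24 - a 2 * a 4 ^+ 2 * a 8 *+ 16 + a 2
    * a 4 * a 8 ^+ 2 *+ 32 - a 2 * a 8 ^+ 3 *+ 64 + a 4 ^+ 4 *+ 8 - a 4 ^+ 3 * a
    8 *+ 16 - a 4 ^+ 2 * a 8 ^+ 2 *+ 64.
  pose K2 : fps :=
    - (a 1 * a 2 ^+ 2 * a 4) *+ 16 + a 1 * a 2 ^+ 2 * a 8 *+ 16 - a 1 * a 2 * a
    4 ^+ 2 *+ 64 - a 1 * a 2 * a 4 * a 8 *+ 80 - a 1 * a 4 ^+ 3 *+ 16 - a 1 * a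
    4 ^+ 2 * a 8 *+ 32 + a 1 * a 4 * a 8 ^+ 2 *+ 192 + a 2 ^+ 2 * a 4 ^+ 2 *+ 16
    - a 2 ^+ 2 * a 4 * a 8 *+ 16 + a 2 * a 4 ^+ 3 *+ 64 + a 2 * a 4 ^+ 2 * a 8
    *+ 80 + a 4 ^+ 4 *+ 16 + a 4 ^+ 3 * a 8 *+ 32 - a 4 ^+ 2 * a 8 ^+ 2 *+ 192.
  by apply: (lincomb ((H *~ (-4)) * P6_eq + (H *~ (-4)) * P12_eq + K1 * conic + K2 *
      conic2)%LC); rewrite /H /G /K1 /K2; ring.
by rewrite /eta_weight !big_cons big_nil.
Qed.

Lemma etaq_f412p :
  (etaq [:: ep 1 (-1); ep 2 (2); ep 3 (3); ep 4 (3); ep 6 (2); ep 12 (-1)] : fps) *+ 36 =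
  - (a 1 * a 2 ^+ 3) - a 1 * a 2 ^+ 2 * a 4 + a 1 * a 2 * a 4 ^+ 2 *+ 4 + a 1
  * a 4 ^+ 3 *+ 4 - a 2 ^+ 4 + a 2 ^+ 3 * a 4 + a 2 ^+ 2 * a 4 ^+ 2 *+ 6 - a 2
  * a 4 ^+ 3 *+ 4 - a 4 ^+ 4 *+ 8.
Proof.
set H := (X in _ = X); apply: (etaq_unique _ 1) => //; last first.
- apply: (coef_eqm _ _ (
    1 *+ 36 - q1 ^+ 2 *+ 36 - q1 ^+ 3 *+ 900 - q1 ^+ 4 *+ 864 - q1 ^+ 5 *+
    2160 - q1 ^+ 6 *+ 1296 - q1 ^+ 7 *+ 1296)); first by rewrite /H; eqm_eval.
  by ring.
- rewrite (eta_log_cons 1 (-1) _ (-1) erefl)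
    (eta_log_cons 2 (2) _ (4) erefl)
    (eta_log_cons 3 (3) _ (9) erefl)
    (eta_log_cons 4 (3) _ (12) erefl)
    (eta_log_cons 6 (2) _ (12) erefl)
    (eta_log_cons 12 (-1) _ (-12) erefl) eta_log_nil.
  have -> : qD H *+ 24 = qD12 H *+ 2 by rewrite /qD12 -mulrnA.
  rewrite {1}/H !qD12E.
  pose K1 : fps :=
    - (a 1 ^+ 2 * a 2 ^+ 2) *+ 12 - a 1 ^+ 2 * a 2 * a 4 *+ 8 + a 1 ^+ 2 * a 4
    ^+ 2 *+ 16 - a 1 * a 2 ^+ 3 *+ 12 - a 1 * a 2 ^+ 2 * a 4 *+ 8 + a 1 * a 2 *
    a 4 ^+ 2 *+ 16 - a 2 ^+ 4 *+ 8 - a 2 ^+ 3 * a 4 *+ 40 + a 2 ^+ 2 * a 4 ^+ 2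
    *+ 56 + a 2 * a 4 ^+ 3 *+ 128 - a 4 ^+ 4 *+ 32.
  by apply: (lincomb ((H *~ (-2)) * P2_eq + (H *~ (-3)) * P3_eq + (H *~ (-3)) * P4_eq
      + (H *~ (-2)) * P6_eq + (H *~ (1)) * P12_eq + K1 * conic)%LC); rewrite /H /G
          /K1; ring.
by rewrite /eta_weight !big_cons big_nil.
Qed.

(** The form is that of [etaq_f412p] with the sign of [a 2] changed, so in the difference f_{4,12}
    only the terms odd in [a 2] survive. *)
Lemma etaq_f412m :
  (etaq [:: ep 1 (3); ep 2 (2); ep 3 (-1); ep 4 (-1); ep 6 (2); ep 12 (3)] : fps) *+ 36 =
  a 1 * a 2 ^+ 3 - a 1 * a 2 ^+ 2 * a 4 - a 1 * a 2 * a 4 ^+ 2 *+ 4 + a 1 * a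
  4 ^+ 3 *+ 4 - a 2 ^+ 4 - a 2 ^+ 3 * a 4 + a 2 ^+ 2 * a 4 ^+ 2 *+ 6 + a 2 * a
  4 ^+ 3 *+ 4 - a 4 ^+ 4 *+ 8.
Proof.
set H := (X in _ = X); apply: (etaq_unique _ 2) => //; last first.
- apply: (coef_eqm _ _ (
    - 1 *+ 108 - q1 ^+ 1 *+ 36 + q1 ^+ 2 *+ 324 - q1 ^+ 3 *+ 864 + q1 ^+ 4 *+
    1728 - q1 ^+ 5 *+ 1296 + q1 ^+ 6 *+ 1296)); first by rewrite /H; eqm_eval.
  by ring.
- rewrite (eta_log_cons 1 (3) _ (3) erefl)
    (eta_log_cons 2 (2) _ (4) erefl)
    (eta_log_cons 3 (-1) _ (-3) erefl)
    (eta_log_cons 4 (-1) _ (-4) erefl)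
    (eta_log_cons 6 (2) _ (12) erefl)
    (eta_log_cons 12 (3) _ (36) erefl) eta_log_nil.
  have -> : qD H *+ 24 = qD12 H *+ 2 by rewrite /qD12 -mulrnA.
  rewrite {1}/H !qD12E.
  pose K1 : fps :=
    a 1 ^+ 2 * a 2 ^+ 2 *+ 12 - a 1 ^+ 2 * a 2 * a 4 *+ 8 - a 1 ^+ 2 * a 4 ^+ 2
    *+ 16 - a 1 * a 2 ^+ 3 *+ 12 + a 1 * a 2 ^+ 2 * a 4 *+ 8 + a 1 * a 2 * a 4
    ^+ 2 *+ 16 + a 2 ^+ 4 *+ 8 - a 2 ^+ 3 * a 4 *+ 40 - a 2 ^+ 2 * a 4 ^+ 2 *+
    56 + a 2 * a 4 ^+ 3 *+ 128 + a 4 ^+ 4 *+ 32.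
  by apply: (lincomb ((H *~ (-2)) * P2_eq + (H *~ (1)) * P3_eq + (H *~ (1)) * P4_eq +
      (H *~ (-2)) * P6_eq + (H *~ (-3)) * P12_eq + K1 * conic)%LC); rewrite /H /G
          /K1; ring.
by rewrite /eta_weight !big_cons big_nil.
Qed.

Lemma etaq_f424 :
  (etaq [:: ep 1 (-4); ep 2 (11); ep 3 (-4); ep 4 (-3); ep 6 (11); ep 12 (-3)] : fps)
      *+ 54 =
  - (a 1 * a 2 * a 4 ^+ 2) *+ 5 + a 1 * a 2 * a 8 ^+ 2 *+ 8 + a 1 * a 4 ^+ 2 *
  a 8 *+ 14 - a 1 * a 8 ^+ 3 *+ 8 - a 2 * a 4 ^+ 3 *+ 7 + a 2 * a 4 * a 8 ^+ 2
  *+ 40 - a 4 ^+ 3 * a 8 *+ 2 - a 4 * a 8 ^+ 3 *+ 40.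
Proof.
set H := (X in _ = X); apply: (etaq_unique _ 1) => //; last first.
- apply: (coef_eqm _ _ (
    1 *+ 216 + q1 ^+ 1 *+ 162 + q1 ^+ 3 *+ 108)); first by rewrite /H; eqm_eval.
  by ring.
- rewrite (eta_log_cons 1 (-4) _ (-4) erefl)
    (eta_log_cons 2 (11) _ (22) erefl)
    (eta_log_cons 3 (-4) _ (-12) erefl)
    (eta_log_cons 4 (-3) _ (-12) erefl)
    (eta_log_cons 6 (11) _ (66) erefl)
    (eta_log_cons 12 (-3) _ (-36) erefl) eta_log_nil.
  have -> : qD H *+ 24 = qD12 H *+ 2 by rewrite /qD12 -mulrnA.
  rewrite {1}/H !qD12E.
  pose K1 : fps :=
    - (a 1 ^+ 2 * a 4 ^+ 2) *+ 20 + a 1 ^+ 2 * a 8 ^+ 2 *+ 32 - a 1 * a 4 ^+ 3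
    *+ 68 + a 1 * a 4 * a 8 ^+ 2 *+ 224 + a 2 ^+ 2 * a 4 ^+ 2 *+ 40 - a 2 ^+ 2 *
    a 8 ^+ 2 *+ 64 - a 2 * a 4 ^+ 2 * a 8 *+ 112 + a 2 * a 8 ^+ 3 *+ 64 - a 4 ^+
    4 *+ 56 + a 4 ^+ 2 * a 8 ^+ 2 *+ 320.
  pose K2 : fps :=
    - (a 1 * a 2 ^+ 2 * a 4) *+ 80 + a 1 * a 2 * a 4 * a 8 *+ 64 - a 1 * a 4 ^+
    3 *+ 128 + a 1 * a 4 * a 8 ^+ 2 *+ 192 + a 2 ^+ 2 * a 4 ^+ 2 *+ 32 - a 2 * a
    4 ^+ 2 * a 8 *+ 544 - a 4 ^+ 4 *+ 64 + a 4 ^+ 2 * a 8 ^+ 2 *+ 960.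
  by apply: (lincomb ((H *~ (-11)) * P2_eq + (H *~ (4)) * P3_eq + (H *~ (3)) * P4_eq
      + (H *~ (-11)) * P6_eq + (H *~ (3)) * P12_eq + K1 * conic + K2 * conic2)%LC);
          rewrite /H /G /K1 /K2; ring.
by rewrite /eta_weight !big_cons big_nil.
Qed.

(** * Normal forms *)

Lemma V_sum (I : Type) (r : seq I) (F : I -> fps) d :
  V d (\sum_(i <- r) F i) = \sum_(i <- r) V d (F i).
Proof.
elim: r => [|i r IH]; last by rewrite !big_cons VD IH.
by rewrite !big_nil; apply/funext => n; rewrite /V /rescale; case: ifP.
Qed.

Lemma VMz d f (k : int) : V d (f *~ k) = V d f *~ k.
Proof. by case: k => k; rewrite ?NegzE ?mulrNz ?VN -!pmulrn VMn. Qed.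

Lemma qD_etaq l v : all (fun p => 0 < p.1)%N l -> eta_weight l = (24 * v)%:Z ->
  qD (etaq l) *+ 24 = (etaq l : fps) * eta_log l.
Proof.
move=> l0 lv; rewrite (etaqE _ v) // qDM qD_qpow qD_eta_euler // (eta_logE _ v) //.
by ring.
Qed.

Lemma etaq_lead l v : eta_weight l = (24 * v)%:Z -> etaq l v = 1.
Proof.
move=> lv; have := congr1 (fun f : fps => f v) (etaqE l v lv) => /= ->.
by rewrite qpowM leqnn subnn /eta_euler prodq0.
Qed.

(** Both sides solve the same differential equation, by the chain rule, and have leading coefficient
    1 at d v; the products are never re-indexed. *)
Lemma V_etaq d l v : (0 < d)%N -> all (fun p => 0 < p.1)%N l ->
  eta_weight l = (24 * v)%:Z ->
  V d (etaq l) = etaq [seq ep (d * p.1) p.2 | p <- l].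
Proof.
move=> d0 l0 lv; set l' := [seq _ | _ <- _].
have l0' : all (fun p => 0 < p.1)%N l'.
  by rewrite all_map; apply/allP => p pl /=; rewrite muln_gt0 d0 (allP l0).
have lv' : eta_weight l' = (24 * (d * v))%:Z.
  rewrite mulnCA PoszM -lv /eta_weight big_map mulr_sumr.
  by apply: eq_bigr => p _ /=; rewrite PoszM mulrA.
apply: (ode_unique _ _ (eta_log l') (d * v)).
- rewrite (eta_logE _ _ l0' lv') fpsMn fpsD eta_lambert0 addr0.
  have -> : ((d * v)%:R : fps) 0%N = (d * v)%:Z by rewrite fpsMn fps1; exact: natz.
  by rewrite -mulr_natr natz -PoszM mulnC.
- by rewrite (etaq_lead _ _ lv') /V /rescale dvdn_mulr // mulKn // etaq_lead.
- have -> : eta_log l' = V d (eta_log l) *+ d.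
    rewrite /eta_log big_map V_sum -sumrMnl; apply: eq_bigr => p _ /=.
    rewrite VMz VP // PoszM [_ *+ d]pmulrn -mulrzA; congr (_ *~ _); ring.
  have := congr1 (V d) (qD_etaq _ _ l0 lv); rewrite VMn VM // => h.
  by rewrite -V_qD; apply: (lincomb (d%:R * h)%LC); ring.
- exact: qD_etaq l0' lv'.
Qed.

Lemma E4tE t : (0 < t)%N -> E4t t = E t.
Proof.
move=> t0; apply/funext => n; rewrite EE // fpsD fpsMn fps1 /E4t /V /rescale.
case: (posnP n) => [->|n0]; first by rewrite dvdn0 div0n /W3 /lam big_nil.
rewrite /= add0r; case: ifP => tn; last by rewrite mul0rn.
rewrite /W3 /lam sum_divisors ?divn_gt0 ?(dvdn_leq n0) //.
rewrite /sigma3 -[RHS]mulr_natl; congr (_ * _).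
rewrite -natz natr_sum; apply: eq_bigr => d _.
by rewrite natrX natz.
Qed.

Definition odds (f : fps) : fps := fun n => if odd n then f n else 0.

Lemma odd_part f : odds f *+ 2 = f - tw f.
Proof.
apply/funext => n; rewrite fpsMn fpsD fpsN /odds /tw -signr_odd; case: ifP => _ /=.
  by rewrite expr1; ring.
by rewrite expr0; ring.
Qed.

(* Modulo [conic] and [conic2] every quartic form in [a 1], [a 2], [a 4], [a 8] has a
   normal form of degree at most one in [a 1] and in [a 2]. *)
Lemma nf_1 : E 1 *+ 1 =
  a 1 * a 2 * a 4 ^+ 2 *+ 60 + a 1 * a 2 * a 4 * a 8 *+ 120 + a 1 * a 4 ^+ 3
  *+ 140 + a 1 * a 4 ^+ 2 * a 8 *+ 120 - a 1 * a 4 * a 8 ^+ 2 *+ 240 - a 1 * a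
  8 ^+ 3 *+ 160 + a 2 * a 4 ^+ 3 *+ 120 + a 2 * a 4 ^+ 2 * a 8 *+ 420 - a 2 *
  a 8 ^+ 3 *+ 360 + a 4 ^+ 4 *+ 225 + a 4 ^+ 3 * a 8 *+ 432 - a 4 ^+ 2 * a 8
  ^+ 2 *+ 300 - a 4 * a 8 ^+ 3 *+ 576.
Proof.
apply: (lincomb (
  1 * E1_eq +
  (a 1 ^+ 2 *+ 5 + a 1 * a 2 *+ 12 + a 1 * a 4 *+ 10 + a 2 ^+ 2 *+ 15 + a 2 * a 4 *+
      24) * conic +
  (a 1 * a 2 *+ 20 + a 1 * a 4 *+ 60 + a 1 * a 8 *+ 40 + a 2 ^+ 2 *+ 45 + a 2 * a 4
      *+ 72 + a 2 * a 8 *+ 90 + a 4 ^+ 2 *+ 75 + a 4 * a 8 *+ 144) * conic2)%LC).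
by ring.
Qed.

Lemma nf_2 : E 2 *+ 1 =
  a 2 * a 4 ^+ 3 *+ 20 + a 2 * a 4 ^+ 2 * a 8 *+ 60 - a 2 * a 8 ^+ 3 *+ 40 + a
  4 ^+ 4 *+ 45 + a 4 ^+ 3 * a 8 *+ 72 - a 4 ^+ 2 * a 8 ^+ 2 *+ 60 - a 4 * a 8
  ^+ 3 *+ 96.
Proof.
apply: (lincomb (
  1 * E2_eq +
  (a 1 * a 2 *+ 2 + a 2 * a 4 *+ 4) * conic +
  (a 2 ^+ 2 *+ 5 + a 2 * a 4 *+ 12 + a 2 * a 8 *+ 10 + a 4 ^+ 2 *+ 15 + a 4 * a 8 *+
      24) * conic2)%LC).
by ring.
Qed.

Lemma nf_3 : E 3 *+ 9 =
  - (a 1 * a 2 * a 4 ^+ 2) *+ 60 + a 1 * a 2 * a 4 * a 8 *+ 120 + a 1 * a 4 ^+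
  3 *+ 140 - a 1 * a 4 ^+ 2 * a 8 *+ 120 - a 1 * a 4 * a 8 ^+ 2 *+ 240 + a 1 *
  a 8 ^+ 3 *+ 160 - a 2 * a 4 ^+ 3 *+ 120 + a 2 * a 4 ^+ 2 * a 8 *+ 420 - a 2
  * a 8 ^+ 3 *+ 360 + a 4 ^+ 4 *+ 225 - a 4 ^+ 3 * a 8 *+ 432 - a 4 ^+ 2 * a 8
  ^+ 2 *+ 300 + a 4 * a 8 ^+ 3 *+ 576.
Proof.
apply: (lincomb (
  1 * E3_eq +
  (a 1 ^+ 2 *+ 5 - a 1 * a 2 *+ 12 + a 1 * a 4 *+ 10 + a 2 ^+ 2 *+ 15 - a 2 * a 4 *+
      24) * conic +
  (- (a 1 * a 2) *+ 20 + a 1 * a 4 *+ 60 - a 1 * a 8 *+ 40 + a 2 ^+ 2 *+ 45 - a 2 * a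
      4 *+ 72 + a 2 * a 8 *+ 90 + a 4 ^+ 2 *+ 75 - a 4 * a 8 *+ 144) * conic2)%LC).
by ring.
Qed.

Lemma nf_4 : E 4 *+ 1 =
  a 4 ^+ 4 *+ 5 + a 4 ^+ 3 * a 8 *+ 12 - a 4 * a 8 ^+ 3 *+ 16.
Proof.
have := congr1 (V 2) E2_eq; rewrite !(VMn, VD, VN, VM, VX) // !Va // ?VE // => h.
apply: (lincomb (
  1 * h +
  (a 2 * a 4 *+ 2 + a 4 * a 8 *+ 4) * conic2)%LC).
by ring.
Qed.

Lemma nf_5 : E 6 *+ 9 =
  - (a 2 * a 4 ^+ 3) *+ 20 + a 2 * a 4 ^+ 2 * a 8 *+ 60 - a 2 * a 8 ^+ 3 *+ 40
  + a 4 ^+ 4 *+ 45 - a 4 ^+ 3 * a 8 *+ 72 - a 4 ^+ 2 * a 8 ^+ 2 *+ 60 + a 4 *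
  a 8 ^+ 3 *+ 96.
Proof.
apply: (lincomb (
  1 * E6_eq +
  (- (a 1 * a 2) *+ 2 - a 2 * a 4 *+ 4) * conic +
  (a 2 ^+ 2 *+ 5 - a 2 * a 4 *+ 12 + a 2 * a 8 *+ 10 + a 4 ^+ 2 *+ 15 - a 4 * a 8 *+
      24) * conic2)%LC).
by ring.
Qed.

Lemma nf_6 : E 8 *+ 1 =
  a 4 ^+ 3 * a 8 *+ 2 - a 4 * a 8 ^+ 3 *+ 6 + a 8 ^+ 4 *+ 5.
Proof.
have := congr1 (V 4) E2_eq; rewrite !(VMn, VD, VN, VM, VX) // !Va // ?VE // => h.
apply: (lincomb (
  1 * h)%LC).
by ring.
Qed.

Lemma nf_7 : E 12 *+ 9 =
  a 4 ^+ 4 *+ 5 - a 4 ^+ 3 * a 8 *+ 12 + a 4 * a 8 ^+ 3 *+ 16.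
Proof.
have := congr1 (V 2) E6_eq; rewrite !(VMn, VD, VN, VM, VX) // !Va // ?VE // => h.
apply: (lincomb (
  1 * h +
  (- (a 2 * a 4) *+ 2 - a 4 * a 8 *+ 4) * conic2)%LC).
by ring.
Qed.

Lemma nf_8 : E 24 *+ 9 =
  - (a 4 ^+ 3 * a 8) *+ 2 + a 4 * a 8 ^+ 3 *+ 6 + a 8 ^+ 4 *+ 5.
Proof.
have := congr1 (V 4) E6_eq; rewrite !(VMn, VD, VN, VM, VX) // !Va // ?VE // => h.
apply: (lincomb (
  1 * h)%LC).
by ring.
Qed.

Lemma nf_9 : (f4_6 : fps) *+ 36 =
  - (a 1 * a 2 * a 4 * a 8) *+ 4 + a 1 * a 4 ^+ 3 *+ 2 + a 1 * a 4 * a 8 ^+ 2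
  *+ 8 + a 2 * a 4 ^+ 2 * a 8 *+ 8 - a 2 * a 8 ^+ 3 *+ 16 - a 4 ^+ 4 *+ 6 + a
  4 ^+ 2 * a 8 ^+ 2 *+ 8.
Proof.
rewrite /f4_6.
apply: (lincomb (
  1 * etaq_f46 +
  (- a 1 ^+ 2 - a 1 * a 4 *+ 2 + a 2 ^+ 2 *+ 2) * conic +
  (- (a 1 * a 4) *+ 2 + a 2 ^+ 2 *+ 2 + a 2 * a 8 *+ 4 - a 4 ^+ 2 *+ 2) * conic2)%LC).
by ring.
Qed.

Lemma nf_10 : V 2 f4_6 *+ 36 =
  - (a 2 * a 4 ^+ 2 * a 8) *+ 2 + a 2 * a 8 ^+ 3 *+ 8 + a 4 ^+ 4 *+ 2 - a 4 ^+
  2 * a 8 ^+ 2 *+ 8.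
Proof.
rewrite /f4_6.
have := congr1 (V 2) etaq_f46; rewrite !(VMn, VD, VN, VM, VX) // !Va // ?VE // => h.
apply: (lincomb (
  1 * h +
  (- a 2 ^+ 2 - a 2 * a 8 *+ 2 + a 4 ^+ 2 *+ 2) * conic2)%LC).
by ring.
Qed.

Lemma nf_11 : V 4 f4_6 *+ 36 =
  - a 4 ^+ 4 + a 4 ^+ 2 * a 8 ^+ 2 *+ 5 - a 8 ^+ 4 *+ 4.
Proof.
rewrite /f4_6.
by have := congr1 (V 4) etaq_f46; rewrite !(VMn, VD, VN, VM, VX) // !Va // ?VE.
Qed.

Lemma nf_12 : (f4_8 : fps) *+ 36 =
  a 1 * a 2 * a 4 ^+ 2 + a 1 * a 2 * a 4 * a 8 *+ 2 - a 1 * a 2 * a 8 ^+ 2 *+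
  8 - a 1 * a 4 ^+ 3 *+ 3 + a 1 * a 4 ^+ 2 * a 8 *+ 2 + a 1 * a 4 * a 8 ^+ 2
  *+ 4 + a 1 * a 8 ^+ 3 *+ 8 - a 2 * a 4 ^+ 3 - a 2 * a 4 ^+ 2 * a 8 *+ 2 + a
  2 * a 4 * a 8 ^+ 2 *+ 8 + a 4 ^+ 4 *+ 3 - a 4 ^+ 3 * a 8 *+ 2 - a 4 ^+ 2 * a
  8 ^+ 2 *+ 4 - a 4 * a 8 ^+ 3 *+ 8.
Proof.
rewrite /f4_8.
apply: (lincomb (
  1 * etaq_f48)%LC).
by ring.
Qed.

Lemma nf_13 : V 3 f4_8 *+ 324 =
  - (a 1 * a 2 * a 4 ^+ 2) + a 1 * a 2 * a 4 * a 8 *+ 2 + a 1 * a 2 * a 8 ^+ 2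
  *+ 8 - a 1 * a 4 ^+ 3 *+ 3 - a 1 * a 4 ^+ 2 * a 8 *+ 2 + a 1 * a 4 * a 8 ^+
  2 *+ 4 - a 1 * a 8 ^+ 3 *+ 8 + a 2 * a 4 ^+ 3 - a 2 * a 4 ^+ 2 * a 8 *+ 2 -
  a 2 * a 4 * a 8 ^+ 2 *+ 8 + a 4 ^+ 4 *+ 3 + a 4 ^+ 3 * a 8 *+ 2 - a 4 ^+ 2 *
  a 8 ^+ 2 *+ 4 + a 4 * a 8 ^+ 3 *+ 8.
Proof.
rewrite /f4_8.
have -> : V 3 (etaq [:: ep 2 4; ep 4 4]) = etaq [:: ep 6 4; ep 12 4].
  by rewrite (V_etaq 3 [:: ep 2 4; ep 4 4] 1) // /eta_weight !big_cons big_nil.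
apply: (lincomb (
  1 * etaq_f48_3)%LC).
by ring.
Qed.

Lemma nf_14 : (f4_12 : fps) *+ 36 =
  a 1 * a 2 * a 4 ^+ 2 *+ 2 - a 1 * a 4 ^+ 2 * a 8 *+ 12 + a 1 * a 8 ^+ 3 *+
  16 - a 2 * a 4 ^+ 3 *+ 2 + a 4 ^+ 3 * a 8 *+ 12 - a 4 * a 8 ^+ 3 *+ 16.
Proof.
have -> : (f4_12 : fps) = (etaq [:: ep 1 (-1); ep 2 (2); ep 3 (3); ep 4 (3); ep 6
    (2); ep 12 (-1)] : fps) - (etaq [:: ep 1 (3); ep 2 (2); ep 3 (-1); ep 4 (-1); ep
        6 (2); ep 12 (3)] : fps) by [].
rewrite mulrnBl etaq_f412p etaq_f412m.
apply: (lincomb (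
  (- (a 1 * a 2) *+ 2 - a 1 * a 8 *+ 4 + a 2 * a 4 *+ 2 + a 4 * a 8 *+ 4) * conic2)%LC).
by ring.
Qed.

Lemma nf_15 : V 2 f4_12 *+ 36 =
  - (a 2 * a 4 ^+ 3) *+ 2 + a 2 * a 4 * a 8 ^+ 2 *+ 8 + a 4 ^+ 3 * a 8 *+ 2 -
  a 4 * a 8 ^+ 3 *+ 8.
Proof.
have -> : (f4_12 : fps) = (etaq [:: ep 1 (-1); ep 2 (2); ep 3 (3); ep 4 (3); ep 6
    (2); ep 12 (-1)] : fps) - (etaq [:: ep 1 (3); ep 2 (2); ep 3 (-1); ep 4 (-1); ep
        6 (2); ep 12 (3)] : fps) by [].
have := congr1 (V 2) etaq_f412p; rewrite !(VMn, VD, VN, VM, VX) // !Va // => h1.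
have := congr1 (V 2) etaq_f412m; rewrite !(VMn, VD, VN, VM, VX) // !Va // => h2.
rewrite mulrnDl mulNrn h1 h2.
by ring.
Qed.

Lemma nf_16 : odds f4_24 *+ 108 =
  - (a 1 * a 2 * a 4 ^+ 2) *+ 10 + a 1 * a 2 * a 8 ^+ 2 *+ 16 + a 1 * a 4 ^+ 2
  * a 8 *+ 28 - a 1 * a 8 ^+ 3 *+ 16 + a 2 * a 4 ^+ 3 *+ 10 - a 2 * a 4 * a 8
  ^+ 2 *+ 16 - a 4 ^+ 3 * a 8 *+ 28 + a 4 * a 8 ^+ 3 *+ 16.
Proof.
rewrite /f4_24.
(* The odd part is half the difference with q -> -q, which sends [a 1] to [2 a_4 - a_1] and fixes
   [a 2], [a 4], [a 8], so it is a quartic form too. *)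
rewrite -[108%N]/(2 * 54)%N mulrnA odd_part mulrnBl -twMn etaq_f424.
rewrite !(twMn, twD, twN, twM, twX) tw_a1 (tw_a2k 1) (tw_a2k 2) (tw_a2k 4).
by ring.
Qed.

(** * The nineteen theta products in normal form *)

Lemma row_112 : a 1 * a 1 * a 1 * a 2 =
  a 1 * a 2 * a 4 ^+ 2 *+ 9 + a 1 * a 4 ^+ 2 * a 8 *+ 18 - a 1 * a 8 ^+ 3 *+
  24 + a 2 * a 4 ^+ 3 *+ 10 + a 4 ^+ 3 * a 8 *+ 36 - a 4 * a 8 ^+ 3 *+ 48.
Proof.
apply: (lincomb (
  (a 1 * a 2 + a 2 * a 4 *+ 2) * conic +
  (a 1 * a 2 *+ 3 + a 1 * a 8 *+ 6 + a 2 * a 4 *+ 6 + a 4 * a 8 *+ 12) * conic2)%LC).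
by ring.
Qed.

Lemma row_114 : a 1 * a 1 * a 1 * a 4 =
  a 1 * a 2 * a 4 * a 8 *+ 6 + a 1 * a 4 ^+ 3 *+ 9 - a 1 * a 4 * a 8 ^+ 2 *+
  12 + a 2 * a 4 ^+ 2 * a 8 *+ 12 + a 4 ^+ 4 *+ 10 - a 4 ^+ 2 * a 8 ^+ 2 *+ 24.
Proof.
apply: (lincomb (
  (a 1 * a 4 + a 4 ^+ 2 *+ 2) * conic +
  (a 1 * a 4 *+ 3 + a 4 ^+ 2 *+ 6) * conic2)%LC).
by ring.
Qed.

Lemma row_118 : a 1 * a 1 * a 1 * a 8 =
  a 1 * a 2 * a 8 ^+ 2 *+ 6 + a 1 * a 4 ^+ 2 * a 8 *+ 9 - a 1 * a 8 ^+ 3 *+ 12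
  + a 2 * a 4 * a 8 ^+ 2 *+ 12 + a 4 ^+ 3 * a 8 *+ 10 - a 4 * a 8 ^+ 3 *+ 24.
Proof.
apply: (lincomb (
  (a 1 * a 8 + a 4 * a 8 *+ 2) * conic +
  (a 1 * a 8 *+ 3 + a 4 * a 8 *+ 6) * conic2)%LC).
by ring.
Qed.

Lemma row_122 : a 1 * a 1 * a 2 * a 2 =
  a 1 * a 2 * a 4 * a 8 *+ 4 + a 1 * a 4 ^+ 3 *+ 6 - a 1 * a 4 * a 8 ^+ 2 *+ 8
  + a 2 * a 4 ^+ 2 * a 8 *+ 28 - a 2 * a 8 ^+ 3 *+ 24 + a 4 ^+ 4 *+ 15 - a 4
  ^+ 2 * a 8 ^+ 2 *+ 20.
Proof.
apply: (lincomb (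
  (a 2 ^+ 2) * conic +
  (a 1 * a 4 *+ 2 + a 2 ^+ 2 *+ 3 + a 2 * a 8 *+ 6 + a 4 ^+ 2 *+ 5) * conic2)%LC).
by ring.
Qed.

Lemma row_124 : a 1 * a 1 * a 2 * a 4 =
  a 1 * a 2 * a 4 ^+ 2 *+ 2 + a 2 * a 4 ^+ 3 *+ 5 + a 4 ^+ 3 * a 8 *+ 18 - a 4
  * a 8 ^+ 3 *+ 24.
Proof.
apply: (lincomb (
  (a 2 * a 4) * conic +
  (a 2 * a 4 *+ 3 + a 4 * a 8 *+ 6) * conic2)%LC).
by ring.
Qed.

Lemma row_128 : a 1 * a 1 * a 2 * a 8 =
  a 1 * a 2 * a 4 * a 8 *+ 2 + a 2 * a 4 ^+ 2 * a 8 *+ 5 + a 4 ^+ 2 * a 8 ^+ 2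
  *+ 18 - a 8 ^+ 4 *+ 24.
Proof.
apply: (lincomb (
  (a 2 * a 8) * conic +
  (a 2 * a 8 *+ 3 + a 8 ^+ 2 *+ 6) * conic2)%LC).
by ring.
Qed.

Lemma row_144 : a 1 * a 1 * a 4 * a 4 =
  a 1 * a 4 ^+ 3 *+ 2 + a 2 * a 4 ^+ 2 * a 8 *+ 6 + a 4 ^+ 4 *+ 5 - a 4 ^+ 2 *
  a 8 ^+ 2 *+ 12.
Proof.
apply: (lincomb (
  (a 4 ^+ 2) * conic +
  (a 4 ^+ 2 *+ 3) * conic2)%LC).
by ring.
Qed.

Lemma row_148 : a 1 * a 1 * a 4 * a 8 =
  a 1 * a 4 ^+ 2 * a 8 *+ 2 + a 2 * a 4 * a 8 ^+ 2 *+ 6 + a 4 ^+ 3 * a 8 *+ 5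
  - a 4 * a 8 ^+ 3 *+ 12.
Proof.
apply: (lincomb (
  (a 4 * a 8) * conic +
  (a 4 * a 8 *+ 3) * conic2)%LC).
by ring.
Qed.

Lemma row_188 : a 1 * a 1 * a 8 * a 8 =
  a 1 * a 4 * a 8 ^+ 2 *+ 2 + a 2 * a 8 ^+ 3 *+ 6 + a 4 ^+ 2 * a 8 ^+ 2 *+ 5 -
  a 8 ^+ 4 *+ 12.
Proof.
apply: (lincomb (
  (a 8 ^+ 2) * conic +
  (a 8 ^+ 2 *+ 3) * conic2)%LC).
by ring.
Qed.

Lemma row_222 : a 1 * a 2 * a 2 * a 2 =
  a 1 * a 2 * a 4 ^+ 2 *+ 3 + a 1 * a 4 ^+ 2 * a 8 *+ 6 - a 1 * a 8 ^+ 3 *+ 8.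
Proof.
apply: (lincomb (
  (a 1 * a 2 + a 1 * a 8 *+ 2) * conic2)%LC).
by ring.
Qed.

Lemma row_224 : a 1 * a 2 * a 2 * a 4 =
  a 1 * a 2 * a 4 * a 8 *+ 2 + a 1 * a 4 ^+ 3 *+ 3 - a 1 * a 4 * a 8 ^+ 2 *+ 4.
Proof.
apply: (lincomb (
  (a 1 * a 4) * conic2)%LC).
by ring.
Qed.

Lemma row_228 : a 1 * a 2 * a 2 * a 8 =
  a 1 * a 2 * a 8 ^+ 2 *+ 2 + a 1 * a 4 ^+ 2 * a 8 *+ 3 - a 1 * a 8 ^+ 3 *+ 4.
Proof.
apply: (lincomb (
  (a 1 * a 8) * conic2)%LC).
by ring.
Qed.

Lemma row_244 : a 1 * a 2 * a 4 * a 4 =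
  a 1 * a 2 * a 4 ^+ 2.
Proof. by ring. Qed.

Lemma row_248 : a 1 * a 2 * a 4 * a 8 =
  a 1 * a 2 * a 4 * a 8.
Proof. by ring. Qed.

Lemma row_288 : a 1 * a 2 * a 8 * a 8 =
  a 1 * a 2 * a 8 ^+ 2.
Proof. by ring. Qed.

Lemma row_444 : a 1 * a 4 * a 4 * a 4 =
  a 1 * a 4 ^+ 3.
Proof. by ring. Qed.

Lemma row_448 : a 1 * a 4 * a 4 * a 8 =
  a 1 * a 4 ^+ 2 * a 8.
Proof. by ring. Qed.

Lemma row_488 : a 1 * a 4 * a 8 * a 8 =
  a 1 * a 4 * a 8 ^+ 2.
Proof. by ring. Qed.

Lemma row_888 : a 1 * a 8 * a 8 * a 8 =
  a 1 * a 8 ^+ 3.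
Proof. by ring. Qed.

(** * The representation numbers *)

Lemma counts_Qform c1 c2 c3 : (0 < c1)%N -> (0 < c2)%N -> (0 < c3)%N ->
  counts {ffun 'I_8 -> int} (Qform c1 c2 c3) (a 1 * a c1 * a c2 * a c3).
Proof.
move=> c1p c2p c3p.
have ca c : (0 < c)%N -> counts _ (fun p => c%:Z * quad2 p) (a c).
  by move=> c0; rewrite -[c in a c]muln1 -Va // -theta_lambert; exact: counts_scale
      counts_theta.
have c0 : counts _ quad2 (a 1) by rewrite -theta_lambert; exact: counts_theta.
have pos c p : 0 <= c%:Z * quad2 p by rewrite mulr_ge0 ?quad2_ge0.
have k1 := counts_add _ _ _ _ _ _ quad2_ge0 (pos c1) c0 (ca c1 c1p).
have pos1 p : 0 <= quad2 p.1 + c1%:Z * quad2 p.2 by rewrite addr_ge0 ?quad2_ge0.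
have k2 := counts_add _ _ _ _ _ _ pos1 (pos c2) k1 (ca c2 c2p).
have pos2 p : 0 <= quad2 p.1.1 + c1%:Z * quad2 p.1.2 + c2%:Z * quad2 p.2.
  by rewrite addr_ge0.
have k3 := counts_add _ _ _ _ _ _ pos2 (pos c3) k2 (ca c3 c3p).
pose f (x : (int * int) * (int * int) * (int * int) * (int * int)) : {ffun 'I_8 -> int} :=
  [ffun i : 'I_8 => nth 0 [:: x.1.1.1.1; x.1.1.1.2; x.1.1.2.1; x.1.1.2.2;
                             x.1.2.1; x.1.2.2; x.2.1; x.2.2] i].
pose g (y : {ffun 'I_8 -> int}) : (int * int) * (int * int) * (int * int) * (int * int) :=
  ((y (inord 0), y (inord 1)), (y (inord 2), y (inord 3)),
   (y (inord 4), y (inord 5)), (y (inord 6), y (inord 7))).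
apply: (counts_bij _ _ _ _ _ f g _ _ _ k3).
- by move=> [[[[x0 x1] [x2 x3]] [x4 x5]] [x6 x7]]; rewrite /g /f !ffunE !inordK.
- move=> y; apply/ffunP => i; rewrite ffunE /=.
  case: i => -[|[|[|[|[|[|[|[|i]]]]]]]] Hi //=; congr (y _); apply: val_inj;
  by rewrite /= inordK.
- by move=> x; rewrite /Qform /f !ffunE !inordK.
Qed.

(** The weights of the table are fractions, so the comparison is made coefficientwise over [rat]. *)
Definition cf (n : nat) (f : fps) : rat := (f n)%:~R.

Lemma cfD n f g : cf n (f + g) = cf n f + cf n g.
Proof. by rewrite /cf fpsD rmorphD. Qed.
Lemma cfN n f : cf n (- f) = - cf n f.
Proof. by rewrite /cf fpsN rmorphN. Qed.
Lemma cfMn n f k : cf n (f *+ k) = cf n f *+ k.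
Proof. by rewrite /cf fpsMn rmorphMn. Qed.

Lemma cf_trans n f g x y : f = g -> cf n f = x -> cf n g = y -> x = y.
Proof. by move=> -> <- <-. Qed.
Lemma cf_eqD n f g x y : cf n f = x -> cf n g = y -> cf n (f + g) = x + y.
Proof. by move=> <- <-; exact: cfD. Qed.
Lemma cf_eqN n f x : cf n f = x -> cf n (- f) = - x.
Proof. by move=> <-; exact: cfN. Qed.
Lemma cf_eqMn n f k x : cf n f = x -> cf n (f *+ k) = x *+ k.
Proof. by move=> <-; exact: cfMn. Qed.

Ltac cf_eval := repeat lazymatch goal with
  | |- cf _ (_ + _) = _ => apply cf_eqD
  | |- cf _ (- _) = _ => apply cf_eqN
  | |- cf _ (_ *+ _) = _ => apply cf_eqMn
  | |- cf _ _ = _ => apply erefl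
  end.

(** Reads an equation of series at index n as a linear equation in the coefficients of single
    monomials and single f_i; unification computes both sides. *)
Ltac cf_have n e :=
  let x := fresh in let y := fresh in
  evar (x : rat); evar (y : rat); have : x = y;
  [apply: (cf_trans n _ _ _ _ e); rewrite /x /y; cf_eval | rewrite /x /y {x y}].

(** Forgetting what these coefficients are leaves pure linear algebra over the rationals, which
    [lra] decides. *)
Ltac cf_abstract := repeat match goal with
  | |- context [cf ?n ?f] => generalize (cf n f); intro
  end; intros.

Lemma sum_A nu n : \sum_(i < 16) nu`_i * (A i.+1 n)%:~R =
  nu`_0 * cf n (E 1) + nu`_1 * cf n (E 2) + nu`_2 * cf n (E 3) + nu`_3 * cf n (E 4)
  + nu`_4 * cf n (E 6) + nu`_5 * cf n (E 8) + nu`_6 * cf n (E 12) + nu`_7 * cf n (E 24)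
  + nu`_8 * cf n f4_6 + nu`_9 * cf n (V 2 f4_6) + nu`_10 * cf n (V 4 f4_6)
  + nu`_11 * cf n f4_8 + nu`_12 * cf n (V 3 f4_8) + nu`_13 * cf n f4_12
  + nu`_14 * cf n (V 2 f4_12) + nu`_15 * cf n (odds f4_24) :> rat.
Proof. by rewrite -!E4tE // !big_ord_recl big_ord0 /= addr0 !addrA. Qed.

(** In this and the following rows the normal forms supplied are those of the f_i with non-zero
    weight, together with that of the theta product. *)
Lemma fourier_112 n : cf n (a 1 * a 1 * a 1 * a 2) =
  \sum_(i < 16)
   [:: fr 3 40; fr (-1) 5; fr (-27) 40; 0; fr 9 5; 0; 0; 0; 0; 0; 0; 0; 0; 0; 0; 0]`_i
   * (A i.+1 n)%:~R.
Proof.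
rewrite sum_A /= /fr.
cf_have n nf_1.
cf_have n nf_2.
cf_have n nf_3.
cf_have n nf_5.
cf_have n row_112.
cf_abstract; lra.
Qed.

Lemma fourier_114 n : cf n (a 1 * a 1 * a 1 * a 4) =
  \sum_(i < 16)
   [:: fr 3 100; fr (-9) 100; fr 27 100; fr 4 25; fr (-81) 100; 0; fr 36 25; 0; fr 54
       5; fr 432 5; 0; 0; 0; 0; 0; 0]`_i
   * (A i.+1 n)%:~R.
Proof.
rewrite sum_A /= /fr.
cf_have n nf_1.
cf_have n nf_2.
cf_have n nf_3.
cf_have n nf_4.
cf_have n nf_5.
cf_have n nf_7.
cf_have n nf_9.
cf_have n nf_10.
cf_have n row_114.
cf_abstract; lra.
Qed.

Lemma fourier_118 n : cf n (a 1 * a 1 * a 1 * a 8) =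
  \sum_(i < 16)
   [:: fr 3 160; fr (-9) 160; fr (-27) 160; fr 9 80; fr 81 160; fr (-1) 5; fr (-81)
       80; fr 9 5; 0; 0; 0; fr (-27) 4; fr 243 4; 0; fr 81 1; fr 81 4]`_i
   * (A i.+1 n)%:~R.
Proof.
rewrite sum_A /= /fr.
cf_have n nf_1.
cf_have n nf_2.
cf_have n nf_3.
cf_have n nf_4.
cf_have n nf_5.
cf_have n nf_6.
cf_have n nf_7.
cf_have n nf_8.
cf_have n nf_12.
cf_have n nf_13.
cf_have n nf_15.
cf_have n nf_16.
cf_have n row_118.
cf_abstract; lra.
Qed.

Lemma fourier_122 n : cf n (a 1 * a 1 * a 2 * a 2) =
  \sum_(i < 16)
   [:: fr 1 50; fr 2 25; fr 9 50; 0; fr 18 25; 0; 0; 0; fr 36 5; 0; 0; 0; 0; 0; 0; 0]`_i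
   * (A i.+1 n)%:~R.
Proof.
rewrite sum_A /= /fr.
cf_have n nf_1.
cf_have n nf_2.
cf_have n nf_3.
cf_have n nf_5.
cf_have n nf_9.
cf_have n row_122.
cf_abstract; lra.
Qed.

Lemma fourier_124 n : cf n (a 1 * a 1 * a 2 * a 4) =
  \sum_(i < 16)
   [:: fr 1 80; fr 1 16; fr (-9) 80; fr (-1) 5; fr (-9) 16; 0; fr 9 5; 0; 0; 0; 0; 0;
       0; fr 9 1; 0; 0]`_i
   * (A i.+1 n)%:~R.
Proof.
rewrite sum_A /= /fr.
cf_have n nf_1.
cf_have n nf_2.
cf_have n nf_3.
cf_have n nf_4.
cf_have n nf_5.
cf_have n nf_7.
cf_have n nf_14.
cf_have n row_124.
cf_abstract; lra.
Qed.

Lemma fourier_128 n : cf n (a 1 * a 1 * a 2 * a 8) =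
  \sum_(i < 16)
   [:: fr 1 200; fr 1 40; fr 9 200; fr (-9) 100; fr 9 40; fr 4 25; fr (-81) 100; fr
       36 25; fr 9 5; fr 144 5; fr 1152 5; fr 9 1; fr 81 1; 0; 0; 0]`_i
   * (A i.+1 n)%:~R.
Proof.
rewrite sum_A /= /fr.
cf_have n nf_1.
cf_have n nf_2.
cf_have n nf_3.
cf_have n nf_4.
cf_have n nf_5.
cf_have n nf_6.
cf_have n nf_7.
cf_have n nf_8.
cf_have n nf_9.
cf_have n nf_10.
cf_have n nf_11.
cf_have n nf_12.
cf_have n nf_13.
cf_have n row_128.
cf_abstract; lra.
Qed.

Lemma fourier_144 n : cf n (a 1 * a 1 * a 4 * a 4) =
  \sum_(i < 16)
   [:: fr 1 200; fr 3 200; fr 9 200; fr 2 25; fr 27 200; 0; fr 18 25; 0; fr 54 5; fr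
       216 5; 0; 0; 0; 0; 0; 0]`_i
   * (A i.+1 n)%:~R.
Proof.
rewrite sum_A /= /fr.
cf_have n nf_1.
cf_have n nf_2.
cf_have n nf_3.
cf_have n nf_4.
cf_have n nf_5.
cf_have n nf_7.
cf_have n nf_9.
cf_have n nf_10.
cf_have n row_144.
cf_abstract; lra.
Qed.

Lemma fourier_148 n : cf n (a 1 * a 1 * a 4 * a 8) =
  \sum_(i < 16)
   [:: fr 1 320; fr 3 320; fr (-9) 320; fr 1 16; fr (-27) 320; fr (-1) 5; fr (-9) 16;
       fr 9 5; 0; 0; 0; fr 9 4; fr (-81) 4; fr 9 4; fr 27 1; fr 27 4]`_i
   * (A i.+1 n)%:~R.
Proof.
rewrite sum_A /= /fr.
cf_have n nf_1.
cf_have n nf_2.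
cf_have n nf_3.
cf_have n nf_4.
cf_have n nf_5.
cf_have n nf_6.
cf_have n nf_7.
cf_have n nf_8.
cf_have n nf_12.
cf_have n nf_13.
cf_have n nf_14.
cf_have n nf_15.
cf_have n nf_16.
cf_have n row_148.
cf_abstract; lra.
Qed.

Lemma fourier_188 n : cf n (a 1 * a 1 * a 8 * a 8) =
  \sum_(i < 16)
   [:: fr 1 800; fr 3 800; fr 9 800; fr 3 200; fr 27 800; fr 2 25; fr 27 200; fr 18
       25; fr 36 5; fr 234 5; fr 576 5; fr 9 2; fr 81 2; 0; 0; 0]`_i
   * (A i.+1 n)%:~R.
Proof.
rewrite sum_A /= /fr.
cf_have n nf_1.
cf_have n nf_2.
cf_have n nf_3.
cf_have n nf_4.
cf_have n nf_5.
cf_have n nf_6.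
cf_have n nf_7.
cf_have n nf_8.
cf_have n nf_9.
cf_have n nf_10.
cf_have n nf_11.
cf_have n nf_12.
cf_have n nf_13.
cf_have n row_188.
cf_abstract; lra.
Qed.

Lemma fourier_222 n : cf n (a 1 * a 2 * a 2 * a 2) =
  \sum_(i < 16)
   [:: fr 1 40; fr (-3) 20; fr (-9) 40; 0; fr 27 20; 0; 0; 0; 0; 0; 0; 0; 0; 0; 0; 0]`_i
   * (A i.+1 n)%:~R.
Proof.
rewrite sum_A /= /fr.
cf_have n nf_1.
cf_have n nf_2.
cf_have n nf_3.
cf_have n nf_5.
cf_have n row_222.
cf_abstract; lra.
Qed.

Lemma fourier_224 n : cf n (a 1 * a 2 * a 2 * a 4) =
  \sum_(i < 16)
   [:: fr 1 100; fr (-7) 100; fr 9 100; fr 4 25; fr (-63) 100; 0; fr 36 25; 0; fr 18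
       5; fr 72 5; 0; 0; 0; 0; 0; 0]`_i
   * (A i.+1 n)%:~R.
Proof.
rewrite sum_A /= /fr.
cf_have n nf_1.
cf_have n nf_2.
cf_have n nf_3.
cf_have n nf_4.
cf_have n nf_5.
cf_have n nf_7.
cf_have n nf_9.
cf_have n nf_10.
cf_have n row_224.
cf_abstract; lra.
Qed.

Lemma fourier_228 n : cf n (a 1 * a 2 * a 2 * a 8) =
  \sum_(i < 16)
   [:: fr 1 160; fr (-7) 160; fr (-9) 160; fr 9 80; fr 63 160; fr (-1) 5; fr (-81)
       80; fr 9 5; 0; 0; 0; fr (-9) 4; fr 81 4; 0; fr 9 1; fr 27 4]`_i
   * (A i.+1 n)%:~R.
Proof.
rewrite sum_A /= /fr.
cf_have n nf_1.
cf_have n nf_2.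
cf_have n nf_3.
cf_have n nf_4.
cf_have n nf_5.
cf_have n nf_6.
cf_have n nf_7.
cf_have n nf_8.
cf_have n nf_12.
cf_have n nf_13.
cf_have n nf_15.
cf_have n nf_16.
cf_have n row_228.
cf_abstract; lra.
Qed.

Lemma fourier_244 n : cf n (a 1 * a 2 * a 4 * a 4) =
  \sum_(i < 16)
   [:: fr 1 160; fr (-1) 32; fr (-9) 160; fr (-1) 10; fr 9 32; 0; fr 9 10; 0; 0; 0;
       0; 0; 0; fr 9 2; 0; 0]`_i
   * (A i.+1 n)%:~R.
Proof.
rewrite sum_A /= /fr.
cf_have n nf_1.
cf_have n nf_2.
cf_have n nf_3.
cf_have n nf_4.
cf_have n nf_5.
cf_have n nf_7.
cf_have n nf_14.
cf_have n row_244.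
cf_abstract; lra.
Qed.

Lemma fourier_248 n : cf n (a 1 * a 2 * a 4 * a 8) =
  \sum_(i < 16)
   [:: fr 1 400; fr (-1) 80; fr 9 400; fr (-1) 20; fr (-9) 80; fr 4 25; fr (-9) 20;
       fr 36 25; fr 9 10; fr 27 5; fr 72 5; fr 9 2; fr 81 2; 0; 0; 0]`_i
   * (A i.+1 n)%:~R.
Proof.
rewrite sum_A /= /fr.
cf_have n nf_1.
cf_have n nf_2.
cf_have n nf_3.
cf_have n nf_4.
cf_have n nf_5.
cf_have n nf_6.
cf_have n nf_7.
cf_have n nf_8.
cf_have n nf_9.
cf_have n nf_10.
cf_have n nf_11.
cf_have n nf_12.
cf_have n nf_13.
cf_have n row_248.
cf_abstract; lra.
Qed.

Lemma fourier_288 n : cf n (a 1 * a 2 * a 8 * a 8) =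
  \sum_(i < 16)
   [:: fr 1 640; fr (-1) 128; fr (-9) 640; fr (-3) 160; fr 9 128; fr (-1) 10; fr 27
       160; fr 9 10; 0; 0; 0; fr (-9) 8; fr 81 8; fr 27 8; fr 9 2; fr 27 8]`_i
   * (A i.+1 n)%:~R.
Proof.
rewrite sum_A /= /fr.
cf_have n nf_1.
cf_have n nf_2.
cf_have n nf_3.
cf_have n nf_4.
cf_have n nf_5.
cf_have n nf_6.
cf_have n nf_7.
cf_have n nf_8.
cf_have n nf_12.
cf_have n nf_13.
cf_have n nf_14.
cf_have n nf_15.
cf_have n nf_16.
cf_have n row_288.
cf_abstract; lra.
Qed.

Lemma fourier_444 n : cf n (a 1 * a 4 * a 4 * a 4) =
  \sum_(i < 16)
   [:: fr 1 400; fr (-9) 400; fr 9 400; fr 3 25; fr (-81) 400; 0; fr 27 25; 0; fr 27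
       5; fr 54 5; 0; 0; 0; 0; 0; 0]`_i
   * (A i.+1 n)%:~R.
Proof.
rewrite sum_A /= /fr.
cf_have n nf_1.
cf_have n nf_2.
cf_have n nf_3.
cf_have n nf_4.
cf_have n nf_5.
cf_have n nf_7.
cf_have n nf_9.
cf_have n nf_10.
cf_have n row_444.
cf_abstract; lra.
Qed.

Lemma fourier_448 n : cf n (a 1 * a 4 * a 4 * a 8) =
  \sum_(i < 16)
   [:: fr 1 640; fr (-9) 640; fr (-9) 640; fr 7 80; fr 81 640; fr (-1) 5; fr (-63)
       80; fr 9 5; 0; 0; 0; fr 9 8; fr (-81) 8; fr 9 8; 0; fr 27 8]`_i
   * (A i.+1 n)%:~R.
Proof.
rewrite sum_A /= /fr.
cf_have n nf_1.
cf_have n nf_2.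
cf_have n nf_3.
cf_have n nf_4.
cf_have n nf_5.
cf_have n nf_6.
cf_have n nf_7.
cf_have n nf_8.
cf_have n nf_12.
cf_have n nf_13.
cf_have n nf_14.
cf_have n nf_16.
cf_have n row_448.
cf_abstract; lra.
Qed.

Lemma fourier_488 n : cf n (a 1 * a 4 * a 8 * a 8) =
  \sum_(i < 16)
   [:: fr 1 1600; fr (-9) 1600; fr 9 1600; fr 1 40; fr (-81) 1600; fr 2 25; fr 9 40;
       fr 18 25; fr 18 5; fr 36 5; fr 36 5; fr 9 4; fr 81 4; 0; 0; 0]`_i
   * (A i.+1 n)%:~R.
Proof.
rewrite sum_A /= /fr.
cf_have n nf_1.
cf_have n nf_2.
cf_have n nf_3.
cf_have n nf_4.
cf_have n nf_5.
cf_have n nf_6.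
cf_have n nf_7.
cf_have n nf_8.
cf_have n nf_9.
cf_have n nf_10.
cf_have n nf_11.
cf_have n nf_12.
cf_have n nf_13.
cf_have n row_488.
cf_abstract; lra.
Qed.

Lemma fourier_888 n : cf n (a 1 * a 8 * a 8 * a 8) =
  \sum_(i < 16)
   [:: fr 1 2560; fr (-9) 2560; fr (-9) 2560; fr 9 320; fr 81 2560; fr (-3) 20; fr
       (-81) 320; fr 27 20; 0; 0; 0; fr 27 32; fr (-243) 32; fr 81 32; 0; fr 81 32]`_i
   * (A i.+1 n)%:~R.
Proof.
rewrite sum_A /= /fr.
cf_have n nf_1.
cf_have n nf_2.
cf_have n nf_3.
cf_have n nf_4.
cf_have n nf_5.
cf_have n nf_6.
cf_have n nf_7.
cf_have n nf_8.
cf_have n nf_12.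
cf_have n nf_13.
cf_have n nf_14.
cf_have n nf_16.
cf_have n row_888.
cf_abstract; lra.
Qed.

(* For each of the 19 triples (c1,c2,c3) of the table and every n : nat, the set of
   x in Z^8 with Q(x) = n is finite (given as a duplicate-free list s) and its
   cardinality M(1,c1,c2,c3;n) equals sum_{i=1}^{16} nu_i A_i(n). *)
Theorem theorem2p2 (c1 c2 c3 : nat) (nu : seq rat) :
  ((c1, c2, c3), nu) \in nu_table ->
  forall n : nat,
  exists s : seq {ffun 'I_8 -> int},
    [/\ uniq s,
        (forall x : {ffun 'I_8 -> int}, (x \in s) = (Qform c1 c2 c3 x == n%:Z)) &
        (size s)%:R = \sum_(i < 16) nu`_i * (A i.+1 n)%:~R].
Proof.
move=> tab n.
have [c1p c2p c3p row] : [/\ (0 < c1)%N, (0 < c2)%N, (0 < c3)%N &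
    cf n (a 1 * a c1 * a c2 * a c3) = \sum_(i < 16) nu`_i * (A i.+1 n)%:~R].
  move: tab; rewrite !inE.
  case/orP=> [/eqP[-> -> -> ->]|]; first by split=> //; exact: fourier_112.
  case/orP=> [/eqP[-> -> -> ->]|]; first by split=> //; exact: fourier_114.
  case/orP=> [/eqP[-> -> -> ->]|]; first by split=> //; exact: fourier_118.
  case/orP=> [/eqP[-> -> -> ->]|]; first by split=> //; exact: fourier_122.
  case/orP=> [/eqP[-> -> -> ->]|]; first by split=> //; exact: fourier_124.
  case/orP=> [/eqP[-> -> -> ->]|]; first by split=> //; exact: fourier_128.
  case/orP=> [/eqP[-> -> -> ->]|]; first by split=> //; exact: fourier_144.
  case/orP=> [/eqP[-> -> -> ->]|]; first by split=> //; exact: fourier_148.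
  case/orP=> [/eqP[-> -> -> ->]|]; first by split=> //; exact: fourier_188.
  case/orP=> [/eqP[-> -> -> ->]|]; first by split=> //; exact: fourier_222.
  case/orP=> [/eqP[-> -> -> ->]|]; first by split=> //; exact: fourier_224.
  case/orP=> [/eqP[-> -> -> ->]|]; first by split=> //; exact: fourier_228.
  case/orP=> [/eqP[-> -> -> ->]|]; first by split=> //; exact: fourier_244.
  case/orP=> [/eqP[-> -> -> ->]|]; first by split=> //; exact: fourier_248.
  case/orP=> [/eqP[-> -> -> ->]|]; first by split=> //; exact: fourier_288.
  case/orP=> [/eqP[-> -> -> ->]|]; first by split=> //; exact: fourier_444.
  case/orP=> [/eqP[-> -> -> ->]|]; first by split=> //; exact: fourier_448.
  case/orP=> [/eqP[-> -> -> ->]|]; first by split=> //; exact: fourier_488.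
  by move=> /eqP[-> -> -> ->]; split=> //; exact: fourier_888.
have [s [us ms ss]] := counts_Qform _ _ _ c1p c2p c3p n.
by exists s; split=> //; rewrite -row /cf -ss.
Qed.
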